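(* Let $\alpha\ge 0$ and let $(\boldsymbol\theta_n,\mathbf x_n,X_n)_{n\ge 0}$ be generated by the SA-SRRW recursion described in the context, under Assumptions (A1), (A2) and (A4) listed there. Then $$\mathbf x_n \xrightarrow[n\to\infty]{} \boldsymbol\mu \quad\text{almost surely},\qquad \gamma_n^{-1/2}(\mathbf x_n-\boldsymbol\mu)\xrightarrow[n\to\infty]{} N(\mathbf 0,\mathbf V_{\mathbf x}(\alpha))\quad\text{in distribution},$$ where $$\mathbf V_{\mathbf x}(\alpha)=\sum_{i=1}^{N-1}\frac{1}{2\alpha(1+\lambda_i)+2-\mathbf 1_{\{a=1\}}}\cdot\frac{1+\lambda_i}{1-\lambda_i}\,\mathbf u_i\mathbf u_i^T .$$ Moreover, for all $\alpha_2>\alpha_1>0$, we have $\mathbf V_{\mathbf x}(\alpha_2)<_L\mathbf V_{\mathbf x}(\alpha_1)<_L\mathbf V_{\mathbf x}(0)$.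
   Context: **Base chain.** $\mathcal N$ is a finite set with $N=|\mathcal N|\ge 2$ elements, identified with $\{1,\dots,N\}$. $\Sigma$ is the probability simplex in $\mathbb R^N$ and $\mathrm{Int}(\Sigma)$ its (relative) interior, i.e. the probability vectors with all entries positive. $\mathbf P=[P_{ij}]$ is the transition matrix of an ergodic Markov chain on $\mathcal N$ with stationary distribution $\boldsymbol\mu=[\mu_i]\in\mathrm{Int}(\Sigma)$, time-reversible: $\mu_iP_{ij}=\mu_jP_{ji}$ for all $i,j$. Its eigenvalues are ordered $-1<\lambda_1\le\cdots\le\lambda_{N-1}<\lambda_N=1$, with left eigenvectors $\mathbf u_i$ and right eigenvectors $\mathbf v_i$, $\mathbf u_N=\boldsymbol\mu$, $\mathbf v_N=\mathbf 1$ (all-ones vector), normalized so that $\mathbf u_i^T\mathbf v_i=1$, $\mathbf u_i^T\mathbf v_j=0$ for $i\ne j$, and $\mathbf u_i=\mathrm{diag}(\boldsymbol\mu)\mathbf v_i$. **SRRW kernel.** For $\alpha\ge0$ and $\mathbf x\in\mathrm{Int}(\Sigma)$, $$K_{ij}[\mathbf x]=\frac{P_{ij}(x_j/\mu_j)^{-\alpha}}{\sum_{k\in\mathcal N}P_{ik}(x_k/\mu_k)^{-\alpha}},\qquad i,j\in\mathcal N.$$ **SA-SRRW recursion.** Given $H:\mathbb R^D\times\mathcal N\to\mathbb R^D$, step sizes $\{\beta_n\},\{\gamma_n\}$ and an initial point $(\boldsymbol\theta_0,\mathbf x_0,X_0)\in\mathbb R^D\times\mathrm{Int}(\Sigma)\times\mathcal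 N$, for $n\ge 0$: draw $X_{n+1}$, conditionally on the past, from the distribution $\mathbf K_{X_n,\cdot}[\mathbf x_n]$; then set $$\mathbf x_{n+1}=\mathbf x_n+\gamma_{n+1}(\boldsymbol\delta_{X_{n+1}}-\mathbf x_n),\qquad \boldsymbol\theta_{n+1}=\boldsymbol\theta_n+\beta_{n+1}H(\boldsymbol\theta_n,X_{n+1}),$$ where $\boldsymbol\delta_j\in\mathbb R^N$ is the $j$-th standard basis vector. $\mathbb P_{\boldsymbol\theta_0,\mathbf x_0,X_0}$ is the law of the process with this initial point. **Assumptions.** (A1) $H(\cdot,i)$ is continuous at every $\boldsymbol\theta\in\mathbb R^D$, and there is $L>0$ with $\|H(\boldsymbol\theta,i)\|\le L(1+\|\boldsymbol\theta\|)$ for all $\boldsymbol\theta\in\mathbb R^D$, $i\in\mathcal N$. (A2) $\beta_n=(n+1)^{-b}$ and $\gamma_n=(n+1)^{-a}$ with $a,b\in(0.5,1]$. (A4) For any $(\boldsymbol\theta_0,\mathbf x_0,X_0)\in\mathbb R^D\times\mathrm{Int}(\Sigma)\times\mathcal N$, the sequence $\{\boldsymbol\theta_n\}_{n\ge0}$ (resp. $\{\mathbf x_n\}_{n\ge0}$) is $\mathbb P_{\boldsymbol\theta_0,\mathbf x_0,X_0}$-almost surely contained within a compact subset of $\mathbb R^D$ (resp. $\mathrm{Int}(\Sigma)$). **Notation.** For symmetric matrices, $\mathbf M_1<_L\mathbf M_2$ means that $\mathbf M_2-\mathbf M_1$ is positive semi-definite and $\mathbf M_1\ne\mathbf M_2$.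 $\mathbf 1_{\{\cdot\}}$ is an indicator. *)

(* Defs.v *)
From HB Require Import structures.
From mathcomp Require Import all_boot all_order all_algebra.
From mathcomp Require Import all_classical all_reals all_analysis.
Import Order.TTheory GRing.Theory Num.Theory.
Import numFieldNormedType.Exports.

Set Implicit Arguments.
Unset Strict Implicit.
Unset Printing Implicit Defensive.

Local Open Scope classical_set_scope.
Local Open Scope ring_scope.

(* The state space with N elements is 'I_N; all vectors are column vectors. *)

Definition int_simplex (R : realType) (N : nat) : set 'cV[R]_N :=
  [set x | (forall i, 0 < x i 0) /\ \sum_(i < N) x i 0 = 1].

Record ergodic_reversible (R : realType) (N : nat) (P : 'M[R]_N)
    (mu : 'cV[R]_N) : Prop := ErgodicReversible {
  trans_ge0 : forall i j, 0 <= P i j;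
  trans_sum1 : forall i, \sum_(j < N) P i j = 1;
  irreducible : forall i j, exists n : nat, 0 < (P ^+ n) i j;
  aperiodic : forall (i : 'I_N) (d : nat),
    (forall n : nat, (0 < n)%N -> 0 < (P ^+ n) i i -> (d %| n)%N) -> d = 1%N;
  mu_int_simplex : int_simplex mu;
  mu_stationary : mu^T *m P = mu^T;
  mu_reversible : forall i j, mu i 0 * P i j = mu j 0 * P j i
}.

(* The eigenvalues are indexed from 0, so that the eigenvalue 1 is the one of
   index N.-1.  Biorthogonality makes v a basis of eigenvectors, hence lambda
   lists every eigenvalue of P with its multiplicity. *)
Record spectral_decomposition (R : realType) (N : nat) (P : 'M[R]_N)
    (mu : 'cV[R]_N) (lambda : 'I_N -> R) (u v : 'I_N -> 'cV[R]_N) : Prop :=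
    SpectralDecomposition {
  lambda_le : forall i j : 'I_N, (i <= j)%N -> lambda i <= lambda j;
  lambda_gtN1 : forall i : 'I_N, -1 < lambda i;
  lambda_lt1 : forall i : 'I_N, (i < N.-1)%N -> lambda i < 1;
  lambda_last : forall i : 'I_N, nat_of_ord i = N.-1 ->
    [/\ lambda i = 1, u i = mu & v i = const_mx 1];
  left_eigen : forall i, (u i)^T *m P = lambda i *: (u i)^T;
  right_eigen : forall i, P *m v i = lambda i *: v i;
  biorthonormal : forall i j, ((u i)^T *m v j) 0 0 = (i == j)%:R;
  left_right : forall i, u i = diag_mx mu^T *m v i
}.

Definition srrw_weight (R : realType) (N : nat) (mu : 'cV[R]_N) (alpha : R)
    (x : 'cV[R]_N) (j : 'I_N) : R :=
  (x j 0 / mu j 0) `^ (- alpha).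

Definition srrw_kernel (R : realType) (N : nat) (P : 'M[R]_N) (mu : 'cV[R]_N)
    (alpha : R) (x : 'cV[R]_N) (i j : 'I_N) : R :=
  P i j * srrw_weight mu alpha x j /
    \sum_(k < N) P i k * srrw_weight mu alpha x k.

Definition step_size (R : realType) (c : R) (n : nat) : R :=
  n.+1%:R `^ (- c).

Definition past (R : realType) (N D : nat) (Omega : Type)
    (theta : nat -> Omega -> 'cV[R]_D) (x : nat -> Omega -> 'cV[R]_N)
    (X : nat -> Omega -> 'I_N) (n : nat) : set (set Omega) :=
  <<s [set A | exists2 k, (k <= n)%N &
    [\/ exists j (B : set R),
          measurable B /\ A = [set w | B (theta k w j 0)],
        exists j (B : set R),
          measurable B /\ A = [set w | B (x k w j 0)]
      | exists i, A = [set w | X k w = i]] ] >>.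

(* The last field says that, given the past up to time n, the conditional
   probability of X n.+1 = j is the kernel at the current state. *)
Record sa_srrw (R : realType) (N D : nat) (P : 'M[R]_N) (mu : 'cV[R]_N)
    (alpha : R) (beta gamma : nat -> R) (H : 'cV[R]_D -> 'I_N -> 'cV[R]_D)
    (theta0 : 'cV[R]_D) (x0 : 'cV[R]_N) (i0 : 'I_N)
    (d : measure_display) (Omega : measurableType d) (Pr : probability Omega R)
    (theta : nat -> Omega -> 'cV[R]_D) (x : nat -> Omega -> 'cV[R]_N)
    (X : nat -> Omega -> 'I_N) : Prop := SaSrrw {
  theta_measurable : forall n j,
    measurable_fun [set: Omega] (fun w => theta n w j 0);
  x_measurable : forall n j, measurable_fun [set: Omega] (fun w => x n w j 0);
  X_measurable : forall n i, measurable [set w | X n w = i];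
  initial_point : {ae Pr, forall w,
    [/\ theta 0%N w = theta0, x 0%N w = x0 & X 0%N w = i0]};
  x_recursion : forall n, {ae Pr, forall w,
    x n.+1 w = x n w + gamma n.+1 *: (delta_mx (X n.+1 w) 0 - x n w)};
  theta_recursion : forall n, {ae Pr, forall w,
    theta n.+1 w = theta n w + beta n.+1 *: H (theta n w) (X n.+1 w)};
  X_conditional_law : forall n j (A : set Omega), past theta x X n A ->
    Pr (A `&` [set w | X n.+1 w = j]) =
    (\int[Pr]_(w in A) (srrw_kernel P mu alpha (x n w) (X n w) j)%:E)%E
}.

Definition borel_cV (R : realType) (n : nat) :=
  g_sigma_algebraType (@open 'cV[R]_n).

(* N(0, V) as the law all of whose one-dimensional projections <t, .> are
   N(0, t^T V t).  The projections of zero variance are singled out because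
   normal_prob m 0 is not the Dirac mass at m. *)
Definition centered_normal_law (R : realType) (n : nat) (V : 'M[R]_n)
    (nu : probability (borel_cV R n) R) : Prop :=
  forall (t : 'cV[R]_n) (B : set R), measurable B ->
    let var := (t^T *m V *m t) 0 0 in
    nu [set z : 'cV[R]_n | B ((t^T *m z) 0 0)] =
    if var == 0 then \d_(0 : R) B else normal_prob 0 (Num.sqrt var) B.

Definition cvg_in_distribution (R : realType) (n : nat) (d : measure_display)
    (Omega : measurableType d) (Pr : probability Omega R)
    (Y : nat -> Omega -> 'cV[R]_n) (nu : probability (borel_cV R n) R) : Prop :=
  forall f : 'cV[R]_n -> R, continuous f ->
    (exists M : R, forall z, `|f z| <= M) ->
    (\int[Pr]_w f (Y k w))%R @[k --> \oo] --> (\int[nu]_z f z)%R.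

Definition Vx (R : realType) (N : nat) (lambda : 'I_N -> R)
    (u : 'I_N -> 'cV[R]_N) (a alpha : R) : 'M[R]_N :=
  \sum_(i < N | (i < N.-1)%N)
    ((2 * alpha * (1 + lambda i) + 2 - (a == 1)%:R)^-1 *
     ((1 + lambda i) / (1 - lambda i))) *: (u i *m (u i)^T).

Definition pos_semidef (R : realType) (n : nat) (M : 'M[R]_n) : Prop :=
  M^T = M /\ forall w : 'cV[R]_n, 0 <= (w^T *m M *m w) 0 0.

Definition loewner_lt (R : realType) (n : nat) (M1 M2 : 'M[R]_n) : Prop :=
  pos_semidef (M2 - M1) /\ M1 <> M2.

(* Main.v *)
Require Import Defs.
From HB Require Import structures.
From mathcomp Require Import all_boot all_order all_algebra.
From mathcomp Require Import all_classical all_reals all_analysis.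
From mathcomp Require Import measurable_realfun.
From mathcomp Require Import ring lra.
Import Order.TTheory GRing.Theory Num.Theory.
Import numFieldNormedType.Exports.

Set Implicit Arguments.
Unset Strict Implicit.
Unset Printing Implicit Defensive.

Local Open Scope classical_set_scope.
Local Open Scope ring_scope.

(* Almost surely x_n is a function of the finite path X_1, ..., X_n, so that
   every expectation is a finite sum over paths.

   Convergence.  The solution of the Poisson equation splits delta_j - pi(x)
   into a martingale difference and a telescoping term.  The remaining drift
   pi(x) - x contracts the oscillation of x / mu at unit rate for every
   alpha >= 0, hence x_n -> mu without any ODE method.

   Fluctuations.  Near mu the coordinates <v_i, x_n - mu>, corrected by the
   telescoping term, obey a recursion contracting at rate 1 + alpha (1 + lambda_i)
   up to second order terms; the covariance of the noise at mu is diagonal with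
   entries (1 + lambda_i) / (1 - lambda_i).  McLeish's theorem gives the limit of
   the characteristic functions, the quadratic variation being controlled by a
   second use of the Poisson equation.  Since 1 / gamma_{n+1} - 1 / gamma_n tends
   to the indicator of a = 1, that indicator is subtracted from the rates.

   Convergence in law follows from the characteristic functions by tightness and
   by approximation with trigonometric polynomials, namely Bernstein polynomials
   in sin (y_i / L).  The Gaussian limit is the law of a sum of independent
   normal multiples of the u_i. *)

(** The linearization holds only near [mu], and the event of staying there from time m on depends on
    the future: conditioning on it would destroy the martingale property. Instead the noise is
    multiplied by the adapted indicator [good r m], which vanishes before time m and from the first
    later exit on, so that the noise remains a martingale difference and has a deterministic bound
    on every path. The radius and the Lipschitz constants are fixed first, then m so late that the
    exit probability is below [dlt], and only then n tends to infinity. The factor of [dlt] in the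
    final error must therefore be independent of m.

    Second order terms are harmless because E |x_n - mu|^2 is O(gamma_n) on the good event: they add
    O(gamma_n) to a quantity of size gamma_n^{1/2}. All contraction rates are at least 1, while
    gamma_n loses at most the fraction gamma_{n+1} in one step. This margin keeps the normalized
    recursions contracting, also for a = 1.

    Characteristic functions appear as means of cos (<t, y> + phi): the phase phi covers the real
    and the imaginary part at once. *)

(** * Expectation over finite paths and martingale inequalities *)

Section PathExpectation.
Context (R : realType) (S : finType) (k : seq S -> S -> R).
Hypothesis k_ge0 : forall p j, 0 <= k p j.
Hypothesis k_sum1 : forall p, \sum_j k p j = 1.

(* A path is a list of states, most recent first; [k p j] is the probability
   that the path [p] is continued by [j]. *)
Definition step (f : seq S -> R) (p : seq S) : R := \sum_j k p j * f (j :: p).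

Implicit Types (f g : seq S -> R) (xi : seq S -> S -> R) (c e : R).

(** The last step is averaged out first, which makes the tower property definitional. *)
Fixpoint Ex (n : nat) (f : seq S -> R) : R :=
  if n is n'.+1 then Ex n' (step f) else f [::].

Lemma Ex_le n f g : (forall p, size p = n -> f p <= g p) -> Ex n f <= Ex n g.
Proof.
elim: n f g => [|n IHn] f g fg /=; first exact: fg.
apply: IHn => p sp; apply: ler_sum => j _.
by apply: ler_wpM2l => //; apply: fg; rewrite /= sp.
Qed.

Lemma Ex_ext n f g : (forall p, size p = n -> f p = g p) -> Ex n f = Ex n g.
Proof. by move=> fg; apply/le_anti/andP; split; apply: Ex_le => p /fg ->. Qed.

Lemma ExD n f g : Ex n (fun p => f p + g p) = Ex n f + Ex n g.
Proof.
elim: n f g => [|n IHn] f g //=; rewrite -IHn; apply: Ex_ext => p _.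
by rewrite /step -big_split; apply: eq_bigr => j _; rewrite mulrDr.
Qed.

Lemma ExZ n c f : Ex n (fun p => c * f p) = c * Ex n f.
Proof.
elim: n f => [|n IHn] f //=; rewrite -IHn; apply: Ex_ext => p _.
by rewrite /step mulr_sumr; apply: eq_bigr => j _; rewrite mulrCA.
Qed.

Lemma ExN n f : Ex n (fun p => - f p) = - Ex n f.
Proof.
by rewrite -mulN1r -ExZ; apply: Ex_ext => p _; rewrite mulN1r.
Qed.

Lemma ExB n f g : Ex n (fun p => f p - g p) = Ex n f - Ex n g.
Proof. by rewrite ExD ExN. Qed.

Lemma step_cst c p : step (fun=> c) p = c.
Proof. by rewrite /step -mulr_suml k_sum1 mul1r. Qed.

Lemma Ex_cst n c : Ex n (fun=> c) = c.
Proof.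
elim: n => [|n IHn] //=; rewrite -[RHS]IHn; apply: Ex_ext => p _.
exact: step_cst.
Qed.

Lemma Ex_sum n (I : Type) (r : seq I) (Q : pred I) (F : I -> seq S -> R) :
  Ex n (fun p => \sum_(i <- r | Q i) F i p) = \sum_(i <- r | Q i) Ex n (F i).
Proof.
elim: r => [|i r IHr].
  by rewrite big_nil -[RHS](Ex_cst n 0); apply: Ex_ext => p _; rewrite big_nil.
rewrite big_cons -IHr; case: ifP => Qi; last first.
  by apply: Ex_ext => p _; rewrite big_cons Qi.
by rewrite -ExD; apply: Ex_ext => p _; rewrite big_cons Qi.
Qed.

Lemma Ex_ge0 n f : (forall p, size p = n -> 0 <= f p) -> 0 <= Ex n f.
Proof. by move=> f0; rewrite -(Ex_cst n 0); apply: Ex_le. Qed.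

Lemma Ex_le_cst n f c : (forall p, size p = n -> f p <= c) -> Ex n f <= c.
Proof. by move=> f0; rewrite -[leRHS](Ex_cst n c); apply: Ex_le. Qed.

Lemma Ex_norm n f : `|Ex n f| <= Ex n (fun p => `|f p|).
Proof.
rewrite ler_norml -ExN; apply/andP; split; apply: Ex_le => p _.
  by rewrite lerNl -normrN ler_norm.
exact: ler_norm.
Qed.

(** A substitute for the Cauchy-Schwarz inequality: average 2 c f <= c^2 + f^2. *)
Lemma Ex_le_sqrt n f c : 0 < c ->
  Ex n (fun p => f p ^+ 2) <= c ^+ 2 -> Ex n f <= c.
Proof.
move=> c_gt0 fc.
have : Ex n (fun p => 2 * c * f p) <= Ex n (fun p => c ^+ 2 + f p ^+ 2).
  by apply: Ex_le => p _; rewrite -subr_ge0 (_ : _ - _ = (c - f p) ^+ 2) ?sqr_ge0 //; ring.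
rewrite ExZ ExD Ex_cst => H1.
have : 2 * c * Ex n f <= 2 * c * c.
  by rewrite (le_trans H1) // -mulrA -expr2 mulr2n mulrDl !mul1r lerD2l.
by rewrite ler_pM2l // mulr_gt0.
Qed.

(** [xi p j] is the increment gained when [p] is continued by [j]; centred increments make this a
    martingale. *)
Fixpoint psum xi (p : seq S) : R :=
  if p is j :: p' then psum xi p' + xi p' j else 0.

(** Orthogonality of martingale increments: given the past, the cross term has mean zero. *)
Lemma Ex_psum_sqr n xi (c : nat -> R) :
  (forall p, (size p < n)%N -> \sum_j k p j * xi p j = 0) ->
  (forall p, (size p < n)%N -> \sum_j k p j * xi p j ^+ 2 <= c (size p)) ->
  Ex n (fun p => psum xi p ^+ 2) <= \sum_(i < n) c i.
Proof.
elim: n => [|n IHn] mxi vxi; first by rewrite big_ord0 /= expr0n.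
rewrite big_ord_recr /=.
have -> : c n = Ex n (fun=> c n) by rewrite Ex_cst.
rewrite -lerBlDr -ExB; apply: le_trans; last first.
  by apply: IHn => p pn; [apply: mxi|apply: vxi]; rewrite ltnW.
apply: Ex_le => p sp; rewrite /step.
have -> : \sum_j k p j * psum xi (j :: p) ^+ 2 = psum xi p ^+ 2 +
    (2 * psum xi p * (\sum_j k p j * xi p j) + \sum_j k p j * xi p j ^+ 2).
  rewrite -[X in _ = X + _](step_cst _ p) /step mulr_sumr -!big_split /=.
  by apply: eq_bigr => j _; ring.
have := mxi p; have := vxi p; rewrite sp ltnSn => /(_ isT) v /(_ isT) ->.
by rewrite mulr0 add0r lerBlDr lerD2l.
Qed.

Fixpoint exceeds xi e (p : seq S) : bool :=
  (e < `|psum xi p|) || (if p is _ :: p' then exceeds xi e p' else false).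

(* Freezing the martingale at the first exceedance turns Kolmogorov's maximal
   inequality into Chebyshev's inequality at the final time. *)
Lemma kolmogorov n xi (c : nat -> R) e : 0 < e ->
  (forall p, (size p < n)%N -> \sum_j k p j * xi p j = 0) ->
  (forall p, (size p < n)%N -> \sum_j k p j * xi p j ^+ 2 <= c (size p)) ->
  Ex n (fun p => (exceeds xi e p)%:R) <= (\sum_(i < n) c i) / e ^+ 2.
Proof.
move=> e0 mxi vxi.
pose xi' p j := if exceeds xi e p then 0 else xi p j.
have Hex p : if exceeds xi e p then e < `|psum xi' p| else psum xi' p == psum xi p.
  elim: p => [|j p IHp] /=; first by rewrite normr0 orbF; case: ifP.
  rewrite {2 4}/xi'; case: (exceeds xi e p) IHp => IHp.
    by rewrite orbT addr0.
  by rewrite orbF (eqP IHp); case: ifP.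
rewrite ler_pdivlMr ?exprn_gt0 // mulrC -ExZ.
apply: (@le_trans _ _ (Ex n (fun p => psum xi' p ^+ 2))).
  apply: Ex_le => p _; have := Hex p; case: exceeds => H.
    by rewrite mulr1 -(real_normK (num_real (psum xi' p))) ler_sqr ?nnegrE // ltW.
  by rewrite mulr0 sqr_ge0.
apply: Ex_psum_sqr => p pn; rewrite /xi'; case: (exceeds xi e p).
- by rewrite big1 // => j _; rewrite mulr0.
- exact: mxi.
- rewrite big1 => [|j _]; last by rewrite expr0n mulr0.
  apply: le_trans (vxi p pn); apply: sumr_ge0 => j _.
  by rewrite mulr_ge0 // sqr_ge0.
- exact: vxi.
Qed.

End PathExpectation.

(** * Taylor bounds for cos, sin and exp *)

Section TrigBounds.
Context (R : realType).
Implicit Types x y : R.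

(** Each Taylor bound below follows from a lower order one by bounding the derivative and
    integrating once. *)
Lemma MVT_bound (f f' : R -> R) x M : f 0 = 0 ->
  (forall y, is_derive y 1 f (f' y)) ->
  (forall y, `|y| <= `|x| -> `|f' y| <= M) -> `|f x| <= M * `|x|.
Proof.
move=> f0 df bf.
have cf a b : {within `[a, b], continuous f}.
  by apply: derivable_within_continuous => y _; apply: ex_derive.
have [x0|x0|->] := ltgtP x 0; last by rewrite f0 !normr0 mulr0.
- have [c /[!in_itv]/= /andP[c1 c2]] := MVT x0 (fun y _ => df y) (cf _ _).
  rewrite f0 !sub0r => /(congr1 Num.norm); rewrite normrN normrM normrN => ->.
  by apply: ler_wpM2r => //; apply: bf; rewrite (ltr0_norm c2) (ltr0_norm x0) lerN2 ltW.
- have [c /[!in_itv]/= /andP[c1 c2]] := MVT x0 (fun y _ => df y) (cf _ _).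
  rewrite f0 !subr0 => /(congr1 Num.norm); rewrite normrM => ->.
  by apply: ler_wpM2r => //; apply: bf; rewrite (gtr0_norm c1) (gtr0_norm x0) ltW.
Qed.

Lemma norm_sin_le x : `|sin x| <= `|x|.
Proof.
rewrite -[leRHS]mul1r; apply: (@MVT_bound _ cos); rewrite ?sin0 // => y _.
exact: cos_max.
Qed.

Lemma cos_sub1_le x : `|cos x - 1| <= `|x|.
Proof.
rewrite -[leRHS]mul1r; apply: (@MVT_bound (fun x => cos x - 1) (fun x => - sin x)).
- by rewrite cos0 subrr.
- by move=> y; apply: is_derive_eq; rewrite subr0.
- by move=> y _; rewrite normrN; exact: sin_max.
Qed.

(** With the next lemma, the imaginary and real parts of (1 + i x) e^{- i x}. The derivatives - x
    sin x and x (cos x - 1) are O(x^2). *)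
Lemma xcos_sin_le x : `|x * cos x - sin x| <= `|x| ^+ 3.
Proof.
rewrite exprSr; apply: (@MVT_bound (fun x => x * cos x - sin x) (fun x => - (x * sin x))).
- by rewrite mul0r sin0 subrr.
- by move=> y; apply: is_derive_eq; rewrite /GRing.scale /=; ring.
- move=> y yx; rewrite normrN normrM; apply: ler_pM => //.
  exact: le_trans (norm_sin_le _) yx.
Qed.

Lemma cos_xsin_le x : `|cos x + x * sin x - 1 - x ^+ 2 / 2| <= `|x| ^+ 3.
Proof.
rewrite (exprSr `|x|).
have /= H := @MVT_bound (fun x => cos x + x * sin x - 1 - x ^+ 2 / 2)
  (fun x => x * (cos x - 1)) x (`|x| ^+ 2); apply: H.
- by rewrite mul0r cos0; lra.
- by move=> y; apply: is_derive_eq; rewrite /GRing.scale /=; field.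
- move=> y yx; rewrite normrM; apply: ler_pM => //.
  exact: le_trans (cos_sub1_le _) yx.
Qed.

Lemma expRN_taylor_le x : 0 <= x -> `|expR (- x) - 1 + x| <= x ^+ 2.
Proof.
move=> x0.
have e1 := expR_ge1Dx (- x).
have e2 : expR (- x) <= 1 by rewrite -[leRHS]expR0 ler_expR oppr_le0.
have e3 := expR_ge1Dx x.
have e4 : expR (- x) * expR x = 1 by rewrite -expRD addNr expR0.
have e5 : expR (- x) * (1 + x) <= 1 by rewrite -[leRHS]e4 ler_wpM2l ?expR_ge0.
rewrite ler_norml; apply/andP; split; nra.
Qed.

Lemma expR_lipschitz x y C : x <= C -> y <= C ->
  `|expR x - expR y| <= expR C * `|x - y|.
Proof.
wlog xy : x y / x <= y.
  move=> H xC yC; have [xy|/ltW xy] := leP x y; first exact: H.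
  by rewrite distrC [in leRHS]distrC; apply: H.
move=> xC yC.
rewrite distrC [in leRHS]distrC !ger0_norm ?subr_ge0 ?ler_expR //.
have h1 := expR_ge1Dx (x - y).
have h2 : expR x = expR y * expR (x - y) by rewrite -expRD; congr expR; ring.
have h3 : expR y <= expR C by rewrite ler_expR.
have h4 := expR_gt0 y.
have h5 : 0 <= y - x by rewrite subr_ge0.
rewrite h2; nra.
Qed.

(* (1 + i x) e^{- i x} e^{- x^2 / 2} = 1 + O(x^3), real and imaginary parts. *)
Lemma mcleish_factor_le x : `|x| <= 1 ->
  `|(cos x + x * sin x) * expR (- (x ^+ 2 / 2)) - 1| <= 3 * `|x| ^+ 3 /\
  `|(x * cos x - sin x) * expR (- (x ^+ 2 / 2))| <= 3 * `|x| ^+ 3.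
Proof.
move=> x1; have x20 : 0 <= x ^+ 2 / 2 by rewrite divr_ge0 ?sqr_ge0.
have := expRN_taylor_le x20.
have := cos_xsin_le x; have := xcos_sin_le x.
have e0 := expR_gt0 (- (x ^+ 2 / 2)).
have e1 : expR (- (x ^+ 2 / 2)) <= 1 by rewrite -[leRHS]expR0 ler_expR oppr_le0.
set E := expR _ in e0 e1 *.
rewrite -[x ^+ 2](real_normK (num_real x)).
set y := `|x| in x1 *; have y0 : 0 <= y := normr_ge0 x.
have y3 : 0 <= y ^+ 3 by rewrite exprn_ge0.
have y2 : 0 <= y ^+ 2 by rewrite exprn_ge0.
have y43 : (y ^+ 2 / 2) ^+ 2 <= y ^+ 3 / 4.
  rewrite (_ : (y ^+ 2 / 2) ^+ 2 = y ^+ 3 * y / 4); last by field.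
  by rewrite ler_pM2r // ler_piMr.
set a := cos x + _ - 1 - _; set B := x * cos x - _; set d := E - 1 + _.
move=> hB ha hd; split; last first.
  rewrite normrM (gtr0_norm e0); apply: (@le_trans _ _ `|B|).
    by rewrite ler_piMr.
  by apply: (le_trans hB); rewrite ler_peMl // ler1n.
(* Since cos x + x sin x = 1 + y^2 / 2 + a and E = 1 - y^2 / 2 + d, the second order terms
   cancel. *)
have -> : (cos x + x * sin x) * E - 1 =
    - (y ^+ 2 / 2) ^+ 2 + a * E + d * (1 + y ^+ 2 / 2).
  by rewrite /a /d; ring.
have t1 : `|a * E| <= y ^+ 3.
  by rewrite normrM (gtr0_norm e0) (le_trans _ ha) // ler_piMr.
have t2 : `|d * (1 + y ^+ 2 / 2)| <= y ^+ 3.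
  rewrite normrM (@ger0_norm _ (1 + _)) ?addr_ge0 ?divr_ge0 //.
  have y21 : y ^+ 2 <= 1 by rewrite exprn_ile1.
  apply: (@le_trans _ _ (y ^+ 3 / 4 * 2)); last by nra.
  by apply: ler_pM => //; [rewrite addr_ge0 // divr_ge0|exact: le_trans hd y43|lra].
have := ler_normD (- (y ^+ 2 / 2) ^+ 2 + a * E) (d * (1 + y ^+ 2 / 2)).
have := ler_normD (- (y ^+ 2 / 2) ^+ 2) (a * E).
rewrite normrN (ger0_norm (sqr_ge0 _)); lra.
Qed.

End TrigBounds.

(** * McLeish's bound for the characteristic function of a martingale *)

Section McLeish.
Context (R : realType) (S : finType) (k : seq S -> S -> R).
Hypothesis k_ge0 : forall p j, 0 <= k p j.
Hypothesis k_sum1 : forall p, \sum_j k p j = 1.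
Context (n : nat) (xi : seq S -> S -> R) (e C : R).
Hypothesis xi_mart : forall p, (size p < n)%N -> \sum_j k p j * xi p j = 0.
Hypothesis e_le1 : e <= 1.
Hypothesis xi_le : forall p j, (size p < n)%N -> `|xi p j| <= e.
Hypothesis qv_le : forall p, (size p <= n)%N ->
  psum (fun p j => xi p j ^+ 2) p <= C.

Let M := psum xi.
Let V := psum (fun p j => xi p j ^+ 2).

(* Real and imaginary parts of \prod (1 + i xi). *)
Fixpoint cprod_re (p : seq S) : R * R :=
  if p is j :: p' then
    let: (a, b) := cprod_re p' in (a - xi p' j * b, b + xi p' j * a)
  else (1, 0).

(** Each factor 1 + i xi has conditional mean 1, so the complex product has mean 1 at every time. *)
Let Ex_cprod m : (m <= n)%N ->
  Ex k m (fun p => (cprod_re p).1) = 1 /\ Ex k m (fun p => (cprod_re p).2) = 0.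
Proof.
elim: m => [|m IHm] //= mn; have [IH1 IH2] := IHm (ltnW mn).
split; [rewrite -[RHS]IH1|rewrite -[RHS]IH2]; apply: (Ex_ext k_ge0) => p sp;
  rewrite /step /=; case: (cprod_re p) => a b /=;
  under eq_bigr do rewrite mulrDr ?mulrN.
  rewrite sumrB -mulr_suml k_sum1 mul1r.
  under eq_bigr do rewrite mulrA.
  by rewrite -mulr_suml xi_mart ?sp // mul0r subr0.
rewrite big_split /= -mulr_suml k_sum1 mul1r.
under eq_bigr do rewrite mulrA.
by rewrite -mulr_suml xi_mart ?sp // mul0r addr0.
Qed.

(** The product multiplied by e^{- i M}; multiplied further by e^{- V / 2} it is close to 1. *)
Let rot (p : seq S) : R * R :=
  let: (a, b) := cprod_re p in
  (a * cos (M p) + b * sin (M p), b * cos (M p) - a * sin (M p)).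

Let V_ge0 p : 0 <= V p.
Proof. by elim: p => //= j p IHp; rewrite addr_ge0 // sqr_ge0. Qed.

(** The left side is 1 plus the l1 distance to 1 of a product of factors (1 + i xi) e^{- i xi} e^{-
    xi^2 / 2}. In this form it is submultiplicative, and a factor costs at most 1 + 6 |xi|^3 <= exp
    (6 e xi^2). *)
Let rot_le p : (size p <= n)%N ->
  1 + `|(rot p).1 * expR (- (V p / 2)) - 1| + `|(rot p).2 * expR (- (V p / 2))|
    <= expR (6 * e * V p).
Proof.
elim: p => [|j p IHp] /= sp.
  rewrite /rot /= (_ : M [::] = 0) // (_ : V [::] = 0) // cos0 sin0.
  rewrite !(mul0r, mulr0, oppr0, expR0, mul1r, mulr1, addr0, subrr, normr0).
  by rewrite lexx.
have {IHp} := IHp (ltnW sp).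
rewrite /rot /=; case: (cprod_re p) => a b /=.
set x := xi p j; have xe : `|x| <= e := xi_le j sp.
have [f1 f2] := mcleish_factor_le (le_trans xe e_le1).
have -> : M (j :: p) = M p + x by [].
have -> : V (j :: p) = V p + x ^+ 2 by [].
rewrite cosD sinD [(V p + _) / 2]mulrDl opprD expRD.
set E := expR (- (V p / 2)); set F := expR (- (x ^+ 2 / 2)) in f1 f2 *.
set c := cos (M p); set s := sin (M p).
set U := (a * c + b * s) * E; set W := (b * c - a * s) * E.
set A := (cos x + _) * F in f1; set B := (_ - sin x) * F in f2.
move=> IH.
have -> : ((a - x * b) * (c * cos x - s * sin x) +
   (b + x * a) * (s * cos x + c * sin x)) * (E * F) = U * A - W * B.
  by rewrite /U /W /A /B; ring.
have -> : ((b + x * a) * (c * cos x - s * sin x) -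
   (a - x * b) * (s * cos x + c * sin x)) * (E * F) = W * A + U * B.
  by rewrite /U /W /A /B; ring.
rewrite mulrDr expRD.
set y := 3 * `|x| ^+ 3 in f1 f2.
have h1 : `|U * A - W * B - 1| <= `|U - 1| + (1 + `|U - 1|) * y + `|W| * y.
  have -> : U * A - W * B - 1 = (U - 1) + (1 + (U - 1)) * (A - 1) - W * B by ring.
  apply: (le_trans (ler_normB _ _)); apply: lerD.
    apply: (le_trans (ler_normD _ _)); rewrite lerD2l normrM.
    apply: ler_pM => //; apply: (le_trans (ler_normD _ _)).
    by rewrite normr1.
  by rewrite normrM ler_wpM2l.
have h2 : `|W * A + U * B| <= `|W| + `|W| * y + (1 + `|U - 1|) * y.
  have -> : W * A + U * B = W + W * (A - 1) + (1 + (U - 1)) * B by ring.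
  apply: (le_trans (ler_normD _ _)); apply: lerD.
    by apply: (le_trans (ler_normD _ _)); rewrite lerD2l normrM ler_wpM2l.
  rewrite normrM; apply: ler_pM => //; apply: (le_trans (ler_normD _ _)).
  by rewrite normr1.
apply: (@le_trans _ _ ((1 + `|U - 1| + `|W|) * (1 + 2 * y))).
  have := normr_ge0 (U - 1); have := normr_ge0 W.
  have y0 : 0 <= y by rewrite mulr_ge0 // exprn_ge0.
  nra.
apply: ler_pM => //; rewrite ?addr_ge0 ?mulr_ge0 ?exprn_ge0 //.
apply: le_trans (expR_ge1Dx _); rewrite lerD2l /y exprS.
rewrite real_normK ?num_real // [leLHS](_ : _ = 6 * `|x| * x ^+ 2); last by ring.
by rewrite ler_wpM2r ?sqr_ge0 // ler_wpM2l.
Qed.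

(** [expR C] is the Lipschitz constant of exp up to C and bounds e^{V / 2}; the second term bounds
    (e^{6 e V} - 1) / e. *)
Let K := expR C * (1 + 6 * C * expR (6 * C)).

(** The product equals rot e^{i M} and has mean 1, so with G = e^{s2 / 2} one has G E e^{i M} - 1 =
    E ((G - rot) e^{i M}). Here rot is close to e^{V / 2} by [rot_le], and e^{V / 2} is close to G
    when V is close to s2. Finally G >= 1 may be dropped. *)
Lemma mcleish (s2 : R) : 0 <= e -> 0 <= s2 <= C ->
  `|Ex k n (fun p => cos (M p)) - expR (- (s2 / 2))|
    <= K * (Ex k n (fun p => `|V p - s2|) + e) /\
  `|Ex k n (fun p => sin (M p))|
    <= K * (Ex k n (fun p => `|V p - s2|) + e).
Proof.
move=> e0 /andP[s20 s2C].
have C0 : 0 <= C := le_trans s20 s2C.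
pose G := expR (s2 / 2).
have rotG p : size p = n -> `|(rot p).1 - G| + `|(rot p).2| <=
    K * (`|V p - s2| + e).
  move=> sp; have := rot_le (eq_leq sp).
  have Vp : V p <= C by apply: qv_le; rewrite sp.
  set E := expR (- (V p / 2)) => hN.
  have EV : E * expR (V p / 2) = 1 by rewrite -expRD addNr expR0.
  have V2 : expR (V p / 2) <= expR C.
    by rewrite ler_expR; have := V_ge0 p; lra.
  have hG : `|expR (V p / 2) - G| <= expR C * `|V p - s2|.
    apply: (le_trans (@expR_lipschitz _ _ _ C _ _)); rewrite ?ler_pM2l ?expR_gt0 //.
    - by have := V_ge0 p; lra.
    - by lra.
    - by rewrite -mulrBl normrM (@ger0_norm _ 2^-1) //; have := normr_ge0 (V p - s2); lra.
  have hexp : expR (6 * e * V p) - 1 <= 6 * C * expR (6 * C) * e.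
    rewrite (_ : _ - 1 = expR (6 * e * V p) - expR 0); last by rewrite expR0.
    apply: (le_trans (ler_norm _)).
    have eV : e * V p <= C.
      by rewrite -[leRHS]mul1r; apply: ler_pM.
    apply: (le_trans (@expR_lipschitz _ _ _ (6 * C) _ _)); rewrite ?mulr_ge0 //.
      by rewrite -mulrA ler_pM2l.
    rewrite subr0 ger0_norm ?mulr_ge0 //.
    have := @ler_wpM2l _ e e0 _ _ Vp; have := expR_gt0 (6 * C); nra.
  have r1 : `|(rot p).1 - expR (V p / 2)| = `|(rot p).1 * E - 1| * expR (V p / 2).
    rewrite -{2}(gtr0_norm (expR_gt0 (V p / 2))) -normrM mulrBl -mulrA EV.
    by rewrite mulr1 mul1r.
  have r2 : `|(rot p).2| = `|(rot p).2 * E| * expR (V p / 2).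
    by rewrite -(gtr0_norm (expR_gt0 (V p / 2))) -normrM -mulrA EV mulr1.
  have := ler_distD (expR (V p / 2)) (rot p).1 G.
  rewrite r1 r2; set n1 := `|_ * E - 1| in hN *; set n2 := `|_ * E| in hN *.
  have hn : (n1 + n2) * expR (V p / 2) <= 6 * C * expR (6 * C) * e * expR C.
    apply: ler_pM => //; rewrite ?addr_ge0 ?expR_ge0 // ?normr_ge0 //.
    by apply: le_trans hexp; lra.
  have kk : 0 <= expR C * (6 * C * expR (6 * C)) * `|V p - s2|.
    by rewrite !mulr_ge0 ?expR_ge0.
  have kk2 : 0 <= expR C * e by rewrite mulr_ge0 ?expR_ge0.
  by rewrite /K; lra.
have [T1 T2] := Ex_cprod (leqnn n).
have TE p : (cprod_re p).1 = (rot p).1 * cos (M p) - (rot p).2 * sin (M p) /\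
    (cprod_re p).2 = (rot p).1 * sin (M p) + (rot p).2 * cos (M p).
  rewrite /rot; case: (cprod_re p) => a b /=; have := cos2Dsin2 (M p).
  set c := cos _; set s := sin _ => cs; split.
    by rewrite -[LHS]mulr1 -cs; ring.
  by rewrite -[LHS]mulr1 -cs; ring.
have Kb (g : R) : `|G * g| <= K * (Ex k n (fun p => `|V p - s2|) + e) ->
    `|g| <= K * (Ex k n (fun p => `|V p - s2|) + e).
  apply: le_trans; rewrite normrM (gtr0_norm (expR_gt0 _)) ler_peMl //.
  by rewrite -[leLHS]expR0 ler_expR divr_ge0.
have KE : K * (Ex k n (fun p => `|V p - s2|) + e) =
    Ex k n (fun p => K * (`|V p - s2| + e)).
  by rewrite (ExZ k_ge0) (ExD k_ge0) (Ex_cst k_ge0 k_sum1).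
split; apply: Kb; rewrite KE.
  rewrite mulrBr -expRD subrr expR0 -T1 -(ExZ k_ge0) -(ExB k_ge0).
  apply: (le_trans (Ex_norm k_ge0 _ _)); apply: Ex_le => // p sp.
  apply: le_trans (rotG p sp); rewrite (TE p).1.
  rewrite (_ : _ - _ = - (((rot p).1 - G) * cos (M p)) + (rot p).2 * sin (M p)); last by ring.
  apply: (le_trans (ler_normD _ _)); rewrite normrN !normrM.
  by apply: lerD; rewrite ler_piMr ?cos_max ?sin_max.
rewrite -(ExZ k_ge0) -[X in `|X|]subr0 -T2 -(ExB k_ge0).
apply: (le_trans (Ex_norm k_ge0 _ _)); apply: Ex_le => // p sp.
apply: le_trans (rotG p sp); rewrite (TE p).2.
rewrite (_ : _ - _ = - (((rot p).1 - G) * sin (M p)) - (rot p).2 * cos (M p)); last by ring.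
apply: (le_trans (ler_normB _ _)); rewrite normrN !normrM.
by apply: lerD; rewrite ler_piMr ?cos_max ?sin_max.
Qed.

End McLeish.

(** * Step sizes and scalar recursions *)

Section Recursions.
Context (R : realType).
Implicit Types (w g : nat -> R) (c C B E : R).

(** The bound B reproduces itself: (1 - c g) B + g C <= B exactly because C <= c B. *)
Lemma recursion_le w g c C B N :
  (forall n, (N <= n)%N -> 0 <= c * g n <= 1) ->
  (forall n, (N <= n)%N -> 0 <= g n) ->
  (forall n, (N <= n)%N -> w n.+1 <= (1 - c * g n) * w n + g n * C) ->
  w N <= B -> C <= c * B -> forall n, (N <= n)%N -> w n <= B.
Proof.
move=> cg g0 rec wN CB; elim=> [|n IHn]; first by rewrite leqn0 => /eqP <-.
rewrite leq_eqVlt => /predU1P[<- //|]; rewrite ltnS => Nn.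
apply: (le_trans (rec _ Nn)); have /andP[h1 h2] := cg _ Nn.
have := IHn Nn => wB.
apply: (@le_trans _ _ ((1 - c * g n) * B + g n * (c * B))).
  by apply: lerD; [apply: ler_wpM2l => //; rewrite subr_ge0|apply: ler_wpM2l => //; exact: g0].
by rewrite (_ : _ + _ = B) //; ring.
Qed.

(** Above the level E / c + eta the sequence drops by at least c eta g at each step. As the sum of g
    diverges, it must reach the level, and once below it stays there. *)
Lemma recursion_eventually_le w g c E :
  0 < c ->
  (forall (M : R) N, exists n, M <= \sum_(N <= i < n) g i) ->
  (\forall n \near \oo, 0 <= g n) ->
  (\forall n \near \oo, c * g n <= 1) ->
  (\forall n \near \oo, w n.+1 <= (1 - c * g n) * w n + g n * E) ->
  forall eta : R, 0 < eta -> \forall n \near \oo, w n <= E / c + eta.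
Proof.
move=> c0 dvg [N1 _ g0] [N2 _ cg] [N3 _ rec] eta eta0.
pose N := maxn N1 (maxn N2 N3).
pose v n := w n - (E / c + eta).
have Hv n : (N <= n)%N -> v n.+1 <= (1 - c * g n) * v n - c * eta * g n.
  move=> Nn; have /rec H : (N3 <= n)%N.
    by apply: leq_trans Nn; rewrite /N !leq_max leqnn !orbT.
  rewrite /v lerBlDr (le_trans H) // le_eqVlt; apply/orP; left; apply/eqP.
  by field; rewrite gt_eqF.
have g0' n : (N <= n)%N -> 0 <= g n.
  by move=> Nn; apply: g0; rewrite /= (leq_trans _ Nn) // /N !leq_max leqnn.
have cg' n : (N <= n)%N -> c * g n <= 1.
  by move=> Nn; apply: cg; rewrite /= (leq_trans _ Nn) // /N !leq_max leqnn !orbT.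
have [n0 [Nn0 vn0]] : exists n0, (N <= n0)%N /\ v n0 <= 0.
  apply: contrapT => /forallNP H.
  have pos n : (N <= n)%N -> 0 < v n.
    by move=> Nn; rewrite ltNge; apply/negP => vn; apply: (H n).
  have ub n : (N <= n)%N -> v n <= v N - c * eta * \sum_(N <= i < n) g i.
    elim: n => [|n IHn]; first by rewrite leqn0 => /eqP ->; rewrite big_geq // mulr0 subr0.
    rewrite leq_eqVlt => /predU1P[<- |]; first by rewrite big_geq // mulr0 subr0.
    rewrite ltnS => Nn; rewrite big_nat_recr //= mulrDr opprD addrA.
    apply: (le_trans (Hv _ Nn)); rewrite lerD2r.
    apply: le_trans (IHn Nn); rewrite ler_piMl //; first exact/ltW/pos.
    by rewrite gerBl mulr_ge0 ?g0' // ltW.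
  have [n] := dvg (v N / (c * eta) + 1) N; have ce : 0 < c * eta by rewrite mulr_gt0.
  have [Nn|nN] := leqP N n; last first.
    rewrite big_geq ?(ltnW nN) // => h; have := pos N (leqnn _) => vN.
    have : 0 < v N / (c * eta) by rewrite divr_gt0.
    lra.
  move=> h; have := ub _ Nn; have := pos _ Nn.
  have : v N < c * eta * \sum_(N <= i < n) g i.
    rewrite mulrC -ltr_pdivrMr //; lra.
  lra.
have vE m : (w m <= E / c + eta) = (v m <= 0) by rewrite /v subr_le0.
exists n0 => // n /=; rewrite vE; elim: n => [|n IHn].
  by rewrite leqn0 => /eqP <-.
rewrite leq_eqVlt => /predU1P[<- |]; first by [].
rewrite ltnS => n0n; have Nn := leq_trans Nn0 n0n.
have vn := IHn n0n.
apply: (le_trans (Hv _ Nn)).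
have := cg' _ Nn; have := g0' _ Nn => h1 h2.
have : 0 <= c * eta * g n by rewrite !mulr_ge0 // ltW.
have : (1 - c * g n) * v n <= 0 by rewrite mulr_ge0_le0 // subr_ge0.
lra.
Qed.

End Recursions.

(** * Powers of n as step sizes *)

Section StepSize.
Context (R : realType) (a : R).
Hypothesis a_gt : 2^-1 < a.
Hypothesis a_le1 : a <= 1.
Let g := step_size a.

Let a_gt0 : 0 < a.
Proof. by apply: lt_trans a_gt; rewrite invr_gt0. Qed.

Lemma step_size_gt0 n : 0 < g n.
Proof. by rewrite powR_gt0. Qed.

Let g_gt0 := step_size_gt0.

Lemma step_size_ge0 n : 0 <= g n.
Proof. exact: ltW. Qed.

Lemma step_sizeV n : (g n)^-1 = n.+1%:R `^ a.
Proof. by rewrite /g /step_size powRN invrK. Qed.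

Lemma step_sizeE n : g n = (n.+1%:R `^ a)^-1.
Proof. by rewrite -step_sizeV invrK. Qed.

Lemma step_size_nonincr m n : (m <= n)%N -> g n <= g m.
Proof.
move=> mn; rewrite !step_sizeE lef_pV2 ?posrE ?powR_gt0 //.
by rewrite ge0_ler_powR ?nnegrE ?ler_nat // ltW.
Qed.

Lemma step_size_le1 n : g n <= 1.
Proof. by rewrite (le_trans (step_size_nonincr (leq0n n))) // /g /step_size powR1. Qed.

Lemma step_sizeS_lt1 n : g n.+1 < 1.
Proof.
rewrite step_sizeE invf_lt1 ?powR_gt0 //.
have := @gt0_ltr_powR R a a_gt0 1 n.+2%:R; rewrite powR1; apply; rewrite ?nnegrE //.
by rewrite ltr1n.
Qed.

(** Young's inequality with exponents 1 / a and 1 / (1 - a), applied to (1 + u)^a and 1. *)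
Lemma bernoulli_powR (u : R) : 0 <= u -> (1 + u) `^ a <= 1 + a * u.
Proof.
move=> u0; have u1 : 0 <= 1 + u by rewrite addr_ge0.
have [a1|a1|->] := ltgtP a 1; last by rewrite powRr1 // mul1r.
- have := @conjugate_powR R ((1 + u) `^ a) 1 a^-1 (1 - a)^-1.
  rewrite powR_ge0 !invr_gt0 a_gt0 subr_gt0 a1 !invrK => /(_ isT ler01 isT isT).
  rewrite addrC subrK => /(_ erefl); rewrite mulr1 -powRrM divff ?gt_eqF //.
  by rewrite powRr1 // powR1; lra.
- by have := lt_le_trans a1 a_le1; rewrite ltxx.
Qed.

(** Its limit is the indicator of a = 1, by [step_delta_cvg]: this is where the indicator in the
    limit covariance originates. *)
Definition step_delta n : R := (g n.+1)^-1 - (g n)^-1.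

Lemma step_deltaE n : g n / g n.+1 = 1 + step_delta n * g n.
Proof. by rewrite /step_delta mulrBl mulVf ?gt_eqF // mulrC addrC subrK. Qed.

Lemma step_delta_ge0 n : 0 <= step_delta n.
Proof. by rewrite subr_ge0 lef_pV2 ?posrE // step_size_nonincr. Qed.

Lemma step_delta_le n : step_delta n <= a * (n.+1%:R `^ (1 - a))^-1.
Proof.
rewrite /step_delta !step_sizeV.
set y : R := n.+1%:R; have y0 : 0 < y by rewrite ltr0n.
have yV : 0 <= y^-1 by rewrite invr_ge0 ltW.
have -> : n.+2%:R = y * (1 + y^-1) by rewrite mulrDr mulr1 divff ?gt_eqF // natr1.
rewrite powRM ?addr_ge0 ?(ltW y0) //.
have h := bernoulli_powR yV.
have ya : y `^ a * y^-1 = (y `^ (1 - a))^-1.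
  by rewrite -powR_inv1 ?(ltW y0) // -powRN -powRD ?(gt_eqF y0) ?implybT // opprB.
rewrite -ya; apply: (@le_trans _ _ (y `^ a * (1 + a * y^-1) - y `^ a)).
  by rewrite lerD2r ler_wpM2l // powR_ge0.
by rewrite le_eqVlt; apply/orP; left; apply/eqP; ring.
Qed.

Lemma step_delta_le1 n : step_delta n <= 1.
Proof.
apply: (le_trans (step_delta_le n)).
rewrite -[leRHS]mulr1; apply: ler_pM; rewrite ?(ltW a_gt0) // ?invr_ge0 ?powR_ge0 //.
rewrite invf_le1 ?powR_gt0 // -[leLHS](powRr0 n.+1%:R).
by rewrite ler_powR ?subr_ge0 // ler1n.
Qed.

(** [step_delta n <= 1] multiplied by both step sizes. Equivalently (1 - g n.+1) g n <= g n.+1: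
    contraction at rate one shrinks at least as fast as the step size. *)
Lemma step_size_diff n : g n - g n.+1 <= g n * g n.+1.
Proof.
have h := step_delta_le1 n; have d := step_deltaE n.
have g1 := g_gt0 n; have g2 := g_gt0 n.+1.
have -> : g n = g n.+1 + g n.+1 * (step_delta n * g n).
  by rewrite -[X in X + _]mulr1 -mulrDr -d mulrCA divff ?gt_eqF // mulr1.
have : step_delta n * g n <= g n by rewrite ler_piMl // ltW.
set D := step_delta n * g n; move=> Dg.
have D0 : 0 <= D by rewrite mulr_ge0 ?step_delta_ge0 // ltW.
have := step_delta_le1 n; have e : g n = g n.+1 + g n.+1 * D.
  by rewrite -[X in X + _]mulr1 -mulrDr -d mulrCA divff ?gt_eqF // mulr1.
rewrite -e; nra.
Qed.

Lemma natpowN_small (s e : R) : 0 < s -> 0 < e ->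
  \forall n \near \oo, (n.+1%:R `^ s)^-1 <= e.
Proof.
move=> s0 e0.
have [N hN] : exists N : nat, e^-1 `^ s^-1 <= N%:R.
  exists (Num.truncn (e^-1 `^ s^-1)).+1.
  by apply/ltW; rewrite truncnS_gt.
exists N => // n /= Nn; rewrite invf_ple ?posrE ?powR_gt0 //.
rewrite -[leLHS](@powRr1 R) ?invr_ge0 ?(ltW e0) // -[X in _ `^ X](@mulVf R s) ?gt_eqF //.
rewrite powRrM ge0_ler_powR ?nnegrE ?powR_ge0 ?(ltW s0) //.
by apply: (le_trans hN); rewrite ler_nat ltnW.
Qed.

Lemma step_size_small (e : R) : 0 < e -> \forall n \near \oo, g n <= e.
Proof.
move=> e0; have := natpowN_small a_gt0 e0.
by apply: filterS => n; rewrite -step_sizeE.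
Qed.

Lemma step_delta_cvg (e : R) : 0 < e ->
  \forall n \near \oo, `|step_delta n - (a == 1)%:R| <= e.
Proof.
move=> e0; have [a1|a1] := eqVneq a 1.
  exists 0%N => // n _.
  rewrite /step_delta !step_sizeV a1 !powRr1 // (_ : _ - _ - _ = 0) ?normr0 ?(ltW e0) //.
  by rewrite -(natr1 n.+1) /=; ring.
have a_lt1 : 0 < 1 - a by rewrite subr_gt0 lt_neqAle a1.
have := natpowN_small a_lt1 e0; apply: filterS => n h.
rewrite subr0 ger0_norm ?step_delta_ge0 // (le_trans (step_delta_le n)) //.
by rewrite (le_trans _ h) // ler_piMl // invr_ge0 powR_ge0.
Qed.

(** A telescoping majorant of the squared steps, whose exponent 2 a - 1 is positive because a > 1/2.
    It follows from (1 - 1/y)^{-s} >= 1 + s / y. *)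
Lemma step_size_sqr_le n :
  g n.+1 ^+ 2 <= (2 * a - 1)^-1 * ((n.+1%:R `^ (2 * a - 1))^-1 - (n.+2%:R `^ (2 * a - 1))^-1).
Proof.
set s := 2 * a - 1; have s0 : 0 < s by have := a_gt; rewrite /s; lra.
rewrite mulrC ler_pdivlMr //.
set y : R := n.+2%:R; have y0 : 0 < y by rewrite ltr0n.
have yV : 0 < 1 - y^-1 by rewrite subr_gt0 invf_lt1 // ltr1n.
have -> : n.+1%:R = y * (1 - y^-1).
  by rewrite mulrBr mulr1 divff ?gt_eqF // /y -(natr1 n.+1) addrK.
rewrite powRM ?(ltW y0) ?(ltW yV) // invfM.
have -> : g n.+1 ^+ 2 * s = (y `^ s)^-1 * (s * y^-1).
  rewrite step_sizeE -/y expr2 -invfM -powRD ?(gt_eqF y0) ?implybT //.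
  have -> : a + a = s + 1 by rewrite /s; ring.
  by rewrite powRD ?(gt_eqF y0) ?implybT // powRr1 ?(ltW y0) // invfM mulrAC -mulrA.
rewrite -[X in _ <= _ - X]mulr1 -mulrBr ler_wpM2l ?invr_ge0 ?powR_ge0 //.
rewrite -powRN /powR gt_eqF //.
have h1 := expR_ge1Dx (- s * ln (1 - y^-1)).
have h2 : ln (1 - y^-1) <= - y^-1 by apply: le_ln1Dx; rewrite -subr_gt0 opprK addrC.
rewrite -lerBrDl in h1; apply: le_trans h1.
by rewrite mulNr -mulrN ler_wpM2l ?(ltW s0) // lerNr.
Qed.

Lemma step_size_sqr_tail (e : R) : 0 < e ->
  \forall m \near \oo, forall n, \sum_(m <= i < n) g i.+1 ^+ 2 <= e.
Proof.
set s := 2 * a - 1; have s0 : 0 < s by have := a_gt; rewrite /s; lra.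
move=> e0; have := natpowN_small s0 (mulr_gt0 e0 s0); apply: filterS => m hm n.
have [mn|nm] := leqP m n; last by rewrite big_geq ?(ltnW nm) // ltW.
have : \sum_(m <= i < n) g i.+1 ^+ 2 <=
    s^-1 * ((m.+1%:R `^ s)^-1 - (n.+1%:R `^ s)^-1).
  elim: n mn => [|n IHn]; first by rewrite leqn0 => /eqP ->; rewrite big_geq // subrr mulr0.
  rewrite leq_eqVlt => /predU1P[<- |]; first by rewrite big_geq // subrr mulr0.
  rewrite ltnS => mn; rewrite big_nat_recr //=.
  have := IHn mn; have := step_size_sqr_le n; rewrite -/s => h1 h2.
  by have := lerD h2 h1; rewrite -mulrDr addrA subrK.
move=> h; apply: (le_trans h); rewrite mulrC ler_pdivrMr //.
by apply: le_trans hm; rewrite gerBl invr_ge0 powR_ge0.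
Qed.

Lemma step_size_dvg (M : R) N : exists n, M <= \sum_(N <= i < n) g i.+1.
Proof.
apply: contrapT => /forallNP H.
have a01 : 0 <= a <= 1 by rewrite (ltW a_gt0).
apply: (dvg_riemannR a01).
apply: nondecreasing_is_cvgn.
  apply/nondecreasing_seqP => n; rewrite /series /= big_nat_recr //= lerDl.
  by rewrite invr_ge0 powR_ge0.
exists (\sum_(0 <= i < N.+1) riemannR a i + `|M|) => _ [n _ <-].
rewrite /series /=; have r0 i : 0 <= riemannR a i by rewrite /= invr_ge0 powR_ge0.
have [nN|Nn] := leqP n N.+1.
  rewrite [in leRHS](big_cat_nat _ nN) //= -addrA lerDl addr_ge0 //.
  by rewrite big_seq sumr_ge0 // => i _; exact: r0.
rewrite (big_cat_nat _ (ltnW Nn)) //= lerD2l.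
have := H n.-1; case: n Nn => // n Nn /=.
rewrite big_add1 /= => /negP; rewrite -ltNge => /ltW h.
apply: (le_trans _ (ler_norm _)); apply: le_trans h.
rewrite le_eqVlt; apply/orP; left; apply/eqP; apply: eq_bigr => i _.
by rewrite step_sizeE.
Qed.

End StepSize.

(** * The kernel, its stationary law and the Poisson equation *)

Section BoundedLipschitz.
Context (R : realType) (N : nat).
Implicit Types (A : set 'cV[R]_N) (f g : 'cV[R]_N -> R).

Lemma norm_cV_le (x : 'cV[R]_N) i : `|x i 0| <= `|x|.
Proof.
by rewrite [leRHS]/Num.norm /= mx_normrE; apply/bigmax_geP; right => /=; exists (i, 0).
Qed.

Lemma cV_norm_le (x : 'cV[R]_N) (c : R) :
  0 <= c -> (forall i, `|x i 0| <= c) -> `|x| <= c.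
Proof.
move=> c0 h; rewrite [leLHS]/Num.norm /= mx_normrE; apply/bigmax_leP; split=> //=.
by move=> [i j] _ /=; rewrite ord1.
Qed.

(** Boundedness is bundled with the Lipschitz property because only the pair is stable under
    products, hence under determinants. *)
Definition blip A f := exists2 C : R, 0 <= C &
  (forall x, A x -> `|f x| <= C) /\
  (forall x y, A x -> A y -> `|f x - f y| <= C * `|x - y|).

Lemma blip_ext A f g : (forall x, A x -> f x = g x) -> blip A f -> blip A g.
Proof.
move=> fg [C C0 [h1 h2]]; exists C => //; split=> [x Ax|x y Ax Ay].
  by rewrite -fg //; exact: h1.
by rewrite -!fg //; exact: h2.
Qed.

Lemma blip_cst A (c : R) : blip A (fun=> c).
Proof. by exists `|c| => //; split=> // x y _ _; rewrite subrr normr0 mulr_ge0. Qed.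

Lemma blipD A f g : blip A f -> blip A g -> blip A (fun x => f x + g x).
Proof.
move=> [C C0 [h1 h2]] [C' C'0 [h1' h2']]; exists (C + C'); first exact: addr_ge0.
split=> [x Ax|x y Ax Ay].
  by apply: (le_trans (ler_normD _ _)); apply: lerD; [exact: h1|exact: h1'].
rewrite opprD addrACA mulrDl; apply: (le_trans (ler_normD _ _)).
by apply: lerD; [exact: h2|exact: h2'].
Qed.

Lemma blipM A f g : blip A f -> blip A g -> blip A (fun x => f x * g x).
Proof.
move=> [C C0 [h1 h2]] [C' C'0 [h1' h2']]; exists (2 * (C * C')).
  by rewrite !mulr_ge0.
have CC : 0 <= C * C' by exact: mulr_ge0.
split=> [x Ax|x y Ax Ay].
  rewrite normrM; apply: (@le_trans _ _ (C * C')); last by lra.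
  by apply: ler_pM => //; [exact: h1|exact: h1'].
have -> : f x * g x - f y * g y = f x * (g x - g y) + (f x - f y) * g y by ring.
apply: (le_trans (ler_normD _ _)); rewrite !normrM.
rewrite [leRHS](_ : _ = C * (C' * `|x - y|) + C * `|x - y| * C'); last by ring.
by apply: lerD; apply: ler_pM => //; [exact: h1|exact: h2'|exact: h2|exact: h1'].
Qed.

Lemma blipN A f : blip A f -> blip A (fun x => - f x).
Proof.
move=> bf; apply: (blip_ext _ (blipM (blip_cst A (-1)) bf)) => x _.
by rewrite mulN1r.
Qed.

Lemma blipB A f g : blip A f -> blip A g -> blip A (fun x => f x - g x).
Proof. by move=> bf bg; apply: blipD => //; exact: blipN. Qed.

Lemma blip_sum A (I : Type) (r : seq I) (Q : pred I) (F : I -> 'cV[R]_N -> R) :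
  (forall i, blip A (F i)) -> blip A (fun x => \sum_(i <- r | Q i) F i x).
Proof.
move=> h; elim: r => [|i r IHr].
  by apply: (blip_ext _ (blip_cst A 0)) => x _; rewrite big_nil.
have [Qi|Qi] := boolP (Q i).
  by apply: (blip_ext _ (blipD (h i) IHr)) => x _; rewrite big_cons Qi.
by apply: (blip_ext _ IHr) => x _; rewrite big_cons (negbTE Qi).
Qed.

Lemma blip_prod A (I : Type) (r : seq I) (Q : pred I) (F : I -> 'cV[R]_N -> R) :
  (forall i, blip A (F i)) -> blip A (fun x => \prod_(i <- r | Q i) F i x).
Proof.
move=> h; elim: r => [|i r IHr].
  by apply: (blip_ext _ (blip_cst A 1)) => x _; rewrite big_nil.
have [Qi|Qi] := boolP (Q i).
  by apply: (blip_ext _ (blipM (h i) IHr)) => x _; rewrite big_cons Qi.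
by apply: (blip_ext _ IHr) => x _; rewrite big_cons (negbTE Qi).
Qed.

Lemma blip_comp A f (phi : R -> R) (K : R) : 0 <= K -> blip A f ->
  (forall x, A x -> `|phi (f x)| <= K) ->
  (forall x y, A x -> A y -> `|phi (f x) - phi (f y)| <= K * `|f x - f y|) ->
  blip A (fun x => phi (f x)).
Proof.
move=> K0 [C C0 [h1 h2]] p1 p2; exists (K + K * C); first by rewrite addr_ge0 ?mulr_ge0.
split=> [x Ax|x y Ax Ay].
  by apply: (le_trans (p1 _ Ax)); rewrite lerDl mulr_ge0.
apply: (le_trans (p2 _ _ Ax Ay)); rewrite mulrDl -mulrA.
apply: (@le_trans _ _ (K * (C * `|x - y|))).
  by rewrite ler_wpM2l //; exact: h2.
by rewrite lerDr mulr_ge0.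
Qed.

Lemma blipV A f (c : R) : 0 < c -> blip A f -> (forall x, A x -> c <= `|f x|) ->
  blip A (fun x => (f x)^-1).
Proof.
move=> c0 bf fc; apply: (@blip_comp _ _ _ (c^-1 + c^-1 * c^-1)) => //.
- by rewrite addr_ge0 ?mulr_ge0 ?invr_ge0 // ltW.
- move=> x Ax; rewrite normfV (@le_trans _ _ c^-1) //.
    by rewrite lef_pV2 ?posrE ?fc // (lt_le_trans c0) ?fc.
  by rewrite lerDl mulr_ge0 ?invr_ge0 // ltW.
- move=> x y Ax Ay; have fx := fc _ Ax; have fy := fc _ Ay.
  have fx0 : f x != 0 by rewrite -normr_gt0 (lt_le_trans c0).
  have fy0 : f y != 0 by rewrite -normr_gt0 (lt_le_trans c0).
  have -> : (f x)^-1 - (f y)^-1 = - ((f x)^-1 * (f y)^-1 * (f x - f y)).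
    by field; rewrite fx0 fy0.
  rewrite normrN !normrM !normfV ler_wpM2r //.
  apply: (@le_trans _ _ (c^-1 * c^-1)); last by rewrite lerDr invr_ge0 ltW.
  by apply: ler_pM; rewrite ?invr_ge0 // lef_pV2 ?posrE // (lt_le_trans c0).
Qed.

Lemma blip_det A n (F : 'cV[R]_N -> 'M[R]_n) :
  (forall i j, blip A (fun x => F x i j)) -> blip A (fun x => \det (F x)).
Proof.
move=> bF; apply: blip_sum => s; apply: blipM; first exact: blip_cst.
by apply: blip_prod => i.
Qed.

Lemma blip_coord A i : (exists2 C : R, 0 <= C & forall x, A x -> `|x i 0| <= C) ->
  blip A (fun x => x i 0).
Proof.
move=> [C C0 hC]; exists (C + 1); first by rewrite addr_ge0.
split=> [x Ax|x y _ _]; first by rewrite (le_trans (hC _ Ax)) // lerDl.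
have := norm_cV_le (x - y) i; rewrite !mxE => h.
by rewrite mulrDl mul1r (le_trans h) // lerDr mulr_ge0.
Qed.

Lemma blip_unif A (I : finType) (F : I -> 'cV[R]_N -> R) :
  (forall i, blip A (F i)) -> exists2 C : R, 0 <= C &
  (forall i x, A x -> `|F i x| <= C) /\
  (forall i x y, A x -> A y -> `|F i x - F i y| <= C * `|x - y|).
Proof.
move=> bF.
have /choice[C hC] : forall i, exists C : R, 0 <= C /\
    (forall x, A x -> `|F i x| <= C) /\
    (forall x y, A x -> A y -> `|F i x - F i y| <= C * `|x - y|).
  by move=> i; have [C C0 h] := bF i; exists C.
have CS i : C i <= \sum_j C j.
  rewrite (bigD1 i) //= lerDl; apply: sumr_ge0 => j _; exact: (hC j).1.
exists (\sum_j C j); first by apply: sumr_ge0 => j _; exact: (hC j).1.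
split=> [i x Ax|i x y Ax Ay].
  exact: le_trans ((hC i).2.1 _ Ax) (CS i).
by apply: (le_trans ((hC i).2.2 _ _ Ax Ay)); rewrite ler_wpM2r.
Qed.

(** The upper bound 2 instead of 1 leaves room for perturbed iterates that are no longer in the
    simplex. *)
Definition box (rho : R) : set 'cV[R]_N := [set x | forall i, rho <= x i 0 <= 2].

(* Compactness enters through the minimum of [`|f|] over the box. *)
Lemma box_lower_bound rho f : 0 < rho -> blip (box rho) f ->
  (forall x, box rho x -> f x != 0) ->
  exists2 c : R, 0 < c & forall x, box rho x -> c <= `|f x|.
Proof.
move=> rho0 [C C0 [_ h2]] f0.
(* For rho > 2 the box is empty, unless N = 0, where it is a single point. *)
have [r2|r2] := lerP rho 2; last first.
  case: (posnP N) => [N0|Npos]; last first.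
    exists 1 => // x /(_ (Ordinal Npos)) /andP[h h'].
    by have := lt_le_trans r2 (le_trans h h'); rewrite ltxx.
  exists `|f 0|.
    by rewrite normr_gt0; apply: f0 => i; have := ltn_ord i; rewrite {2}N0.
  move=> x _; rewrite (_ : x = 0) //; apply/colP => i.
  by have := ltn_ord i; rewrite {2}N0.
pose A : set 'rV[R]_N := [set v | forall i, (`[rho, 2]%classic : set R) (v ord0 i)].
have cA : compact A by apply: (@rV_compact _ _ (fun=> `[rho, 2]%classic)) => _; exact: segment_compact.
have AB v : A v -> box rho v^T.
  by move=> Av i; have := Av i; rewrite /= in_itv /= mxE.
have A0 : A !=set0.
  by exists (const_mx rho) => i; rewrite /= in_itv /= mxE lexx.
have cf : {within A, continuous (fun v : 'rV[R]_N => `|f v^T|)}.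
  apply/subspace_continuousP => v Av; apply/cvgrPdist_le => e e0.
  rewrite near_withinE; near=> w => Aw.
  apply: (le_trans (ler_dist_dist _ _)).
  apply: (le_trans (h2 _ _ (AB _ Av) (AB _ Aw))).
  have vw : `|v - w| <= e / (C + 1).
    by near: w; apply: cvgr_dist_le; rewrite ?divr_gt0 // ltr_wpDl.
  apply: (@le_trans _ _ ((C + 1) * (e / (C + 1)))); last first.
    by rewrite mulrC divfK // gt_eqF // ltr_wpDl.
  apply: ler_pM => //; first by rewrite lerDl.
  apply: le_trans vw; apply: cV_norm_le => // i; rewrite !mxE.
  rewrite [leRHS]/Num.norm /= mx_normrE; apply/bigmax_geP; right => /=.
  by exists (0, i) => //; rewrite !mxE.
have [v vA hv] := EVT_min_rV A0 cA cf.
have {}vA : A v by rewrite inE in vA.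
exists `|f v^T|; first by rewrite normr_gt0 f0 //; exact: AB.
move=> x bx; rewrite -[x]trmxK; apply: hv; rewrite inE => i /=.
by rewrite in_itv /= mxE; exact: bx.
Unshelve. all: by end_near. Qed.

End BoundedLipschitz.

(** * Lipschitz and second order bounds for negative powers *)

Section PowRBounds.
Context (R : realType) (alpha : R).
Hypothesis alpha_ge0 : 0 <= alpha.
Implicit Types s t : R.

Lemma ln_le_sub1 t : 0 < t -> ln t <= t - 1.
Proof.
by move=> t0; rewrite -{1}[t](subrKC 1) le_ln1Dx // ltrBrDr addrC subrr.
Qed.

Lemma powRN_antimono s t : 0 < s -> s <= t -> t `^ (- alpha) <= s `^ (- alpha).
Proof.
move=> s0 st; have t0 := lt_le_trans s0 st.
by rewrite !powRN lef_pV2 ?posrE ?powR_gt0 // ge0_ler_powR ?nnegrE // ltW.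
Qed.

(** With q = t / s, factor out s^{- alpha} and use 1 - q^{- alpha} <= alpha ln q <= alpha (q -
    1). *)
Lemma powRN_lipschitz s0 s t : 0 < s0 -> s0 <= s -> s0 <= t ->
  `|s `^ (- alpha) - t `^ (- alpha)| <= s0 `^ (- alpha) * alpha / s0 * `|s - t|.
Proof.
move=> s00; wlog st : s t / s <= t.
  move=> H ss tt; have [st|/ltW ts] := leP s t; first exact: H.
  by rewrite distrC [in leRHS]distrC; apply: H.
move=> s0s s0t; have sp : 0 < s := lt_le_trans s00 s0s.
rewrite ger0_norm ?subr_ge0 ?powRN_antimono // distrC ger0_norm ?subr_ge0 //.
have q0 : 0 < t / s by rewrite divr_gt0 // (lt_le_trans sp).
have -> : t `^ (- alpha) = s `^ (- alpha) * (t / s) `^ (- alpha).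
  by rewrite -powRM ?(ltW sp) ?(ltW q0) // mulrC divfK // gt_eqF.
rewrite -{1}[s `^ _]mulr1 -mulrBr.
have h1 : 1 - (t / s) `^ (- alpha) <= alpha * (t / s - 1).
  rewrite /powR gt_eqF //; have := expR_ge1Dx (- alpha * ln (t / s)).
  have h := ln_le_sub1 q0.
  have := ler_wpM2l alpha_ge0 h; lra.
have ts : alpha * (t / s - 1) <= alpha / s0 * (t - s).
  rewrite -mulrA ler_wpM2l // (_ : t / s - 1 = s^-1 * (t - s)); last first.
    by field; rewrite gt_eqF.
  by rewrite ler_wpM2r ?subr_ge0 // lef_pV2.
rewrite -!mulrA; apply: ler_pM; rewrite ?powR_ge0 ?powRN_antimono //.
  rewrite subr_ge0 -[leRHS](powRr0 (t / s)) ler_powR ?oppr_le0 //.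
  by rewrite ler_pdivlMr // mul1r.
by rewrite mulrA; apply: le_trans h1 ts.
Qed.

(** With y = - alpha ln s the quantity is the sum of e^y - 1 - y and alpha (s - 1 - ln s). Both are
    nonnegative and quadratic in s - 1; [Y] bounds y and 0 from above, and [c] is a Lipschitz
    constant of ln at 1. *)
Lemma powRN_taylor s0 : 0 < s0 -> exists2 C : R, 0 <= C & forall s, s0 <= s ->
  `|s `^ (- alpha) - 1 + alpha * (s - 1)| <= C * (s - 1) ^+ 2.
Proof.
move=> s00; pose c := s0^-1 + 1; pose Y := Num.max 0 (- alpha * ln s0).
have c0 : 0 <= c by rewrite addr_ge0 // invr_ge0 ltW.
exists (expR Y * (alpha * c) ^+ 2 + alpha * s0^-1).
  by rewrite addr_ge0 ?mulr_ge0 ?expR_ge0 ?sqr_ge0 ?invr_ge0 // ltW.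
move=> s s0s; have sp := lt_le_trans s00 s0s.
have l1 := ln_le_sub1 sp.
have l2 : 1 - s^-1 <= ln s.
  have := @ln_le_sub1 s^-1; rewrite invr_gt0 sp lnV ?posrE // => /(_ isT); lra.
have sV : s^-1 <= s0^-1 by rewrite lef_pV2.
have sV0 : 0 < s^-1 by rewrite invr_gt0.
have e1 : 1 - s^-1 = s^-1 * (s - 1) by field; rewrite gt_eqF.
have l3 : (s - 1) - ln s <= s0^-1 * (s - 1) ^+ 2.
  apply: (@le_trans _ _ (s^-1 * (s - 1) ^+ 2)); last by rewrite ler_wpM2r ?sqr_ge0.
  rewrite (_ : s^-1 * (s - 1) ^+ 2 = (s - 1) - s^-1 * (s - 1)); last by field; rewrite gt_eqF.
  by rewrite -e1; lra.
have l4 : (ln s) ^+ 2 <= c ^+ 2 * (s - 1) ^+ 2.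
  rewrite -exprMn -(real_normK (num_real (ln s))) -(real_normK (num_real (c * _))).
  rewrite ler_sqr ?nnegrE // normrM (ger0_norm c0).
  have [s1|s1] := lerP 1 s.
    rewrite ger0_norm ?ln_ge0 //.
    by apply: (le_trans l1); rewrite ler_peMl ?subr_ge0 // /c lerDr invr_ge0 ltW.
  rewrite ler0_norm ?ln_le0 ?(ltW s1) //.
  apply: (@le_trans _ _ (s^-1 * (1 - s))); first by rewrite -opprB mulrN -e1; lra.
  by apply: ler_wpM2r; [rewrite subr_ge0 ltW|rewrite /c; lra].
rewrite /powR gt_eqF //; set y := - alpha * ln s.
have yY : y <= Y.
  rewrite le_max; apply/orP; right.
  by rewrite /y !mulNr lerN2 ler_wpM2l // ler_ln ?posrE.
have h1 := expR_ge1Dx y.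
have h2 : expR y - 1 - y <= y * (expR y - 1).
  have := expR_ge1Dx (- y) => hy.
  have : expR y * expR (- y) = 1 by rewrite -expRD subrr expR0.
  have := expR_gt0 y; nra.
have h3 : `|expR y - 1| <= expR Y * `|y|.
  have := @expR_lipschitz _ y 0 Y yY; rewrite expR0 subr0; apply.
  by rewrite le_max lexx.
have h4 : expR y - 1 - y <= expR Y * y ^+ 2.
  apply: (le_trans h2); apply: (le_trans (ler_norm _)); rewrite normrM.
  apply: (le_trans (ler_wpM2l (normr_ge0 y) h3)).
  by rewrite mulrCA -expr2 real_normK // num_real.
have y2 : y ^+ 2 <= (alpha * c) ^+ 2 * (s - 1) ^+ 2.
  have -> : y ^+ 2 = alpha ^+ 2 * (ln s) ^+ 2 by rewrite /y; ring.
  have -> : (alpha * c) ^+ 2 * (s - 1) ^+ 2 = alpha ^+ 2 * (c ^+ 2 * (s - 1) ^+ 2) by ring.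
  by rewrite ler_wpM2l ?sqr_ge0.
have y3 : expR Y * y ^+ 2 <= expR Y * (alpha * c) ^+ 2 * (s - 1) ^+ 2.
  by rewrite -mulrA ler_wpM2l ?expR_ge0.
have y4 : alpha * ((s - 1) - ln s) <= alpha * s0^-1 * (s - 1) ^+ 2.
  by rewrite -mulrA ler_wpM2l.
have y5 : 0 <= alpha * ((s - 1) - ln s) by rewrite mulr_ge0 // subr_ge0.
rewrite (_ : expR y - 1 + _ = (expR y - 1 - y) + alpha * ((s - 1) - ln s)); last by rewrite /y; ring.
rewrite ger0_norm; last by rewrite addr_ge0 //; lra.
rewrite mulrDl; apply: lerD => //; exact: le_trans h4 y3.
Qed.

End PowRBounds.

(** * Reversibility, fundamental matrix and drift of the kernel *)

Section Kernel.
Context (R : realType) (N : nat) (P : 'M[R]_N) (mu : 'cV[R]_N) (alpha : R).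
Hypothesis chain : ergodic_reversible P mu.
Hypothesis alpha_ge0 : 0 <= alpha.
Implicit Types (x : 'cV[R]_N) (i j : 'I_N).

Definition pos_vec x := forall i, 0 < x i 0.

Let mu_gt0 i : 0 < mu i 0 := (mu_int_simplex chain).1 i.
Let mu_sum1 : \sum_i mu i 0 = 1 := (mu_int_simplex chain).2.
Let P0 := trans_ge0 chain.
Let P1 := trans_sum1 chain.

Lemma mu_stat j : \sum_i mu i 0 * P i j = mu j 0.
Proof.
have /matrixP/(_ 0 j) := mu_stationary chain; rewrite !mxE => <-.
by apply: eq_bigr => i _; rewrite mxE.
Qed.

Local Notation w := (srrw_weight mu alpha).

Definition Pw x i : R := \sum_k P i k * w x k.
Definition Wt x : R := \sum_i mu i 0 * (w x i * Pw x i).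
(** Since mu_i w_i P_ij w_j is symmetric in i and j, the kernel is reversible with respect to the
    row sums mu_i w_i (P w)_i. This is its stationary law, normalized by [Wt]. *)
Definition pv x i : R := mu i 0 * (w x i * Pw x i) / Wt x.
(** I - K + 1 pi^T; its inverse [Q] is the fundamental matrix of the chain frozen at x. *)
Definition poisson_mx x : 'M[R]_N :=
  \matrix_(i, j) ((i == j)%:R - srrw_kernel P mu alpha x i j + pv x j).
Definition Q x : 'M[R]_N := invmx (poisson_mx x).
(** This is K Q, see [KQ]; the form without a sum over K is convenient for Lipschitz bounds. *)
Definition psi x i j : R := Q x i j - (i == j)%:R + pv x j.
(** The deviation of Q(i', j) from its mean after one step from i, hence a martingale difference in
    i'. *)
Definition dM x i i' j : R := Q x i' j - psi x i j.

Lemma dME x i i' j : dM x i i' j = Q x i' j - psi x i j. Proof. by []. Qed.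

Lemma weight_gt0 x i : pos_vec x -> 0 < w x i.
Proof. by move=> xp; rewrite powR_gt0 // divr_gt0. Qed.

Lemma P_exists_gt0 i : exists j, 0 < P i j.
Proof.
apply: contrapT => /forallNP H.
have : \sum_j P i j = 0.
  apply: big1 => j _; apply: le_anti; rewrite P0 andbT leNgt.
  by apply/negP => h; apply: (H j).
by rewrite P1 => /eqP; rewrite oner_eq0.
Qed.

Lemma Pw_gt0 x i : pos_vec x -> 0 < Pw x i.
Proof.
move=> xp; have [j Pij] := P_exists_gt0 i.
rewrite /Pw (bigD1 j) //= ltr_pwDl ?mulr_gt0 ?weight_gt0 //.
by apply: sumr_ge0 => k _; rewrite mulr_ge0 // ltW // weight_gt0.
Qed.

Lemma Wt_gt0 x (i : 'I_N) : pos_vec x -> 0 < Wt x.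
Proof.
move=> xp; rewrite /Wt (bigD1 i) //= ltr_pwDl ?mulr_gt0 ?weight_gt0 ?Pw_gt0 //.
by apply: sumr_ge0 => k _; rewrite !mulr_ge0 ?(ltW (mu_gt0 _)) // ltW // ?weight_gt0 // Pw_gt0.
Qed.

Local Notation K := (srrw_kernel P mu alpha).

Lemma srrw_kernel_ge0 x i j : pos_vec x -> 0 <= K x i j.
Proof.
move=> xp; rewrite /srrw_kernel divr_ge0 ?mulr_ge0 //.
  by rewrite ltW // weight_gt0.
exact/ltW/Pw_gt0.
Qed.

Lemma srrw_kernel_sum1 x i : pos_vec x -> \sum_j K x i j = 1.
Proof.
move=> xp; rewrite /srrw_kernel -mulr_suml divff // gt_eqF //.
exact: Pw_gt0.
Qed.

Lemma pv_sum1 x (i : 'I_N) : pos_vec x -> \sum_j pv x j = 1.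
Proof. by move=> xp; rewrite -mulr_suml divff // gt_eqF // (Wt_gt0 i). Qed.

Lemma pv_stat x j : pos_vec x -> \sum_i pv x i * K x i j = pv x j.
Proof.
move=> xp.
have Pn i : Pw x i != 0 by rewrite gt_eqF // Pw_gt0.
rewrite /pv [X in _ = X]mulrAC -[X in _ = _ * X]mulr1.
transitivity (\sum_i (mu i 0 * P i j * (w x i * w x j)) / Wt x).
  apply: eq_bigr => i _; rewrite /srrw_kernel -/(Pw x i).
  by field; rewrite Pn gt_eqF // (Wt_gt0 j).
rewrite -mulr_suml mulr1 [RHS]mulrAC; congr (_ / _).
rewrite {1}/Pw !mulr_sumr; apply: eq_bigr => i _.
by rewrite (mu_reversible chain); ring.
Qed.

(** Maximum principle: a harmonic function that is maximal at one state is maximal at each successor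
    of positive probability, and irreducibility of P reaches every state. *)
Lemma harmonic_cst x (f : 'I_N -> R) : pos_vec x ->
  (forall i, \sum_j K x i j * f j = f i) -> forall i j, f i = f j.
Proof.
move=> xp Kf i0 j0.
have [m _ mmax] := @arg_maxP _ _ _ i0 xpredT f isT.
have mm j : f j <= f m by exact: (mmax j isT).
have step i j : f i = f m -> 0 < P i j -> f j = f m.
  move=> fi Pij; apply/eqP; rewrite eq_le mm /= leNgt; apply/negP => fj.
  have : \sum_j K x i j * (f m - f j) = 0.
    rewrite -fi; transitivity (\sum_j K x i j * f i - \sum_j K x i j * f j).
      by rewrite -sumrB; apply: eq_bigr => k _; rewrite mulrBr.
    by rewrite -mulr_suml srrw_kernel_sum1 // mul1r Kf subrr.
  apply/eqP; rewrite gt_eqF // (bigD1 j) //= ltr_pwDl //.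
    by rewrite mulr_gt0 ?subr_gt0 // divr_gt0 ?mulr_gt0 ?weight_gt0 // Pw_gt0.
  by apply: sumr_ge0 => k _; rewrite mulr_ge0 ?srrw_kernel_ge0 // subr_ge0 mm.
have pow_ge0 n i j : 0 <= (P ^+ n) i j.
  elim: n i j => [|n IHn] i j; first by rewrite expr0 mxE ler0n.
  by rewrite exprSr mxE; apply: sumr_ge0 => k _; rewrite mulr_ge0.
have reach n j : 0 < (P ^+ n) m j -> f j = f m.
  elim: n j => [|n IHn] j.
    by rewrite expr0 mxE ltr0n lt0b => /eqP ->.
  rewrite exprSr mxE => h.
  have [k /andP[hk1 hk2]] : exists k, (0 < (P ^+ n) m k) && (0 < P k j).
    apply: contrapT => /forallNP H; move: h; rewrite ltNge => /negP; apply.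
    apply: sumr_le0 => k _; have /negP := H k; rewrite negb_and -!leNgt => /orP[] hk.
      by apply: mulr_le0_ge0.
    by apply: mulr_ge0_le0.
  exact: step (IHn _ hk1) hk2.
have [n1 /reach ->] := irreducible chain m i0.
by have [n2 /reach ->] := irreducible chain m j0.
Qed.

(** If v is in the kernel, averaging against the stationary law gives pi v = 0. So v is harmonic,
    hence constant, hence zero. *)
Lemma poisson_unit x : pos_vec x -> poisson_mx x \in unitmx.
Proof.
move=> xp; rewrite -unitmx_tr unitmxE unitfE; apply/det0P => -[v vn0 vM].
have eqv i : v 0 i - \sum_j K x i j * v 0 j + \sum_j pv x j * v 0 j = 0.
  have /rowP/(_ i) := vM; rewrite !mxE => h.
  rewrite -[RHS]h -sumrN.
  have -> : v 0 i = \sum_j (i == j)%:R * v 0 j.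
    rewrite (bigD1 i) //= eqxx mul1r big1 ?addr0 // => j ji.
    by rewrite eq_sym (negbTE ji) mul0r.
  by rewrite -!big_split /=; apply: eq_bigr => j _; rewrite !mxE; ring.
have pv0 (i0 : 'I_N) : \sum_j pv x j * v 0 j = 0.
  have : \sum_i pv x i * (v 0 i - \sum_j K x i j * v 0 j + \sum_j pv x j * v 0 j) = 0.
    by apply: big1 => i _; rewrite eqv mulr0.
  under eq_bigr do rewrite mulrDr mulrBr.
  rewrite big_split sumrB /= -[X in _ + X]mulr_suml (pv_sum1 i0) // mul1r.
  have -> : \sum_i pv x i * \sum_j K x i j * v 0 j = \sum_j pv x j * v 0 j.
    under eq_bigr do rewrite mulr_sumr.
    rewrite exchange_big /=; apply: eq_bigr => j _.
    by rewrite -(pv_stat j xp) mulr_suml; apply: eq_bigr => i _; rewrite mulrA.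
  by rewrite subrr add0r.
have Kv i : \sum_j K x i j * v 0 j = v 0 i.
  by have := eqv i; rewrite (pv0 i) addr0 => /eqP; rewrite subr_eq0 eq_sym => /eqP.
have vc := harmonic_cst xp Kv.
move/eqP: vn0; apply; apply/rowP => i; rewrite !mxE.
have := pv0 i; under eq_bigr => j _ do rewrite (vc j i).
by rewrite -mulr_suml (pv_sum1 i) // mul1r.
Qed.

Lemma pvQ x j : pos_vec x -> \sum_i pv x i * Q x i j = pv x j.
Proof.
move=> xp; have h := mulmxV (poisson_unit xp).
pose p : 'rV[R]_N := \row_i pv x i.
have h1 : p *m poisson_mx x = p.
  apply/rowP => k; rewrite !mxE.
  under eq_bigr do rewrite !mxE mulrDr mulrBr.
  rewrite big_split sumrB /= pv_stat // -mulr_suml (pv_sum1 j) // mul1r.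
  rewrite (bigD1 k) //= eqxx mulr1 big1 ?addr0 ?subrr ?add0r // => l lk.
  by rewrite (negbTE lk) mulr0.
have : p *m Q x = p by rewrite -{1}h1 -mulmxA h mulmx1.
move=> /rowP/(_ j); rewrite !mxE => <-.
by apply: eq_bigr => i _; rewrite mxE.
Qed.

Lemma KQ x i j : pos_vec x -> \sum_k K x i k * Q x k j = psi x i j.
Proof.
move=> xp; have := mulmxV (poisson_unit xp) => /matrixP/(_ i j).
rewrite !mxE -/(Q x); under eq_bigr do rewrite mxE mulrDl mulrBl.
rewrite big_split sumrB /= pvQ // (bigD1 i) //= eqxx mul1r big1 => [|k ki]; last first.
  by rewrite eq_sym (negbTE ki) mul0r.
by rewrite addr0 /psi => <-; ring.
Qed.

Lemma dM_mean0 x i j : pos_vec x -> \sum_i' K x i i' * dM x i i' j = 0.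
Proof.
move=> xp; rewrite /dM; under eq_bigr do rewrite mulrBr.
by rewrite sumrB KQ // -mulr_suml srrw_kernel_sum1 // mul1r subrr.
Qed.

(** Besides the martingale difference, the terms in [psi] telescope along the trajectory up to the
    variation of x and of the step size. *)
Lemma noise_decomposition x i i' j :
  (i' == j)%:R - pv x j = dM x i i' j + psi x i j - psi x i' j.
Proof. by rewrite /dM /psi; ring. Qed.

Lemma poisson_eq (f : 'I_N -> R) x i : pos_vec x ->
  f i - \sum_j pv x j * f j = \sum_j Q x i j * f j -
    \sum_k K x i k * \sum_j Q x k j * f j.
Proof.
move=> xp.
have -> : \sum_k K x i k * \sum_j Q x k j * f j = \sum_j psi x i j * f j.
  under eq_bigr do rewrite mulr_sumr.
  rewrite exchange_big /=; apply: eq_bigr => j _.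
  by rewrite -KQ // mulr_suml; apply: eq_bigr => k _; rewrite mulrA.
have {1}-> : f i = \sum_j (i == j)%:R * f j.
  rewrite (bigD1 i) //= eqxx mul1r big1 ?addr0 // => j ji.
  by rewrite eq_sym (negbTE ji) mul0r.
by rewrite -!sumrB; apply: eq_bigr => j _; rewrite /psi; ring.
Qed.

Lemma weight_mu i : w mu i = 1.
Proof. by rewrite /srrw_weight divff ?gt_eqF // powR1. Qed.

Lemma Pw_mu i : Pw mu i = 1.
Proof. by rewrite /Pw; under eq_bigr do rewrite weight_mu mulr1; exact: P1. Qed.

Lemma kernel_mu i j : K mu i j = P i j.
Proof. by rewrite /srrw_kernel -/(Pw mu i) Pw_mu weight_mu mulr1 divr1. Qed.

Lemma Wt_mu : Wt mu = 1.
Proof. by rewrite /Wt; under eq_bigr do rewrite weight_mu Pw_mu !mulr1; exact: mu_sum1. Qed.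

Lemma pv_mu i : pv mu i = mu i 0.
Proof. by rewrite /pv weight_mu Pw_mu Wt_mu !mulr1 divr1. Qed.

Lemma mu_pos : pos_vec mu. Proof. exact: mu_gt0. Qed.

(** At [mu] the kernel is P, and 1 pi^T kills v, so I - K + 1 pi^T acts on v as 1 - l. *)
Lemma Q_mu_eigen (v : 'cV[R]_N) (l : R) i : P *m v = l *: v ->
  \sum_j mu j 0 * v j 0 = 0 -> l != 1 -> \sum_j Q mu i j * v j 0 = v i 0 / (1 - l).
Proof.
move=> Pv muv l1.
have h : poisson_mx mu *m v = (1 - l) *: v.
  apply/colP => k; rewrite !mxE; under eq_bigr do rewrite mxE mulrDl mulrBl.
  rewrite big_split sumrB /=.
  have -> : \sum_i pv mu i * v i 0 = 0 by rewrite -[RHS]muv; apply: eq_bigr => j _; rewrite pv_mu.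
  have -> : \sum_i K mu k i * v i 0 = l * v k 0.
    have /colP/(_ k) := Pv; rewrite !mxE => <-.
    by apply: eq_bigr => j _; rewrite kernel_mu.
  rewrite (bigD1 k) //= eqxx mul1r big1 => [|j jk]; first by ring.
  by rewrite eq_sym (negbTE jk) mul0r.
have := mulVmx (poisson_unit mu_pos) => h2.
have : Q mu *m (poisson_mx mu *m v) = v by rewrite mulmxA h2 mul1mx.
rewrite h -scalemxAr => /colP/(_ i); rewrite !mxE => h3.
by rewrite -[in RHS]h3 mulrC mulrA mulVf ?mul1r // subr_eq0 eq_sym.
Qed.

Lemma box_pos rho x : 0 < rho -> @box R N rho x -> pos_vec x.
Proof. by move=> r0 bx i; have /andP[h _] := bx i; exact: lt_le_trans h. Qed.

Lemma mu_lower_bound : exists2 m : R, 0 < m & forall i, m <= mu i 0.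
Proof.
case: (posnP N) => [N0|Npos].
  by exists 1 => // i; have := ltn_ord i; rewrite {2}N0.
have [m _ mmin] := @arg_minP _ _ _ (Ordinal Npos) xpredT (fun i => mu i 0) isT.
by exists (mu m 0) => // i; exact: mmin.
Qed.

Lemma mu_le1 i : mu i 0 <= 1.
Proof.
rewrite -mu_sum1 (bigD1 i) //= lerDl; apply: sumr_ge0 => j _; exact: ltW.
Qed.

Lemma blip_coord_box rho i : 0 < rho -> blip (box rho) (fun x => x i 0).
Proof.
move=> r0; apply: blip_coord; exists 2 => // x /(_ i) /andP[h1 h2].
by rewrite ger0_norm // (le_trans _ h1) // ltW.
Qed.

Section Box.
Variable rho : R.
Hypothesis rho_gt0 : 0 < rho.

Lemma ratio_ge x i : box rho x -> rho <= x i 0 / mu i 0.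
Proof.
move=> /(_ i) /andP[h _]; rewrite ler_pdivlMr // (le_trans _ h) //.
by rewrite ler_piMr ?mu_le1 // ltW.
Qed.

Lemma blip_weight i : blip (box rho) (fun x => w x i).
Proof.
pose K := rho `^ (- alpha) * alpha / rho.
have K0 : 0 <= K by rewrite divr_ge0 ?mulr_ge0 ?powR_ge0 // ltW.
apply: (@blip_comp _ _ _ (fun x => x i 0 / mu i 0) (fun s => s `^ (- alpha))
   (rho `^ (- alpha) + K)).
- by rewrite addr_ge0 ?powR_ge0.
- by apply: blipM; [exact: blip_coord_box|exact: blip_cst].
- move=> x bx; rewrite ger0_norm ?powR_ge0 //.
  by apply: (le_trans (powRN_antimono alpha_ge0 rho_gt0 (ratio_ge i bx))); rewrite lerDl.
- move=> x y bx by_; apply: (le_trans (powRN_lipschitz alpha_ge0 rho_gt0 _ _)).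
  + exact: ratio_ge.
  + exact: ratio_ge.
  + by rewrite ler_wpM2r // lerDr powR_ge0.
Qed.

Lemma weight_lower : exists2 c : R, 0 < c & forall x i, box rho x -> c <= w x i.
Proof.
have [m m0 hm] := mu_lower_bound.
exists ((2 / m) `^ (- alpha)); first by apply: powR_gt0; rewrite divr_gt0.
move=> x i bx; apply: powRN_antimono => //.
  by rewrite divr_gt0 //; exact: (box_pos rho_gt0 bx).
have /andP[h1 h2] := bx i; apply: ler_pM => //.
- by rewrite (le_trans _ h1) // ltW.
- by rewrite invr_ge0 ltW.
- by rewrite lef_pV2 ?posrE.
Qed.

Lemma blip_Pw i : blip (box rho) (fun x => Pw x i).
Proof.
by apply: blip_sum => k; apply: blipM; [exact: blip_cst|exact: blip_weight].
Qed.

Lemma Pw_lower c x i : (forall i, c <= w x i) -> c <= Pw x i.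
Proof.
move=> h; rewrite -[leLHS]mul1r -(P1 i) mulr_suml; apply: ler_sum => k _.
by rewrite ler_wpM2l.
Qed.

Lemma Pw_upper c x i : (forall i, w x i <= c) -> Pw x i <= c.
Proof.
move=> h; rewrite -[leRHS]mul1r -(P1 i) mulr_suml; apply: ler_sum => k _.
by rewrite ler_wpM2l.
Qed.

Lemma Wt_lower : exists2 c : R, 0 < c & forall x, box rho x -> c <= Wt x.
Proof.
have [c c0 hc] := weight_lower; exists (c * c); first exact: mulr_gt0.
move=> x bx; rewrite -[leLHS]mul1r -mu_sum1 mulr_suml; apply: ler_sum => i _.
rewrite ler_wpM2l ?(ltW (mu_gt0 _)) //; apply: ler_pM; rewrite ?(ltW c0) ?hc //.
by apply: Pw_lower => k; apply: hc.
Qed.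

Lemma blip_Wt : blip (box rho) Wt.
Proof.
apply: blip_sum => k; apply: blipM; first exact: blip_cst.
by apply: blipM; [exact: blip_weight|exact: blip_Pw].
Qed.

Lemma blip_pv i : blip (box rho) (fun x => pv x i).
Proof.
have [c c0 hc] := Wt_lower; apply: blipM.
  apply: blipM; first exact: blip_cst.
  by apply: blipM; [exact: blip_weight|exact: blip_Pw].
apply: (blipV c0); first exact: blip_Wt.
by move=> x bx; apply: (le_trans (hc _ bx)); exact: ler_norm.
Qed.

Lemma blip_kernel i j : blip (box rho) (fun x => K x i j).
Proof.
have [c c0 hc] := weight_lower; apply: blipM.
  by apply: blipM; [exact: blip_cst|exact: blip_weight].
apply: (blipV c0); first exact: blip_Pw.
move=> x bx; apply: le_trans (ler_norm _); apply: Pw_lower => k; exact: hc.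
Qed.

Lemma blip_poisson_mx i j : blip (box rho) (fun x => poisson_mx x i j).
Proof.
apply: (@blip_ext _ _ _ (fun x => (i == j)%:R - K x i j + pv x j)).
  by move=> x _; rewrite mxE.
by apply: blipD (blip_pv _); apply: blipB (blip_kernel _ _); exact: blip_cst.
Qed.

(** Cramer's rule: cofactors are polynomials in the entries, and the determinant stays away from
    zero on the box by compactness. *)
Lemma blip_Q i j : blip (box rho) (fun x => Q x i j).
Proof.
have bdet := blip_det blip_poisson_mx.
have [c c0 hc] : exists2 c : R, 0 < c & forall x, box rho x -> c <= `|\det (poisson_mx x)|.
  apply: box_lower_bound => // x bx.
  by have := poisson_unit (box_pos rho_gt0 bx); rewrite unitmxE unitfE.
apply: (@blip_ext _ _ _ (fun x => (\det (poisson_mx x))^-1 * cofactor (poisson_mx x) j i)).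
  move=> x bx; rewrite /Q /invmx poisson_unit; last exact: (box_pos rho_gt0 bx).
  by rewrite !mxE.
apply: blipM; first exact: (blipV c0).
apply: blipM; first exact: blip_cst.
apply: blip_det => k l.
by apply: (@blip_ext _ _ _ (fun x => poisson_mx x (lift j k) (lift i l))) => [x _|];
  [rewrite !mxE|exact: blip_poisson_mx].
Qed.

Lemma blip_psi i j : blip (box rho) (fun x => psi x i j).
Proof.
apply: blipD (blip_pv _); apply: blipB (blip_Q _ _) _; exact: blip_cst.
Qed.

Lemma blip_dM i i' j : blip (box rho) (fun x => dM x i i' j).
Proof. by apply: blipB; [exact: blip_Q|exact: blip_psi]. Qed.

(* With r = x / mu, the oscillation of r is contracted: at the maximum of r the
   drift is at most (max r * min r)^-alpha / Wt - max r, at the minimum at least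
   the same constant minus min r, and the constants cancel. *)
Lemma drift_contraction : exists2 g0 : R, 0 < g0 & forall x g (D : R),
  box rho x -> 0 <= g <= g0 ->
  (forall i j, x i 0 / mu i 0 - x j 0 / mu j 0 <= D) ->
  forall i j, (x i 0 + g * (pv x i - x i 0)) / mu i 0 -
    (x j 0 + g * (pv x j - x j 0)) / mu j 0 <= (1 - g) * D.
Proof.
pose L := rho `^ (- alpha) * alpha / rho.
have L0 : 0 <= L by rewrite divr_ge0 ?mulr_ge0 ?powR_ge0 // ltW.
have [c c0 hc] := Wt_lower.
pose B := rho `^ (- alpha); have B0 : 0 < B by rewrite powR_gt0.
have LB : 0 <= L * (B / c) by rewrite mulr_ge0 // divr_ge0 // ltW.
(* This limits g so that g L B / c <= 1 - g. Then (1 - g) r + g w(r) q / Wt is nondecreasing in r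
   for 0 <= q <= B, which is [key]. *)
exists (1 + L * (B / c))^-1; first by rewrite invr_gt0 ltr_pwDl.
move=> x g D bx /andP[g0 g1] hD i j.
have xp := box_pos rho_gt0 bx.
have Wp := Wt_gt0 i xp.
have gb : g * (L * (B / c)) <= 1 - g.
  move: g1; rewrite -[(1 + _)^-1]mul1r ler_pdivlMr ?ltr_pwDl // mulrDr mulr1.
  by rewrite lerBrDr addrC.
pose r k := x k 0 / mu k 0.
have wr k : w x k = r k `^ (- alpha) by [].
have rr k : rho <= r k by exact: ratio_ge.
have rp k : 0 < r k := lt_le_trans rho_gt0 (rr k).
have wB k : w x k <= B by rewrite wr powRN_antimono.
have [m _ mmax] := @arg_maxP _ _ _ i xpredT r isT.
have [l _ lmin] := @arg_minP _ _ _ i xpredT r isT.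
have rm k : r k <= r m by exact: mmax.
have rl k : r l <= r k by exact: lmin.
have upd k : (x k 0 + g * (pv x k - x k 0)) / mu k 0 =
    (1 - g) * r k + g * (w x k * Pw x k / Wt x).
  rewrite /pv /r; field; rewrite (gt_eqF Wp) gt_eqF //.
have wmono k k' : r k <= r k' -> w x k' <= w x k.
  by move=> h; rewrite !wr powRN_antimono.
have lip k k' : r k <= r k' -> w x k - w x k' <= L * (r k' - r k).
  move=> h; apply: (le_trans (ler_norm _)); rewrite !wr.
  apply: (le_trans (powRN_lipschitz alpha_ge0 rho_gt0 (rr _) (rr _))).
  by rewrite distrC ger0_norm // subr_ge0.
have key k k' q : r k <= r k' -> 0 <= q -> q <= B ->
    g * (w x k * q / Wt x) - g * (w x k' * q / Wt x) <= (1 - g) * (r k' - r k).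
  move=> h q0 qB.
  rewrite -mulrBr -!mulrA -mulrBl.
  have qW : q / Wt x <= B / c.
    by apply: ler_pM => //; rewrite ?invr_ge0 ?(ltW Wp) // lef_pV2 ?posrE ?hc.
  have q0W : 0 <= q / Wt x by rewrite divr_ge0 // ltW.
  have h1 : (w x k - w x k') * (q / Wt x) <= L * (r k' - r k) * (B / c).
    apply: ler_pM => //; first by rewrite subr_ge0 wmono.
    exact: lip.
  apply: (le_trans (ler_wpM2l g0 h1)).
  rewrite (_ : g * _ = g * (L * (B / c)) * (r k' - r k)); last by ring.
  by rewrite ler_wpM2r // subr_ge0.
have w0 k : 0 <= w x k by rewrite ltW // weight_gt0.
(* Weights decrease in r, so (P w)_i is at most the weight at the minimum [l]; then [key] moves i to
   the maximum [m]. The bound [lo] is symmetric. *)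
have up : (1 - g) * r i + g * (w x i * Pw x i / Wt x) <=
    (1 - g) * r m + g * (w x m * w x l / Wt x).
  have h1 : g * (w x i * Pw x i / Wt x) <= g * (w x i * w x l / Wt x).
    rewrite ler_wpM2l // ler_wpM2r ?invr_ge0 ?(ltW Wp) // ler_wpM2l //.
    by apply: Pw_upper => k; apply: wmono.
  have := key i m (w x l) (rm i) (w0 l) (wB l); lra.
have lo : (1 - g) * r l + g * (w x m * w x l / Wt x) <=
    (1 - g) * r j + g * (w x j * Pw x j / Wt x).
  have h1 : g * (w x j * w x m / Wt x) <= g * (w x j * Pw x j / Wt x).
    rewrite ler_wpM2l // ler_wpM2r ?invr_ge0 ?(ltW Wp) // ler_wpM2l //.
    by apply: Pw_lower => k; apply: wmono.
  have := key l j (w x m) (rl j) (w0 m) (wB m).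
  by rewrite [w x l * _]mulrC; lra.
rewrite !upd; apply: (@le_trans _ _ ((1 - g) * (r m - r l))); first by lra.
by apply: ler_wpM2l; [apply: le_trans gb; rewrite mulr_ge0|exact: hD].
Qed.

(** Write w = 1 + a and P w = 1 + b, where a is - alpha (x / mu - 1) to first order and b = P a. By
    reversibility the projection of b on v is l times that of a, which gives the factor 1 + l. *)
Lemma pv_taylor (v : 'cV[R]_N) (l : R) : box rho mu -> P *m v = l *: v ->
  \sum_j mu j 0 * v j 0 = 0 ->
  exists2 C : R, 0 <= C & forall x, box rho x ->
    `|\sum_i v i 0 * pv x i + alpha * (1 + l) * \sum_i v i 0 * (x i 0 - mu i 0)|
      <= C * `|x - mu| ^+ 2.
Proof.
move=> bmu Pv muv.
have [Ct Ct0 hCt] := powRN_taylor alpha_ge0 rho_gt0.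
have [Ca Ca0 [_ hCa]] := blip_unif blip_weight.
have [Cw Cw0 [_ hCw]] := blip_Wt.
have [c c0 hc] := Wt_lower.
have [m m0 hm] := mu_lower_bound.
pose V := \sum_i `|v i 0|; have V0 : 0 <= V by apply: sumr_ge0.
pose k := alpha * (1 + l).
pose C1 := `|1 + l| * (V * (Ct / m ^+ 2)) + V * Ca ^+ 2.
have C10 : 0 <= C1.
  have := sqr_ge0 m; have := sqr_ge0 Ca => h1 h2.
  by rewrite addr_ge0 // !mulr_ge0 // invr_ge0.
exists (C1 / c + `|k| * V * (Cw / c)).
  by rewrite addr_ge0 // ?divr_ge0 ?(ltW c0) // !mulr_ge0 // invr_ge0 ltW.
move=> x bx; set d := `|x - mu|; have d0 : 0 <= d := normr_ge0 _.
have dx i : `|x i 0 - mu i 0| <= d by have := norm_cV_le (x - mu) i; rewrite !mxE.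
set y := \sum_i v i 0 * (x i 0 - mu i 0).
have sumV (F : 'I_N -> R) (b : R) : 0 <= b -> (forall i, `|F i| <= b) ->
    `|\sum_i v i 0 * F i| <= V * b.
  move=> b0 hF; apply: (le_trans (ler_norm_sum _ _ _)).
  by rewrite mulr_suml; apply: ler_sum => i _; rewrite normrM ler_wpM2l.
have yd : `|y| <= V * d by apply: sumV.
pose a i := w x i - 1; pose b i := \sum_j P i j * a j.
have ad i : `|a i| <= Ca * d by rewrite /a -(weight_mu i); exact: hCa.
have bd i : `|b i| <= Ca * d.
  apply: (le_trans (ler_norm_sum _ _ _)); rewrite -[leRHS]mul1r -(P1 i) mulr_suml.
  by apply: ler_sum => j _; rewrite normrM (ger0_norm (P0 _ _)) ler_wpM2l.
have Pwb i : Pw x i = 1 + b i.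
  rewrite /b /a; under eq_bigr do rewrite mulrBr mulr1.
  by rewrite sumrB P1 addrC subrK.
pose th i := a i + alpha * (x i 0 / mu i 0 - 1).
have thd i : `|th i| <= Ct / m ^+ 2 * d ^+ 2.
  apply: (le_trans (hCt _ (ratio_ge i bx))); rewrite -mulrA ler_wpM2l //.
  have -> : x i 0 / mu i 0 - 1 = (mu i 0)^-1 * (x i 0 - mu i 0).
    by field; rewrite gt_eqF.
  rewrite exprMn -exprVn; apply: ler_pM; rewrite ?sqr_ge0 //.
    rewrite ler_sqr ?nnegrE ?invr_ge0 ?(ltW m0) ?(ltW (mu_gt0 _)) //.
    by rewrite lef_pV2 ?posrE.
  by rewrite -[X in X <= _](real_normK (num_real _)) ler_sqr ?nnegrE.
have mua : \sum_i mu i 0 * v i 0 * a i = - alpha * y + \sum_i v i 0 * (mu i 0 * th i).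
  rewrite /y mulr_sumr -big_split /=; apply: eq_bigr => i _; rewrite /th.
  by field; rewrite gt_eqF.
have mub : \sum_i mu i 0 * v i 0 * b i = l * \sum_i mu i 0 * v i 0 * a i.
  rewrite /b mulr_sumr; under eq_bigr do rewrite mulr_sumr.
  rewrite exchange_big /=; apply: eq_bigr => j _.
  have /colP/(_ j) := Pv; rewrite !mxE => Pvj.
  transitivity (mu j 0 * a j * \sum_i P j i * v i 0); last by rewrite Pvj; ring.
  rewrite mulr_sumr; apply: eq_bigr => i _.
  rewrite (_ : _ * (P i j * a j) = mu i 0 * P i j * (v i 0 * a j)); last by ring.
  by rewrite (mu_reversible chain); ring.
set A := \sum_i mu i 0 * v i 0 * (w x i * Pw x i).
have AE : A + k * y = (1 + l) * (\sum_i v i 0 * (mu i 0 * th i)) +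
    \sum_i v i 0 * (mu i 0 * (a i * b i)).
  have -> : A = \sum_i mu i 0 * v i 0 + \sum_i mu i 0 * v i 0 * a i +
      \sum_i mu i 0 * v i 0 * b i + \sum_i v i 0 * (mu i 0 * (a i * b i)).
    rewrite -!big_split; apply: eq_bigr => i _ /=.
    have -> : w x i = 1 + a i by rewrite /a addrC subrK.
    by rewrite Pwb; ring.
  by rewrite muv mub mua /k; ring.
have hA : `|A + k * y| <= C1 * d ^+ 2.
  rewrite AE; apply: (le_trans (ler_normD _ _)); rewrite /C1 [leRHS]mulrDl; apply: lerD.
    rewrite normrM -mulrA ler_wpM2l // -mulrA; apply: sumV => [|i].
      by rewrite mulr_ge0 ?sqr_ge0 // divr_ge0 // sqr_ge0.
    apply: le_trans (thd i); rewrite normrM ler_piMl // gtr0_norm //.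
    exact: mu_le1.
  rewrite -mulrA; apply: sumV => [|i]; first by rewrite mulr_ge0 ?sqr_ge0.
  rewrite normrM (gtr0_norm (mu_gt0 _)); apply: (@le_trans _ _ `|a i * b i|).
    by rewrite ler_piMl // mu_le1.
  by rewrite normrM -exprMn expr2; apply: ler_pM.
have W1 : `|Wt x - 1| <= Cw * d by rewrite -Wt_mu; exact: hCw.
have cW := hc _ bx; have W0 : 0 < Wt x := lt_le_trans c0 cW.
have -> : \sum_i v i 0 * pv x i = A / Wt x.
  rewrite /A mulr_suml; apply: eq_bigr => i _; rewrite /pv; ring.
(* The normalization only matters at second order, since y and Wt x - 1 are both O(d). *)
have -> : A / Wt x + alpha * (1 + l) * y =
    (A + k * y) / Wt x + k * y * ((Wt x - 1) / Wt x).
  by rewrite /k; field; rewrite gt_eqF.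
have WV : (Wt x)^-1 <= c^-1 by rewrite lef_pV2 ?posrE.
apply: (le_trans (ler_normD _ _)); rewrite [leRHS]mulrDl; apply: lerD.
  rewrite normrM (gtr0_norm (_ : 0 < (Wt x)^-1)) ?invr_gt0 // [leRHS]mulrAC.
  by apply: ler_pM => //; rewrite invr_ge0 ltW.
rewrite !normrM (gtr0_norm (_ : 0 < (Wt x)^-1)) ?invr_gt0 //.
rewrite [leRHS](_ : _ = `|alpha| * `|1 + l| * (V * d) * (Cw * d / c)); last by ring.
apply: ler_pM; rewrite ?mulr_ge0 ?invr_ge0 ?(ltW W0) //.
  by rewrite ler_wpM2l.
by apply: ler_pM; rewrite ?invr_ge0 ?(ltW W0).
Qed.

End Box.
End Kernel.

(** * The process as a law on paths *)

Section ListSum.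
Context (R : realType) (S : finType).

Fixpoint paths (n : nat) : seq (seq S) :=
  if n is n'.+1 then [seq j :: p | p <- paths n', j <- enum S] else [:: [::]].

Lemma sum_paths n (F : seq S -> R) :
  \sum_(p <- paths n.+1) F p = \sum_(p <- paths n) \sum_j F (j :: p).
Proof.
rewrite /= big_allpairs_dep /=; apply: eq_bigr => p _.
by rewrite big_enum.
Qed.

Lemma size_paths n p : p \in paths n -> size p = n.
Proof.
elim: n p => [|n IHn] p; first by rewrite inE => /eqP ->.
by move=> /allpairsP[[p' j] /= [/IHn <- _ ->]].
Qed.

Lemma mem_paths p : p \in paths (size p).
Proof.
elim: p => [|j p IHp]; first by rewrite inE.
by apply/allpairsP; exists (p, j); split => //=; rewrite mem_enum.
Qed.

Lemma paths_delta n (F : seq S -> R) q : size q = n ->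
  \sum_(p <- paths n) F p * (q == p)%:R = F q.
Proof.
elim: n F q => [|n IHn] F q.
  by move/size0nil ->; rewrite big_seq1 eqxx mulr1.
case: q => // j q [sq]; rewrite sum_paths -(IHn (fun p => F (j :: p)) q sq).
apply: eq_bigr => p _; rewrite (bigD1 j) //= eqseq_cons eqxx /=.
rewrite big1 ?addr0 // => i ij.
by rewrite eqseq_cons eq_sym (negbTE ij) mulr0.
Qed.

Variable k : seq S -> S -> R.

Fixpoint path_weight (p : seq S) : R :=
  if p is j :: p' then path_weight p' * k p' j else 1.

Lemma Ex_paths n f : Ex k n f = \sum_(p <- paths n) f p * path_weight p.
Proof.
elim: n f => [|n IHn] f; first by rewrite big_seq1 mulr1.
rewrite sum_paths /= IHn; apply: eq_bigr => p _.
by rewrite /step mulr_suml; apply: eq_bigr => j _; ring.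
Qed.

End ListSum.

Section Process.
Context (R : realType) (N D : nat) (P : 'M[R]_N) (mu : 'cV[R]_N) (alpha a : R).
Hypothesis chain : ergodic_reversible P mu.
Context (x0 : 'cV[R]_N) (i0 : 'I_N).
Hypothesis x0_simplex : int_simplex x0.
Hypothesis a_gt : 2^-1 < a.
Hypothesis a_le1 : a <= 1.

Local Notation g := (step_size a).

(* [xs p] and [Xs p] are the values of x and X after the path [p]. *)
Fixpoint xs (p : seq 'I_N) : 'cV[R]_N :=
  if p is j :: p' then xs p' + g (size p) *: (delta_mx j 0 - xs p') else x0.
Definition Xs (p : seq 'I_N) : 'I_N := head i0 p.
Definition pker (p : seq 'I_N) (j : 'I_N) : R := srrw_kernel P mu alpha (xs p) (Xs p) j.

Lemma xs_cons j p i : xs (j :: p) i 0 =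
  (1 - g (size p).+1) * xs p i 0 + g (size p).+1 * (i == j)%:R.
Proof. by rewrite /= !mxE eqxx andbT; ring. Qed.

Lemma xs_simplex p : int_simplex (xs p).
Proof.
elim: p => [|j p [IH1 IH2]] //; split.
  move=> i; rewrite xs_cons ltr_pwDl //; last first.
    by rewrite mulr_ge0 // ltW // step_size_gt0.
  by rewrite mulr_gt0 // subr_gt0 step_sizeS_lt1.
under eq_bigr do rewrite xs_cons.
rewrite big_split /= -!mulr_sumr IH2 (bigD1 j) //= eqxx big1; last first.
  by move=> i /negbTE ->.
by rewrite addr0 !mulr1 subrK.
Qed.

Lemma xs_pos p : pos_vec (xs p). Proof. exact: (xs_simplex p).1. Qed.

Lemma xs_le1 p i : xs p i 0 <= 1.
Proof.
rewrite -(xs_simplex p).2 (bigD1 i) //= lerDl; apply: sumr_ge0 => j _.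
exact/ltW/xs_pos.
Qed.

Lemma pker_ge0 p j : 0 <= pker p j.
Proof. by rewrite /pker; apply: (srrw_kernel_ge0 _ chain); exact: xs_pos. Qed.

Lemma pker_sum1 p : \sum_j pker p j = 1.
Proof. by rewrite /pker; apply: (srrw_kernel_sum1 _ chain); exact: xs_pos. Qed.

Context (beta : nat -> R) (H : 'cV[R]_D -> 'I_N -> 'cV[R]_D) (theta0 : 'cV[R]_D).
Context (d : measure_display) (Omega : measurableType d) (Pr : probability Omega R).
Context (theta : nat -> Omega -> 'cV[R]_D) (x : nat -> Omega -> 'cV[R]_N).
Context (X : nat -> Omega -> 'I_N).
Hypothesis proc : sa_srrw P mu alpha beta g H theta0 x0 i0 Pr theta x X.

Fixpoint path_of (n : nat) (w : Omega) : seq 'I_N :=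
  if n is n'.+1 then X n w :: path_of n' w else [::].

Lemma size_path_of n w : size (path_of n w) = n.
Proof. by elim: n => //= n ->. Qed.

Lemma ae_path : {ae Pr, forall w, X 0%N w = i0 /\ forall n, x n w = xs (path_of n w)}.
Proof.
have h1 := initial_point proc; have h2 := ae_foralln (x_recursion proc).
apply: filterS2 h1 h2 => w [_ h1 h2] h; split => // n.
elim: n => [|n IHn]; first by rewrite h1.
by rewrite h IHn /= size_path_of.
Qed.

Lemma measurable_path n p : measurable [set w | path_of n w = p].
Proof.
elim: n p => [|n IHn] [|j p].
- by rewrite (_ : [set _ | _] = setT) //; apply/seteqP; split.
- by rewrite (_ : [set _ | _] = set0) //; apply/seteqP; split.
- by rewrite (_ : [set _ | _] = set0) //; apply/seteqP; split.
- rewrite (_ : [set _ | _] = [set w | X n.+1 w = j] `&` [set w | path_of n w = p]).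
    by apply: measurableI => //; exact: (X_measurable proc).
  by apply/seteqP; split => w /=; [move=> [-> ->]|move=> [-> ->]].
Qed.

Lemma measurable_path_event n (E : seq 'I_N -> bool) :
  measurable [set w | E (path_of n w)].
Proof.
rewrite (_ : [set _ | _] = \bigcup_(p in [set` [seq p <- paths _ n | E p]])
    [set w | path_of n w = p]).
  by apply: fin_bigcup_measurable => // p _; exact: measurable_path.
apply/seteqP; split => w /=.
  move=> Ew; exists (path_of n w) => //=.
  by rewrite mem_filter Ew -{2}(size_path_of n w) mem_paths.
by move=> [p /=]; rewrite mem_filter => /andP[Ep _] ->.
Qed.

Lemma ae_measure_eq A B : measurable A -> measurable B ->
  {ae Pr, forall w, A w <-> B w} -> Pr A = Pr B.
Proof.
move=> mA mB AB; rewrite -(setIT A) -(setIT B) -!integral_indic //.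
apply: ae_eq_integral => //; do 2?by apply/measurable_EFinP; exact: measurable_indic.
apply: filterS AB => w AB _; congr EFin; rewrite !indicE; congr ((_ : bool)%:R).
by apply/idP/idP; rewrite !inE => /AB.
Qed.

(* The event of following [p] with all the almost sure identities imposed:
   unlike the bare path event, the kernel is constant on it. *)
Let cyl n p : set Omega :=
  [set w | path_of n w = p /\ X 0%N w = i0 /\ forall i, x n w i 0 = xs p i 0].

Lemma pastC n A : past theta x X n A -> past theta x X n (~` A).
Proof. exact: sigma_algebraC. Qed.

Lemma pastU n (F : nat -> set Omega) : (forall i, past theta x X n (F i)) ->
  past theta x X n (\bigcup_i F i).
Proof. exact: sigma_algebra_bigcup. Qed.

Lemma pastI n A B : past theta x X n A -> past theta x X n B ->
  past theta x X n (A `&` B).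
Proof.
move=> pA pB; rewrite (_ : A `&` B = ~` (\bigcup_i (if i == 0%N then ~` A else ~` B))).
  by apply: pastC; apply: pastU => i; case: ifP => _; apply: pastC.
apply/seteqP; split => [w [Aw Bw] [i _]|w /=]; first by case: ifP => _ /=.
by move=> h; split; apply: contrapT => nw; apply: h; [exists 0%N|exists 1%N].
Qed.

Lemma past_X n m i : (m <= n)%N -> past theta x X n [set w | X m w = i].
Proof. by move=> mn; apply: sub_sigma_algebra; exists m => //; apply: Or33; exists i. Qed.

Lemma past_x n m i (c : R) : (m <= n)%N -> past theta x X n [set w | x m w i 0 = c].
Proof.
move=> mn; apply: sub_sigma_algebra; exists m => //; apply: Or32; exists i, [set c].
by split => //; exact: measurable_set1.
Qed.

Lemma pastT n : past theta x X n setT.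
Proof. by rewrite -setC0; apply: pastC; exact: sigma_algebra0. Qed.

Lemma past_path n m p : (m <= n)%N -> past theta x X n [set w | path_of m w = p].
Proof.
elim: m p => [|m IHm] [|j p] mn.
- by rewrite (_ : [set _ | _] = setT); [exact: pastT|apply/seteqP; split].
- by rewrite (_ : [set _ | _] = set0); [exact: sigma_algebra0|apply/seteqP; split].
- by rewrite (_ : [set _ | _] = set0); [exact: sigma_algebra0|apply/seteqP; split].
- rewrite (_ : [set _ | _] = [set w | X m.+1 w = j] `&` [set w | path_of m w = p]).
    by apply: pastI; [exact: past_X|apply: IHm; exact: ltnW].
  by apply/seteqP; split => w /=; [move=> [-> ->]|move=> [-> ->]].
Qed.

Lemma past_cyl n p : past theta x X n (cyl n p).
Proof.
rewrite (_ : cyl n p = [set w | path_of n w = p] `&` ([set w | X 0%N w = i0] `&`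
    \bigcap_(i : 'I_N) [set w | x n w i 0 = xs p i 0])); last first.
  apply/seteqP; split => w /=; first by move=> [-> [-> h]]; split => //; split => // i _; exact: h.
  by move=> [h1 [h2 h]]; split => //; split => // i; exact: h.
apply: pastI; first exact: past_path.
apply: pastI; first exact: past_X.
rewrite -(setCK (\bigcap__ _)) setC_bigcap.
apply: pastC.
rewrite (_ : \bigcup__ _ = \bigcup_k (if insub k is Some i then ~` [set w | x n w (i : 'I_N) 0 = xs p i 0] else set0)).
  apply: pastU => k; case: insubP => [i _ _|_]; last exact: sigma_algebra0.
  by apply: pastC; exact: past_x.
apply/seteqP; split => w /= [k _]; first by move=> h; exists (val k) => //; rewrite valK.
by case: insubP => [i _ _ h|//]; exists i.
Qed.

Lemma past_measurable n A : past theta x X n A -> measurable A.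
Proof.
apply: smallest_sub; first exact: sigma_algebra_measurable.
move=> B [k _ [[j [C [mC ->]]]|[j [C [mC ->]]]|[i ->]]].
- by rewrite -[X in measurable X]setTI; apply: (theta_measurable proc).
- by rewrite -[X in measurable X]setTI; apply: (x_measurable proc).
- exact: (X_measurable proc).
Qed.

(** Induction on the path. Replacing the path event by [cyl], on which the conditional law is
    constant, each step contributes one factor of [path_weight]. *)
Lemma path_probability n p : size p = n ->
  Pr [set w | path_of n w = p] = (path_weight pker p)%:E.
Proof.
elim: n p => [|n IHn] p sp.
  rewrite (size0nil sp) (_ : [set _ | _] = setT) ?probability_setT //.
  by apply/seteqP; split.
case: p sp => // j p [sp]; have mc : measurable (cyl n p) := past_measurable (@past_cyl n p).
have aec : {ae Pr, forall w, path_of n w = p <-> cyl n p w}.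
  apply: filterS ae_path => w [w0 wx]; split => [pw|[]//].
  by split => //; split => // i; rewrite wx pw.
rewrite (@ae_measure_eq _ (cyl n p `&` [set w | X n.+1 w = j])).
- rewrite (X_conditional_law proc) //; last exact: past_cyl.
  transitivity (\int[Pr]_(w in cyl n p) (cst (pker p j)%:E) w)%E.
    apply: eq_integral => w; rewrite inE => -[pw [w0 wx]]; congr EFin.
    have -> : x n w = xs p by apply/colP.
    rewrite /pker; congr srrw_kernel; rewrite /Xs.
    (* For the empty path the current state is X_0, which is why [cyl] also prescribes X_0. *)
    by case: (n) pw => [|m] <-.
  have e : Pr (cyl n p) = (path_weight pker p)%:E.
    rewrite -(IHn _ sp); apply: ae_measure_eq => //; first exact: measurable_path.
    by apply: filterS aec => w [h1 h2]; split.
  by rewrite integral_cst // [X in (_ * X)%E]e /= -EFinM mulrC.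
- exact: measurable_path.
- by apply: measurableI => //; exact: (X_measurable proc).
- apply: filterS aec => w h; split=> /=; first by move=> [-> /h].
  by move=> [/h -> ->].
Qed.

Lemma path_decomposition n (f : seq 'I_N -> R) w :
  f (path_of n w) = \sum_(p <- paths _ n) f p * \1_[set w | path_of n w = p] w.
Proof.
rewrite -(paths_delta f (size_path_of n w)); apply: eq_bigr => p _.
by rewrite indicE /=; congr (_ * (_ : bool)%:R); apply/eqP/idP; rewrite inE.
Qed.

Lemma measurable_path_fun n (f : seq 'I_N -> R) :
  measurable_fun [set: Omega] (fun w => f (path_of n w)).
Proof.
under eq_fun do rewrite path_decomposition.
apply: measurable_sum => p; apply: measurable_funM => //.
by apply: measurable_indic; exact: measurable_path.
Qed.

Lemma integral_path n (f : seq 'I_N -> R) :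
  (\int[Pr]_w (f (path_of n w))%:E = (Ex pker n f)%:E)%E.
Proof.
under eq_integral => w _.
  rewrite path_decomposition -sumEFin.
  over.
rewrite /= integral_sum //; last first.
  move=> p; under eq_fun do rewrite EFinM.
  apply: integrableZl => //; apply: integrable_indic => //.
  exact: measurable_path.
rewrite Ex_paths -sumEFin big_seq [RHS]big_seq; apply: eq_bigr => p pn.
under eq_integral do rewrite EFinM.
have mp := measurable_path n p.
rewrite integralZl //; last exact: integrable_indic.
rewrite integral_indic // setIT [X in (_ * X)%E]path_probability; first by rewrite EFinM.
exact: size_paths.
Qed.

Lemma probability_path_event n (E : seq 'I_N -> bool) :
  Pr [set w | E (path_of n w)] = (Ex pker n (fun p => (E p)%:R))%:E.
Proof.
rewrite -integral_path -[X in Pr X]setIT -integral_indic //; last exact: measurable_path_event.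
apply: eq_integral => w _; rewrite indicE; congr ((_ : bool)%:R%:E).
by apply/idP/idP; rewrite inE.
Qed.

(* Countable additivity turns the maximal inequality at finite horizons into
   almost sure convergence of a square summable martingale. *)
Lemma martingale_cauchy (xi : seq 'I_N -> 'I_N -> R) (C : R) :
  (forall p, \sum_j pker p j * xi p j = 0) ->
  (forall p, \sum_j pker p j * xi p j ^+ 2 <= C * g (size p).+1 ^+ 2) ->
  {ae Pr, forall w, forall e : nat, exists m, forall n, (m <= n)%N ->
     `|psum xi (path_of n w) - psum xi (path_of m w)| <= e.+1%:R^-1}.
Proof.
move=> mxi vxi; apply: ae_foralln => e.
pose eps : R := e.+1%:R^-1; have eps0 : 0 < eps by rewrite invr_gt0.
(* Erasing the increments before time m turns the partial sum into the increment of the martingale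
   since m. *)
pose xm m p j := if (m <= size p)%N then xi p j else 0.
have xmE m n w : (m <= n)%N -> psum (xm m) (path_of n w) =
    psum xi (path_of n w) - psum xi (path_of m w).
  have x_lt k : (k <= m)%N -> psum (xm m) (path_of k w) = 0.
    elim: k => [|k IHk] km //=; rewrite IHk ?(ltnW km) // add0r /xm size_path_of.
    by rewrite leqNgt km.
  elim: n => [|n IHn]; first by rewrite leqn0 => /eqP ->; rewrite subrr.
  rewrite leq_eqVlt => /predU1P[<-|]; first by rewrite subrr x_lt.
  by rewrite ltnS => mn /=; rewrite IHn // /xm size_path_of mn addrAC.
pose B m n := [set w | exceeds (xm m) eps (path_of n w)].
have mB m n : measurable (B m n) by exact: measurable_path_event.
pose c m (i : nat) : R := if (m <= i)%N then C * g i.+1 ^+ 2 else 0.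
have PB m n : (Pr (B m n) <= ((\sum_(i < n) c m i) / eps ^+ 2)%:E)%E.
  rewrite probability_path_event lee_fin.
  apply: (kolmogorov pker_ge0 pker_sum1 eps0) => p _; rewrite /xm /c; case: (m <= size p)%N => //.
    by rewrite big1 // => j _; rewrite mulr0.
  by rewrite big1 // => j _; rewrite expr0n mulr0.
have ndB m : nondecreasing_seq (B m).
  apply/nondecreasing_seqP => n; apply/subsetPset => w /= h.
  by rewrite /B /= h orbT.
have C0 : 0 <= C.
  have g1 : 0 < g 1 ^+ 2 by rewrite exprn_gt0 // step_size_gt0.
  rewrite -(pmulr_lge0 _ g1); apply: le_trans (vxi [::]).
  by apply: sumr_ge0 => j _; rewrite mulr_ge0 ?sqr_ge0 ?pker_ge0.
have sumc m n : \sum_(i < n) c m i <= C * \sum_(m <= i < n) g i.+1 ^+ 2.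
  rewrite -(big_mkord xpredT (c m)) mulr_sumr.
  have [mn|nm] := leqP m n.
    rewrite (big_cat_nat _ mn) //= big_nat_cond big1 ?add0r; last first.
      by move=> i /andP[/andP[_ im] _]; rewrite /c leqNgt im.
    by rewrite le_eqVlt; apply/orP; left; apply/eqP; apply: eq_big_nat => i /andP[mi _]; rewrite /c mi.
  rewrite big_nat_cond big1 ?big_geq ?(ltnW nm) //.
  by move=> i /andP[/andP[_ im] _]; rewrite /c leqNgt (ltn_trans im nm).
(* For fixed m, the union over n is bounded by the tail from m of the sum of squared steps, which is
   small for late m. *)
have null : Pr (\bigcap_m \bigcup_n B m n) = 0%E.
  apply/eqP; rewrite eq_le measure_ge0 andbT; apply/lee_addgt0Pr => r r0.
  rewrite add0e.
  have r' : 0 < r * eps ^+ 2 / (C + 1) by rewrite divr_gt0 ?mulr_gt0 ?exprn_gt0 // ltr_wpDl.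
  have [m _ /(_ m (leqnn m)) hm] := step_size_sqr_tail a_gt r'.
  have mU m' : measurable (\bigcup_n B m' n) by exact: bigcup_measurable.
  apply: (@le_trans _ _ (Pr (\bigcup_n B m n))).
    apply: le_measure; rewrite ?inE //; first exact: bigcap_measurable.
    exact: bigcap_inf.
  have := nondecreasing_cvg_mu (mu := Pr) (mB m) (mU m) (ndB m) => cv.
  rewrite -(cvg_lim _ cv) //; apply: lime_le; first by apply/cvg_ex; eexists; exact: cv.
  near=> n; apply: (le_trans (PB m n)); rewrite lee_fin ler_pdivrMr ?exprn_gt0 //.
  apply: (le_trans (sumc m n)).
  apply: (@le_trans _ _ ((C + 1) * (r * eps ^+ 2 / (C + 1)))).
    apply: ler_pM => //; last by rewrite lerDl.
    by apply: sumr_ge0 => i _; rewrite sqr_ge0.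
  by rewrite mulrC divfK // gt_eqF // ltr_wpDl.
have mI : measurable (\bigcap_m \bigcup_n B m n).
  by apply: bigcap_measurable => // m _; apply: bigcup_measurable.
exists (\bigcap_m \bigcup_n B m n); split => // w /= nw m _.
apply: contrapT => hm; apply: nw; exists m => n mn.
rewrite leNgt; apply/negP => h; apply: hm; exists n => //.
rewrite /B /=.
have -> : exceeds (xm m) eps (path_of n w) =
  (eps < `|psum (xm m) (path_of n w)|) || (if path_of n w is _ :: p' then exceeds (xm m) eps p' else false).
  by case: (path_of n w).
by rewrite xmE // h.
Unshelve. all: by end_near. Qed.

End Process.

(** * Almost sure convergence *)

Section PathwiseConvergence.
Context (R : realType) (N : nat) (P : 'M[R]_N) (mu : 'cV[R]_N) (alpha a : R).
Hypothesis chain : ergodic_reversible P mu.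
Hypothesis alpha_ge0 : 0 <= alpha.
Hypothesis a_gt : 2^-1 < a.
Hypothesis a_le1 : a <= 1.

Local Notation g := (step_size a).
Local Notation pv := (pv P mu alpha).
Local Notation psi := (psi P mu alpha).
Local Notation dM := (dM P mu alpha).

Definition osc (x : 'cV[R]_N) : R :=
  \big[Num.max/0]_(ij : 'I_N * 'I_N) (x ij.1 0 / mu ij.1 0 - x ij.2 0 / mu ij.2 0).

Lemma osc_ge0 (x : 'cV[R]_N) : 0 <= osc x.
Proof. by rewrite /osc; apply: bigmax_ge_id. Qed.

Lemma osc_ge (x : 'cV[R]_N) i j : x i 0 / mu i 0 - x j 0 / mu j 0 <= osc x.
Proof. by rewrite /osc; apply/bigmax_geP; right; exists (i, j). Qed.

Lemma osc_le (x : 'cV[R]_N) (c : R) : 0 <= c ->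
  (forall i j, x i 0 / mu i 0 - x j 0 / mu j 0 <= c) -> osc x <= c.
Proof. by move=> c0 h; apply/bigmax_leP; split => // -[i j] _; exact: h. Qed.

(** As x and mu have mass one, x_i - mu_i is mu_i times the mu-average over j of x_i / mu_i - x_j /
    mu_j. *)
Lemma osc_dist_mu (x : 'cV[R]_N) i : \sum_i x i 0 = 1 -> `|x i 0 - mu i 0| <= osc x.
Proof.
move=> x1; have [mu0 mu1] := mu_int_simplex chain.
have -> : x i 0 - mu i 0 = mu i 0 * \sum_j mu j 0 * (x i 0 / mu i 0 - x j 0 / mu j 0).
  under eq_bigr do rewrite mulrBr.
  rewrite sumrB -mulr_suml mu1 mul1r.
  have -> : \sum_j mu j 0 * (x j 0 / mu j 0) = 1.
    by rewrite -x1; apply: eq_bigr => j _; rewrite mulrC divfK // gt_eqF.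
  by rewrite mulrBr mulr1 mulrC divfK // gt_eqF.
rewrite normrM gtr0_norm //; apply: (@le_trans _ _ (1 * osc x)); last by rewrite mul1r.
apply: ler_pM => //; rewrite ?(ltW (mu0 _)) //; first exact: (mu_le1 chain).
apply: (le_trans (ler_norm_sum _ _ _)); rewrite -[leRHS]mul1r -mu1 mulr_suml.
apply: ler_sum => j _; rewrite normrM gtr0_norm // ler_wpM2l ?(ltW (mu0 _)) //.
by rewrite ler_norml osc_ge andbT lerNl opprB osc_ge.
Qed.

Context (x : nat -> 'cV[R]_N) (X : nat -> 'I_N) (rho : R).
Hypothesis rho_gt0 : 0 < rho.
Hypothesis x_box : forall n, box rho (x n).
Hypothesis x_simplex : forall n, int_simplex (x n).
Hypothesis x_rec : forall n,
  x n.+1 = x n + g n.+1 *: (delta_mx (X n.+1) 0 - x n).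

Let M j n := \sum_(0 <= k < n) g k.+1 * dM (x k) (X k) (X k.+1) j.
Hypothesis M_cauchy : forall j (e : R), 0 < e ->
  exists m, forall n, (m <= n)%N -> `|M j n - M j m| <= e.

Let g0 n : 0 <= g n := step_size_ge0 a n.
Let half0 : 0 < rho / 2. Proof. by rewrite divr_gt0. Qed.

Let x_le1 n j : x n j 0 <= 1.
Proof.
rewrite -(x_simplex n).2 (bigD1 j) //= lerDl; apply: sumr_ge0 => i _.
exact/ltW/(x_simplex n).1.
Qed.

Let x_inc n j : `|x n.+1 j 0 - x n j 0| <= g n.+1.
Proof.
rewrite x_rec !mxE eqxx andbT [x n j 0 + _]addrC addrK normrM ger0_norm // -[leRHS]mulr1.
rewrite ler_wpM2l // ler_norml; have := x_le1 n j; have := (x_simplex n).1 j.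
by case: eqP => _ /=; lra.
Qed.

Let box_half n : box (rho / 2) (x n).
Proof.
by move=> i; have /andP[h1 h2] := x_box n i; have := rho_gt0; move=> r0; apply/andP; split; lra.
Qed.

(* Adding [g n.+1 * psi] to x and removing the martingale part leaves the
   deterministic recursion up to an error O(g^2). *)
Let z j n := x n j 0 + g n.+1 * psi (x n) (X n) j - M j n.

Let z_rec : exists2 C : R, 0 <= C & forall j n,
  `|z j n.+1 - (z j n + g n.+1 * (pv (x n) j - x n j 0))| <= C * g n.+1 ^+ 2.
Proof.
have [C C0 [hC1 hC2]] := blip_unif (fun ij : 'I_N * 'I_N =>
  blip_psi chain alpha_ge0 rho_gt0 ij.1 ij.2).
exists (C + C); first exact: addr_ge0.
move=> j n.
have -> : z j n.+1 - (z j n + g n.+1 * (pv (x n) j - x n j 0)) =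
    - (g n.+1 - g n.+2) * psi (x n.+1) (X n.+1) j +
    g n.+1 * (psi (x n.+1) (X n.+1) j - psi (x n) (X n.+1) j).
  rewrite /z /M big_nat_recr //= x_rec !mxE eqxx andbT.
  have := noise_decomposition P mu alpha (x n) (X n) (X n.+1) j.
  rewrite [j == _]eq_sym; set D := (_ == _)%:R => hD.
  have -> : D = pv (x n) j + (dM (x n) (X n) (X n.+1) j + psi (x n) (X n) j
    - psi (x n) (X n.+1) j) by rewrite -hD; ring.
  by rewrite -x_rec; ring.
apply: (le_trans (ler_normD _ _)); rewrite mulrDl.
have gd := step_size_diff a_gt a_le1 n.+1.
have gm := @step_size_nonincr _ _ a_gt n.+1 n.+2 (leqnSn _).
apply: lerD.
  rewrite normrM normrN mulrC expr2; apply: ler_pM => //.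
    exact: (hC1 (_, _)).
  rewrite ger0_norm ?subr_ge0 //; apply: (le_trans gd).
  by rewrite ler_wpM2l.
rewrite normrM ger0_norm // expr2 mulrCA; apply: ler_wpM2l => //.
apply: (le_trans (hC2 (_, _) _ _ (x_box _) (x_box _))); apply: ler_wpM2l => //.
by apply: cV_norm_le => // i; rewrite !mxE; exact: x_inc.
Qed.

(** A sequence y that stays within 2 e of x obeys the contraction of [drift_contraction] up to an
    error O(g e), so the oscillation of y is eventually O(e). The bounds on e keep y in the box of
    radius rho / 2. *)
Let osc_limsup : exists2 K : R, 0 <= K & forall e : R, 0 < e -> e <= rho / 4 -> e <= 1/4 ->
  \forall n \near \oo, osc (x n) <= K * e.
Proof.
have [C C0 hz] := z_rec.
have [Cp Cp0 [hCp _]] := blip_unif (fun ij : 'I_N * 'I_N =>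
  blip_psi chain alpha_ge0 rho_gt0 ij.1 ij.2).
have [L L0 [_ hL]] := blip_unif (blip_pv chain alpha_ge0 half0).
have [gam gam0 hgam] := drift_contraction chain alpha_ge0 half0.
have [m0 m00 hm0] := mu_lower_bound chain.
(* Per coordinate: L 2 e for evaluating the stationary law at x instead of y, 2 e for x - y and e
   for C g^2 / g. Dividing by mu costs 1 / m0, and two coordinates are compared. *)
pose E := 2 * ((L * 2 + 3) / m0).
have E0 : 0 <= E by rewrite mulr_ge0 // divr_ge0 ?(ltW m00) // addr_ge0 // mulr_ge0.
exists (E + 1 + 2 * (2 / m0)).
  by rewrite !addr_ge0 // mulr_ge0 // divr_ge0 // ltW.
move=> e e0 e_rho e_4.
have /choice[m hm] : forall j, exists m, forall n, (m <= n)%N -> `|M j n - M j m| <= e.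
  by move=> j; exact: M_cauchy.
(* Adding back the martingale at a late time [m j] leaves the increments of z unchanged and makes y
   close to x. *)
pose y n : 'cV[R]_N := \col_j (z j n + M j (m j)).
pose m1 := \max_j m j.
have mm1 j : (m j <= m1)%N by rewrite /m1 (bigD1 j) //= leq_maxl.
have gsm (c : R) : 0 < c -> \forall n \near \oo, g n.+1 <= c.
  move=> c0; have [n1 _ h] := step_size_small a_gt c0.
  by exists n1 => // n /= n1n; apply: h; rewrite /= (leq_trans n1n).
have yx : \forall n \near \oo, forall j, `|y n j 0 - x n j 0| <= 2 * e.
  have c0 : 0 < e / (Cp + 1) by rewrite divr_gt0 // ltr_wpDl.
  near=> n => j; rewrite mxE /z.
  have -> : x n j 0 + g n.+1 * psi (x n) (X n) j - M j n + M j (m j) - x n j 0 =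
    g n.+1 * psi (x n) (X n) j - (M j n - M j (m j)) by ring.
  apply: (le_trans (ler_normB _ _)); rewrite mulr2n mulrDl mul1r; apply: lerD.
    rewrite normrM ger0_norm //; apply: (@le_trans _ _ (e / (Cp + 1) * (Cp + 1))).
      apply: ler_pM => //; first by near: n; exact: gsm.
      by apply: (le_trans (hCp (_, _) _ (x_box _))); rewrite lerDl.
    by rewrite divfK // gt_eqF // ltr_wpDl.
  by apply: hm; apply: leq_trans (mm1 j) _; near: n; exists m1.
have ybox : \forall n \near \oo, box (rho / 2) (y n).
  apply: filterS yx => n h i; have := h i; rewrite ler_norml => /andP[h1 h2].
  have /andP[h3 h4] := x_box n i; have := x_le1 n i => h5.
  by apply/andP; split; lra.
have yrec : \forall n \near \oo, osc (y n.+1) <= (1 - 1 * g n.+1) * osc (y n) + g n.+1 * (E * e).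
  have c0 : 0 < e / (C + 1) by rewrite divr_gt0 // ltr_wpDl.
  near=> n.
  have yn : box (rho / 2) (y n) by near: n.
  have yxn : forall j, `|y n j 0 - x n j 0| <= 2 * e by near: n.
  have gg : 0 <= g n.+1 <= gam by rewrite g0 /=; near: n; exact: gsm.
  have g1 : g n.+1 <= 1 by exact: step_size_le1.
  have ge : C * g n.+1 <= e.
    apply: (@le_trans _ _ ((C + 1) * (e / (C + 1)))).
      by apply: ler_pM => //; [rewrite lerDl|near: n; exact: gsm].
    by rewrite mulrC divfK // gt_eqF // ltr_wpDl.
  have step j : `|y n.+1 j 0 - (y n j 0 + g n.+1 * (pv (y n) j - y n j 0))| <=
      g n.+1 * ((L * 2 + 3) * e).
    have -> : y n.+1 j 0 - (y n j 0 + g n.+1 * (pv (y n) j - y n j 0)) =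
      (z j n.+1 - (z j n + g n.+1 * (pv (x n) j - x n j 0))) +
      g n.+1 * ((pv (x n) j - pv (y n) j) + (y n j 0 - x n j 0)).
      by rewrite !mxE; ring.
    apply: (le_trans (ler_normD _ _)).
    have -> : g n.+1 * ((L * 2 + 3) * e) = g n.+1 * e + g n.+1 * (L * (2 * e) + 2 * e) by ring.
    apply: lerD.
      apply: (le_trans (hz _ _)); rewrite expr2 mulrA mulrC; exact: ler_wpM2l.
    rewrite normrM ger0_norm //; apply: ler_wpM2l => //.
    apply: (le_trans (ler_normD _ _)); apply: lerD => //.
    apply: (le_trans (hL _ _ _ (box_half n) yn)); apply: ler_wpM2l => //.
    apply: cV_norm_le => [|i]; first by rewrite mulr_ge0 // ltW.
    by have := yxn i; rewrite distrC !mxE.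
  apply: osc_le.
    by apply: addr_ge0; [apply: mulr_ge0; [rewrite mul1r subr_ge0|exact: osc_ge0]|
      apply: mulr_ge0 => //; apply: mulr_ge0 => //; exact: ltW].
  move=> i j.
  have := hgam (y n) (g n.+1) (osc (y n)) yn gg (@osc_ge (y n)) i j.
  have bnd k : `|(y n.+1 k 0 - (y n k 0 + g n.+1 * (pv (y n) k - y n k 0))) / mu k 0| <=
     g n.+1 * ((L * 2 + 3) / m0 * e).
    have muk := (mu_int_simplex chain).1 k.
    rewrite normrM (gtr0_norm (_ : 0 < (mu k 0)^-1)) ?invr_gt0 //.
    rewrite [leRHS](_ : _ = g n.+1 * ((L * 2 + 3) * e) * m0^-1); last by ring.
    apply: ler_pM => //; first by rewrite invr_ge0 ltW.
    by rewrite lef_pV2 ?posrE.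
  have := bnd i; have := bnd j; rewrite !ler_norml => /andP[b1 _] /andP[_ b2].
  rewrite mulrBl in b2; rewrite mulrBl in b1; rewrite mul1r.
  have -> : g n.+1 * (E * e) = 2 * (g n.+1 * ((L * 2 + 3) / m0 * e)) by rewrite /E; ring.
  by lra.
have lim : \forall n \near \oo, osc (y n) <= E * e / 1 + e.
  apply: (@recursion_eventually_le R (fun n => osc (y n)) (fun n => g n.+1)) => //.
  - exact: step_size_dvg.
  - exact: nearW.
  - by apply: nearW => n; rewrite mul1r; exact: step_size_le1.
near=> n; apply: osc_le.
  by rewrite mulr_ge0 ?(ltW e0) // !addr_ge0 // mulr_ge0 // divr_ge0 // ltW.
move=> i j.
have h : osc (y n) <= E * e / 1 + e by near: n.
have yxn : forall j, `|y n j 0 - x n j 0| <= 2 * e by near: n.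
have bnd k : `|(y n k 0 - x n k 0) / mu k 0| <= 2 / m0 * e.
  have muk := (mu_int_simplex chain).1 k.
  rewrite normrM (gtr0_norm (_ : 0 < (mu k 0)^-1)) ?invr_gt0 // mulrAC.
  apply: ler_pM => //; first by rewrite invr_ge0 ltW.
  by rewrite lef_pV2 ?posrE.
have := osc_ge (y n) i j; have := bnd i; have := bnd j.
rewrite !ler_norml => /andP[_ b1] /andP[b2 _].
rewrite mulrBl in b1; rewrite mulrBl in b2; rewrite divr1 in h.
have -> : (E + 1 + 2 * (2 / m0)) * e = (E * e + e) + 2 * (2 / m0 * e) by ring.
by lra.
Unshelve. all: by end_near. Qed.

Lemma pathwise_convergence (e : R) : 0 < e ->
  \forall n \near \oo, forall i, `|x n i 0 - mu i 0| <= e.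
Proof.
move=> e0; have [K K0 hK] := osc_limsup.
pose e' := Num.min (Num.min (e / (K + 1)) (rho / 4)) (1 / 4).
have e'0 : 0 < e' by rewrite !lt_min !divr_gt0 // ltr_wpDl.
have h : e' <= e / (K + 1) by rewrite /e' !ge_min lexx.
have := hK e' e'0; rewrite {1 2}/e' !ge_min !lexx !orbT => /(_ isT isT).
apply: filterS => n hn i; apply: (le_trans (osc_dist_mu i (x_simplex n).2)).
apply: (le_trans hn); apply: (@le_trans _ _ ((K + 1) * (e / (K + 1)))).
  by apply: ler_pM => //; [exact: ltW|rewrite lerDl].
by rewrite mulrC divfK // gt_eqF // ltr_wpDl.
Qed.

End PathwiseConvergence.

(** * Almost sure convergence of the process and exit probabilities *)

Section AlmostSure.
Context (R : realType) (N D : nat) (P : 'M[R]_N) (mu : 'cV[R]_N) (alpha a : R).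
Hypothesis chain : ergodic_reversible P mu.
Hypothesis alpha_ge0 : 0 <= alpha.
Context (x0 : 'cV[R]_N) (i0 : 'I_N).
Hypothesis x0_simplex : int_simplex x0.
Hypothesis a_gt : 2^-1 < a.
Hypothesis a_le1 : a <= 1.
Context (beta : nat -> R) (H : 'cV[R]_D -> 'I_N -> 'cV[R]_D) (theta0 : 'cV[R]_D).
Context (d : measure_display) (Omega : measurableType d) (Pr : probability Omega R).
Context (theta : nat -> Omega -> 'cV[R]_D) (x : nat -> Omega -> 'cV[R]_N).
Context (X : nat -> Omega -> 'I_N).
Hypothesis proc : sa_srrw P mu alpha beta (step_size a) H theta0 x0 i0 Pr theta x X.
Hypothesis x_compact : {ae Pr, forall w, exists2 C : set 'cV[R]_N,
  compact C /\ C `<=` @int_simplex R N & forall n, C (x n w)}.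

Local Notation g := (step_size a).
Local Notation xs := (xs a x0).
Local Notation Xs := (Xs i0).
Local Notation pker := (pker P mu alpha a x0 i0).
Local Notation path_of := (path_of X).

Lemma compact_simplex_box (C : set 'cV[R]_N) : compact C -> C `<=` @int_simplex R N ->
  exists q : nat, forall x, C x -> box q.+1%:R^-1 x.
Proof.
move=> cC CS.
have [C0|C0] := pselect (C !=set0); last first.
  by exists 0%N => y Cy; exfalso; apply: C0; exists y.
have /choice[q hq] : forall i, exists q : nat, forall y, C y -> q.+1%:R^-1 <= y i 0.
  move=> i; have cf : {within C, continuous (fun y : 'cV[R]_N => y i 0)}.
    apply: continuous_subspaceT => y.
    by apply: coord_continuous.
  have [y yC ymin] := compact_EVT_min C0 cC cf.
  rewrite inE in yC; have [y0 _] := CS _ yC.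
  exists (Num.truncn (y i 0)^-1) => z Cz.
  apply: (@le_trans _ _ (y i 0)); last by apply: ymin; rewrite inE.
  by rewrite invf_ple ?posrE //; apply/ltW; exact: truncnS_gt.
exists (\max_i q i) => y Cy i; have [y0 y1] := CS _ Cy; apply/andP; split.
  apply: le_trans (hq i y Cy); rewrite lef_pV2 ?posrE // ler_nat ltnS.
  by rewrite (bigD1 i) //= leq_maxl.
apply: (@le_trans _ _ 1); last by rewrite ler1n.
rewrite -y1 (bigD1 i) //= lerDl; apply: sumr_ge0 => j _; exact: ltW.
Qed.

Lemma ae_dist_mu : {ae Pr, forall w, forall e : R, 0 < e ->
  \forall n \near \oo, forall i, `|x n w i 0 - mu i 0| <= e}.
Proof.
pose rho (q : nat) : R := q.+1%:R^-1.
have rho0 q : 0 < rho q by rewrite invr_gt0.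
(* Truncation to box q makes the increments bounded on every path; on a trajectory that stays in box
   q it changes nothing. *)
pose xi q j (p : seq 'I_N) i := if `[< box (rho q) (xs p) >] then
  g (size p).+1 * dM P mu alpha (xs p) (Xs p) i j else 0.
have pp : forall p, pos_vec (xs p) by move=> p; exact: xs_pos.
have mart : {ae Pr, forall w, forall q (j : 'I_N) (e : nat), exists m, forall n, (m <= n)%N ->
     `|psum (xi q j) (path_of n w) - psum (xi q j) (path_of m w)| <= e.+1%:R^-1}.
  apply: ae_foralln => q; apply: filter_forall => j.
  have [C C0 [hC _]] := blip_unif (fun ij : 'I_N * 'I_N =>
    blip_dM chain alpha_ge0 (rho0 q) ij.1 ij.2 j).
  apply: (martingale_cauchy chain x0_simplex a_gt proc (xi := xi q j) (C := C ^+ 2)) => p; rewrite /xi.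
    case: asboolP => _; last by apply: big1 => i _; rewrite mulr0.
    under eq_bigr do rewrite mulrCA.
    by rewrite -mulr_sumr (dM_mean0 _ chain) // mulr0.
  have cg : 0 <= C ^+ 2 * g (size p).+1 ^+ 2 by rewrite mulr_ge0 ?sqr_ge0.
  case: asboolP => bp; last by rewrite big1 // => i _; rewrite expr0n mulr0.
  rewrite -[leRHS]mul1r -(pker_sum1 alpha chain i0 x0_simplex a_gt p) mulr_suml.
  apply: ler_sum => i _; apply: ler_wpM2l; first exact: (pker_ge0 _ chain).
  rewrite exprMn mulrC; apply: ler_wpM2r; first exact: sqr_ge0.
  rewrite -(real_normK (num_real (dM _ _ _ _ _ _ _))) ler_sqr ?nnegrE //.
  exact: (hC (_, _)).
have ap := ae_path proc.
apply: filterS3 x_compact mart ap => w [C [cC CS] Cx] mart [w0 wx].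
have [q hq] := compact_simplex_box cC CS.
have bx n : box (rho q) (x n w) by exact: hq.
have Xsw n : Xs (path_of n w) = X n w by case: n => [|n] //=; rewrite w0.
move=> e e0.
apply: (@pathwise_convergence R N P mu alpha a chain alpha_ge0 a_gt a_le1
   (fun n => x n w) (fun n => X n w) (rho q)) => //.
- by move=> n; rewrite wx; exact: xs_simplex.
- by move=> n; rewrite !wx /= size_path_of.
- move=> j e' e'0.
  have [m hm] := mart q j (Num.truncn e'^-1).
  have psumE n : psum (xi q j) (path_of n w) =
      \sum_(0 <= k < n) g k.+1 * dM P mu alpha (x k w) (X k w) (X k.+1 w) j.
    elim: n => [|n IHn]; first by rewrite big_geq.
    rewrite big_nat_recr //= IHn; congr (_ + _).
    rewrite /xi; case: asboolP => [_|]; last by rewrite -wx.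
    by rewrite size_path_of Xsw -wx.
  exists m => n mn; rewrite -!psumE; apply: (le_trans (hm _ mn)).
  by rewrite invf_ple ?posrE //; apply/ltW; exact: truncnS_gt.
Qed.

Lemma ae_cvg_mu : {ae Pr, forall w, x n w @[n --> \oo] --> mu}.
Proof.
apply: filterS ae_dist_mu => w h; apply/cvgrPdist_le => e e0.
apply: filterS (h e e0) => n hn; apply: cV_norm_le => [|i]; first exact: ltW.
by rewrite !mxE distrC.
Qed.

Definition in_ball (r : R) (y : 'cV[R]_N) : bool := [forall i, `|y i 0 - mu i 0| <= r].

(* [good r m p]: along [p] the iterates stay in the ball from time [m] on, and
   [p] has length at least [m]. *)
Fixpoint good (r : R) (m : nat) (p : seq 'I_N) : bool :=
  in_ball r (xs p) && (if p is _ :: p' then (size p == m) || good r m p' else m == 0%N).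

Lemma good_size r m p : good r m p -> (m <= size p)%N.
Proof.
elim: p => [|j p IHp] /=; first by case/andP => _ /eqP ->.
by case/andP => _ /orP[/eqP -> //|/IHp]; exact: leqW.
Qed.

Lemma good_path r m n w : (m <= n)%N ->
  (forall k, (m <= k)%N -> (k <= n)%N -> in_ball r (xs (path_of k w))) ->
  good r m (path_of n w).
Proof.
elim: n => [|n IHn] mn h.
  by have := h 0%N mn (leqnn _) => /= ->; rewrite leqn0 in mn.
have := h n.+1 mn (leqnn _) => /= ->; rewrite /= size_path_of.
have [//|nm] := eqVneq n.+1 m; rewrite /=.
apply: IHn => [|k mk kn]; first by rewrite -ltnS ltn_neqAle eq_sym nm.
by apply: h => //; exact: leqW.
Qed.

(** The events of some exit after time m decrease to a null set by almost sure convergence; the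
    bound is uniform in the horizon n. *)
Lemma good_probability (r e : R) : 0 < r -> 0 < e -> exists m0, forall m n,
  (m0 <= m)%N -> (m <= n)%N -> Ex pker n (fun p => (~~ good r m p)%:R) <= e.
Proof.
move=> r0 e0.
pose bad k := [set w | ~~ in_ball r (xs (path_of k w))].
have mbad k : measurable (bad k).
  exact: (measurable_path_event proc k (fun p => ~~ in_ball r (xs p))).
pose B m := \bigcup_k bad (m + k)%N.
have mB m : measurable (B m) by exact: bigcup_measurable.
have niB : nonincreasing_seq B.
  move=> m n mn; apply/subsetPset => w [k _ h]; exists (n - m + k)%N => //.
  by rewrite addnA subnKC.
have mIB : measurable (\bigcap_m B m) by exact: bigcap_measurable.
have null : Pr (\bigcap_m B m) = 0%E.
  apply/negligibleP => //.
  have nb : {ae Pr, forall w, ~ (\bigcap_m B m) w}.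
    apply: filterS2 ae_dist_mu (ae_path proc) => w hw [_ wx] hB.
    have [m _ hm] := hw r r0; have [k _] := hB m I; apply/negP; rewrite negbK.
    by apply/forallP => i; rewrite -wx; apply: hm; rewrite /= leq_addr.
  apply: negligibleS nb => w /= h; exact.
have cv := nonincreasing_cvg_mu (mu := Pr) (ltac:(rewrite (le_lt_trans (probability_le1 _ _)) ?ltry //) : (Pr (B 0%N) < +oo)%E) mB mIB niB.
have {}cv : (Pr \o B @ \oo --> 0)%E by rewrite -null; exact: cv.
have {}cv : \forall m \near \oo, (Pr (B m) <= e%:E)%E.
  have /fine_cvgP[fn /cvgrPdist_le /(_ e e0)] := cv.
  move=> h; apply: filterS2 fn h => m fn; rewrite /= sub0r normrN.
  by rewrite ger0_norm ?fine_ge0 // -lee_fin fineK.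
have [m0 _ hm0] := cv; exists m0 => m n m0m mn.
have : (Pr [set w | ~~ good r m (path_of n w)] <= Pr (B m))%E.
  apply: le_measure; rewrite ?inE //.
    exact: (measurable_path_event proc n (fun p => ~~ good r m p)).
  move=> w /= ng; apply: contrapT => nB; move/negP: ng; apply; apply: good_path => // k mk kn.
  apply: contrapT => /negP h; apply: nB; exists (k - m)%N => //.
  by rewrite /bad /= subnKC.
have := probability_path_event proc n (fun p => ~~ good r m p).
rewrite /= => -> h; rewrite -lee_fin; apply: (le_trans h); exact: hm0.
Qed.

End AlmostSure.

(** * Central limit theorem along paths *)

Section Linearization.
Context (R : realType) (N : nat) (P : 'M[R]_N) (mu : 'cV[R]_N).
Context (lambda : 'I_N -> R) (u v : 'I_N -> 'cV[R]_N) (alpha a : R).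
Hypothesis chain : ergodic_reversible P mu.
Hypothesis spec : spectral_decomposition P mu lambda u v.
Hypothesis alpha_ge0 : 0 <= alpha.
Context (x0 : 'cV[R]_N) (i0 : 'I_N).
Hypothesis x0_simplex : int_simplex x0.
Hypothesis a_gt : 2^-1 < a.
Hypothesis a_le1 : a <= 1.

Local Notation g := (step_size a).
Local Notation xs := (xs a x0).
Local Notation Xs := (Xs i0).
Local Notation pker := (pker P mu alpha a x0 i0).
Local Notation pv := (pv P mu alpha).
Local Notation psi := (psi P mu alpha).
Local Notation dM := (dM P mu alpha).

Definition rate i : R := 1 + alpha * (1 + lambda i).
Definition vproj i (y : 'I_N -> R) : R := \sum_j v i j 0 * y j.
Definition corr i (p : seq 'I_N) : R := vproj i (psi (xs p) (Xs p)).
(** The term g psi absorbs the telescoping part of the noise, so that one step of [zeta] adds a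
    martingale difference to a contraction. *)
Definition zeta i (p : seq 'I_N) : R :=
  vproj i (fun j => xs p j 0 - mu j 0) + g (size p).+1 * corr i p.
Definition noise i (p : seq 'I_N) (i' : 'I_N) : R := vproj i (dM (xs p) (Xs p) i').

Lemma zetaE i p : zeta i p = vproj i (fun j => xs p j 0 - mu j 0) + g (size p).+1 * corr i p.
Proof. by []. Qed.

Lemma noiseE i p i' : noise i p i' = vproj i (dM (xs p) (Xs p) i').
Proof. by []. Qed.

Definition energy (p : seq 'I_N) : R := \sum_(i < N | (i < N.-1)%N) zeta i p ^+ 2.

Let g0 n : 0 <= g n := step_size_ge0 a n.

Lemma subE (y z : 'cV[R]_N) j : (y - z) j 0 = y j 0 - z j 0.
Proof. by rewrite !mxE. Qed.

Lemma vproj_le i (y : 'I_N -> R) (b : R) : (forall j, `|y j| <= b) ->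
  `|vproj i y| <= (\sum_j `|v i j 0|) * b.
Proof.
move=> h; apply: (le_trans (ler_norm_sum _ _ _)); rewrite mulr_suml.
by apply: ler_sum => j _; rewrite normrM ler_wpM2l.
Qed.

Lemma last_index (i : 'I_N) : exists l : 'I_N, nat_of_ord l = N.-1.
Proof.
have h : (N.-1 < N)%N by rewrite ltn_predL (leq_ltn_trans (leq0n i)).
by exists (Ordinal h).
Qed.

Lemma mu_proj0 (i : 'I_N) : (i < N.-1)%N -> \sum_j mu j 0 * v i j 0 = 0.
Proof.
move=> iN; have [l hl] := last_index i.
have [_ ul _] := lambda_last spec hl.
have := biorthonormal spec l i; rewrite ul !mxE.
have -> : (l == i) = false by apply/eqP => h; move: iN; rewrite -h hl ltnn.
by move=> h; rewrite -[RHS]h; apply: eq_bigr => j _; rewrite mxE.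
Qed.

Lemma v_orthonormal i k : \sum_j mu j 0 * (v i j 0 * v k j 0) = (i == k)%:R.
Proof.
rewrite -(biorthonormal spec) mxE; apply: eq_bigr => j _.
rewrite mxE (left_right spec) mul_diag_mx !mxE; ring.
Qed.

Lemma P_eigen i j : \sum_l P j l * v i l 0 = lambda i * v i j 0.
Proof. by have /colP/(_ j) := right_eigen spec i; rewrite !mxE. Qed.

Lemma rate_ge1 i : 1 <= rate i.
Proof.
by rewrite /rate lerDl mulr_ge0 // -lerBlDl sub0r ltW // (lambda_gtN1 spec).
Qed.

Lemma noise_mean0 i p : \sum_j pker p j * noise i p j = 0.
Proof.
rewrite /noise /vproj; under eq_bigr do rewrite mulr_sumr.
rewrite exchange_big big1 //= => j _.
under eq_bigr do rewrite mulrCA.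
rewrite -mulr_sumr (dM_mean0 _ chain) ?mulr0 //.
exact: xs_pos.
Qed.

(* Completeness of the eigenbasis; the last eigenvector does not contribute
   since both vectors have total mass one. *)
Lemma eigen_expansion p j :
  xs p j 0 - mu j 0 = \sum_(i < N | (i < N.-1)%N) u i j 0 * vproj i (fun l => xs p l 0 - mu l 0).
Proof.
pose Um := \matrix_(i, l) u l i 0; pose Vm := \matrix_(i, l) v i l 0.
have VU : Vm *m Um = 1%:M.
  apply/matrixP => i l; rewrite !mxE eq_sym -(biorthonormal spec) mxE.
  by apply: eq_bigr => k _; rewrite !mxE mulrC.
have UV := mulmx1C VU.
set y := fun l => xs p l 0 - mu l 0.
have [l hl] := last_index j.
have yl : vproj l y = 0.
  have [_ _ vl] := lambda_last spec hl.
  rewrite /vproj vl; under eq_bigr do rewrite mxE mul1r.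
  by rewrite sumrB (xs_simplex x0_simplex a_gt p).2 (mu_int_simplex chain).2 subrr.
have -> : xs p j 0 - mu j 0 = \sum_i u i j 0 * vproj i y.
  transitivity (\sum_k (Um *m Vm) j k * y k).
    rewrite UV (bigD1 j) //= mxE eqxx mul1r big1 ?addr0 // => k kj.
    by rewrite mxE eq_sym (negbTE kj) mul0r.
  under eq_bigr do rewrite mxE mulr_suml.
  rewrite exchange_big /=; apply: eq_bigr => i _.
  by rewrite /vproj mulr_sumr; apply: eq_bigr => k _; rewrite !mxE mulrA.
rewrite (bigD1 l) //= yl mulr0 add0r; apply: eq_bigl => i.
have := ltn_ord i; have [->|il] := eqVneq i l; first by rewrite hl ltnn.
have : nat_of_ord i != N.-1 by apply: contraNneq il => h; apply/eqP/val_inj; rewrite /= h hl.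
by move=> h1 h2; rewrite ltn_neqAle h1 /= -ltnS prednK // (leq_ltn_trans (leq0n i)).
Qed.

Section Constants.
Variable rho : R.
Hypothesis rho_gt0 : 0 < rho.
(** This keeps the ball of radius rho around mu inside the box. *)
Hypothesis rho_le : forall i, 2 * rho <= mu i 0.

Lemma ball_box (y : 'cV[R]_N) : in_ball mu rho y -> box rho y.
Proof.
move=> /forallP h i; have := h i; rewrite ler_norml => /andP[h1 h2].
have := rho_le i; have := mu_le1 chain i; have r0 := rho_gt0.
by move=> m1 m2; apply/andP; split; lra.
Qed.

Lemma mu_box : box rho mu.
Proof.
by apply: ball_box; apply/forallP => i; rewrite subrr normr0 ltW.
Qed.

Lemma xs_inc p j i : `|xs (j :: p) i 0 - xs p i 0| <= g (size p).+1.
Proof.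
rewrite xs_cons.
have -> : (1 - g (size p).+1) * xs p i 0 + g (size p).+1 * (i == j)%:R - xs p i 0 =
   g (size p).+1 * ((i == j)%:R - xs p i 0) by ring.
rewrite normrM ger0_norm // -[leRHS]mulr1 ler_wpM2l // ler_norml.
have := xs_le1 x0_simplex a_gt p i; have := xs_pos x0_simplex a_gt p i.
by case: eqP => _ /=; lra.
Qed.

Lemma ball_next_box p j : in_ball mu (rho / 2) (xs p) -> g (size p).+1 <= rho / 2 ->
  box rho (xs (j :: p)).
Proof.
move=> /forallP h gr; apply: ball_box; apply/forallP => i.
have := h i; have := xs_inc p j i; rewrite !ler_norml.
by move=> /andP[h1 h2] /andP[h3 h4]; apply/andP; split; lra.
Qed.

Lemma half_ball_box p : in_ball mu (rho / 2) (xs p) -> box rho (xs p).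
Proof.
move=> /forallP h; apply: ball_box; apply/forallP => i; apply: (le_trans (h i)).
by have r0 := rho_gt0; lra.
Qed.

Lemma vsum_le i : \sum_j `|v i j 0| <= \sum_i \sum_j `|v i j 0|.
Proof.
rewrite [leRHS](bigD1 i) //= lerDl; apply: sumr_ge0 => k _.
by apply: sumr_ge0.
Qed.

Lemma noise_bound : exists2 C : R, 0 <= C & forall i p i',
  box rho (xs p) -> `|noise i p i'| <= C.
Proof.
have [C C0 [hC _]] := blip_unif (fun ij : 'I_N * 'I_N * 'I_N =>
  blip_dM chain alpha_ge0 rho_gt0 ij.1.1 ij.1.2 ij.2).
exists ((\sum_i \sum_j `|v i j 0|) * C).
  by rewrite mulr_ge0 //; apply: sumr_ge0 => i _; apply: sumr_ge0.
move=> i p i' bp; apply: (le_trans (vproj_le _ _ (b := C))).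
  by move=> j; exact: (hC (_, _, _)).
by rewrite ler_wpM2r // vsum_le.
Qed.

Lemma corr_bound : exists2 C : R, 0 <= C & forall i p,
  box rho (xs p) -> `|corr i p| <= C.
Proof.
have [C C0 [hC _]] := blip_unif (fun ij : 'I_N * 'I_N =>
  blip_psi chain alpha_ge0 rho_gt0 ij.1 ij.2).
exists ((\sum_i \sum_j `|v i j 0|) * C).
  by rewrite mulr_ge0 //; apply: sumr_ge0 => i _; apply: sumr_ge0.
move=> i p bp; apply: (le_trans (vproj_le _ _ (b := C))).
  by move=> j; exact: (hC (_, _)).
by rewrite ler_wpM2r // vsum_le.
Qed.

Lemma taylor_bound : exists2 C : R, 0 <= C & forall (i : 'I_N), (i < N.-1)%N -> forall p,
  box rho (xs p) ->
  `|vproj i (pv (xs p)) + (rate i - 1) * vproj i (fun j => xs p j 0 - mu j 0)|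
    <= C * `|xs p - mu| ^+ 2.
Proof.
have /choice[C hC] : forall i : 'I_N, exists C : R, 0 <= C /\ ((i < N.-1)%N -> forall p, box rho (xs p) ->
    `|vproj i (pv (xs p)) + (rate i - 1) * vproj i (fun j => xs p j 0 - mu j 0)|
    <= C * `|xs p - mu| ^+ 2).
  move=> i; case: (boolP (i < N.-1)%N) => iN; last by exists 0.
  have [C C0 h] := pv_taylor chain alpha_ge0 rho_gt0 mu_box (right_eigen spec i) (mu_proj0 iN).
  exists C; split => // _ p bp; have := h _ bp.
  by rewrite (_ : rate i - 1 = alpha * (1 + lambda i)) //; rewrite /rate; ring.
exists (\sum_i C i); first by apply: sumr_ge0 => j _; exact: (hC j).1.
move=> i iN p bp; apply: le_trans ((hC i).2 iN _ bp) _.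
rewrite ler_wpM2r ?sqr_ge0 // (bigD1 i) //= lerDl; apply: sumr_ge0 => j _; exact: (hC j).1.
Qed.

(** Three errors: the second order term of the drift, the factor rate g applied to the corrector,
    which is O(g^2), and the change of step size and of x inside the corrector, also O(g^2). *)
Lemma zeta_step : exists2 C : R, 0 <= C & forall i : 'I_N, (i < N.-1)%N -> forall p i',
  in_ball mu (rho / 2) (xs p) -> g (size p).+1 <= rho / 2 ->
  `|zeta i (i' :: p) - ((1 - rate i * g (size p).+1) * zeta i p + g (size p).+1 * noise i p i')|
    <= C * (g (size p).+1 * (g (size p).+1 + `|xs p - mu| ^+ 2)).
Proof.
have [Ct Ct0 hCt] := taylor_bound; have [Cc Cc0 hCc] := corr_bound.
have [Cp Cp0 [hC1 hC2]] := blip_unif (fun ij : 'I_N * 'I_N =>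
  blip_psi chain alpha_ge0 rho_gt0 ij.1 ij.2).
pose V := \sum_i \sum_j `|v i j 0|.
have V0 : 0 <= V by apply: sumr_ge0 => i _; apply: sumr_ge0.
pose Rt := \sum_i `|rate i|.
have Rt0 : 0 <= Rt by apply: sumr_ge0.
exists (Ct + (Rt * Cc + V * (Cp + Cp))).
  by rewrite !addr_ge0 ?mulr_ge0 ?addr_ge0.
move=> i iN p i' bp gr; set g' := g (size p).+1.
have bx := half_ball_box bp; have bx' := ball_next_box i' bp gr.
set y := vproj i (fun j => xs p j 0 - mu j 0).
set x2 := `|_ - mu| ^+ 2; have x20 : 0 <= x2 by exact: sqr_ge0.
(* The defect of telescoping: both terms are at the new state i', but at consecutive values of the
   step and of x. *)
pose E j := g (size p).+2 * psi (xs (i' :: p)) i' j - g' * psi (xs p) i' j.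
have yE : vproj i (fun j => xs p j 0) = y.
  rewrite /y /vproj; under [RHS]eq_bigr do rewrite mulrBr.
  rewrite sumrB (_ : \sum_j v i j 0 * mu j 0 = 0) ?subr0 //.
  by rewrite -[RHS](mu_proj0 iN); apply: eq_bigr => j _; rewrite mulrC.
have -> : zeta i (i' :: p) - ((1 - rate i * g') * zeta i p + g' * noise i p i') =
    g' * (vproj i (pv (xs p)) + (rate i - 1) * y) + (rate i * g' ^+ 2 * corr i p + vproj i E).
  have -> : zeta i (i' :: p) = y + g' * (vproj i (pv (xs p)) - y + noise i p i' + corr i p) + vproj i E.
    rewrite -{2}yE /zeta /y /corr /noise /vproj /E /= -!sumrB -!big_split /= !mulr_sumr -!big_split /=.
    apply: eq_bigr => j _.
    rewrite !mxE eqxx andbT; have := noise_decomposition P mu alpha (xs p) (Xs p) i' j.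
    rewrite [j == _]eq_sym; set D := (_ == _)%:R => hD.
    have -> : D = pv (xs p) j + (dM (xs p) (Xs p) i' j + psi (xs p) (Xs p) j - psi (xs p) i' j).
      by rewrite -hD; ring.
    by rewrite /g'; ring.
  by rewrite /zeta -/y -/g'; ring.
have hE j : `|E j| <= (Cp + Cp) * g' ^+ 2.
  have -> : E j = - (g' - g (size p).+2) * psi (xs (i' :: p)) i' j +
      g' * (psi (xs (i' :: p)) i' j - psi (xs p) i' j) by rewrite /E; ring.
  have gd := step_size_diff a_gt a_le1 (size p).+1.
  have gm := @step_size_nonincr _ _ a_gt (size p).+1 (size p).+2 (leqnSn _).
  apply: (le_trans (ler_normD _ _)); rewrite [leRHS]mulrDl; apply: lerD.
    rewrite normrM normrN mulrC expr2; apply: ler_pM => //; first exact: (hC1 (_, _)).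
    by rewrite ger0_norm ?subr_ge0 //; apply: (le_trans gd); rewrite ler_wpM2l // g0.
  rewrite normrM (ger0_norm (g0 _)) expr2 mulrCA; apply: ler_wpM2l; first exact: g0.
  apply: (le_trans (hC2 (_, _) _ _ bx' bx)); apply: ler_wpM2l => //.
  by apply: cV_norm_le => [|k]; [exact: g0|rewrite subE; exact: xs_inc].
have gg : 0 <= g' := g0 _.
apply: (le_trans (ler_normD _ _)); rewrite [leRHS]mulrDl; apply: lerD.
  rewrite normrM ger0_norm // mulrCA; apply: ler_wpM2l => //.
  by apply: (le_trans (hCt i iN p bx)); rewrite ler_wpM2l // lerDr.
apply: (@le_trans _ _ ((Rt * Cc + V * (Cp + Cp)) * g' ^+ 2)); last first.
  rewrite ler_wpM2l ?addr_ge0 ?mulr_ge0 ?addr_ge0 // expr2 ler_wpM2l //.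
  by rewrite lerDl.
apply: (le_trans (ler_normD _ _)); rewrite [leRHS]mulrDl; apply: lerD.
  rewrite normrM normrM (ger0_norm (sqr_ge0 _)) mulrAC ler_wpM2r ?sqr_ge0 //.
  apply: ler_pM => //; last exact: hCc.
  by rewrite /Rt (bigD1 i) //= lerDl; apply: sumr_ge0.
apply: (le_trans (vproj_le _ hE)); rewrite -mulrA ler_wpM2r ?vsum_le //.
by rewrite mulr_ge0 ?addr_ge0 ?sqr_ge0.
Qed.

(** By [eigen_expansion] the distance is controlled by the projections, each of which is [zeta]
    minus a corrector of size O(g). *)
Lemma dist_energy : exists2 C : R, 0 <= C & forall p, box rho (xs p) ->
  `|xs p - mu| ^+ 2 <= C * (energy p + g (size p).+1 ^+ 2).
Proof.
have [Cc Cc0 hCc] := corr_bound.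
pose U := \sum_i \sum_j `|u i j 0|.
have U0 : 0 <= U by apply: sumr_ge0 => i _; apply: sumr_ge0.
exists (U ^+ 2 * (2 + 2 * Cc ^+ 2)).
  have := sqr_ge0 U; have := sqr_ge0 Cc => h1 h2.
  by rewrite mulr_ge0 // addr_ge0 // mulr_ge0.
move=> p bp; set g' := g (size p).+1; have gg : 0 <= g' := g0 _.
have e0 : 0 <= energy p by apply: sumr_ge0 => i _; exact: sqr_ge0.
pose b := Num.sqrt (2 * energy p + 2 * Cc ^+ 2 * g' ^+ 2).
have bb : 0 <= 2 * energy p + 2 * Cc ^+ 2 * g' ^+ 2.
  by have := sqr_ge0 g'; have := sqr_ge0 Cc => h1 h2; rewrite addr_ge0 // !mulr_ge0.
have b0 : 0 <= b by exact: sqrtr_ge0.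
have y_le (i : 'I_N) : (i < N.-1)%N -> `|vproj i (fun l => xs p l 0 - mu l 0)| <= b.
  move=> iN; rewrite -ler_sqr ?nnegrE // real_normK ?num_real // sqr_sqrtr //.
  have -> : vproj i (fun l => xs p l 0 - mu l 0) = zeta i p - g' * corr i p.
    by rewrite /zeta addrK.
  have h1 : zeta i p ^+ 2 <= energy p.
    rewrite /energy (bigD1 i) //= lerDl; apply: sumr_ge0 => k _; exact: sqr_ge0.
  have h2 : (g' * corr i p) ^+ 2 <= Cc ^+ 2 * g' ^+ 2.
    rewrite exprMn mulrC ler_wpM2r ?sqr_ge0 // -(real_normK (num_real (corr i p))).
    by rewrite ler_sqr ?nnegrE // hCc.
  have h3 := sqr_ge0 (zeta i p + g' * corr i p).
  have -> : (zeta i p - g' * corr i p) ^+ 2 =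
     2 * zeta i p ^+ 2 + 2 * (g' * corr i p) ^+ 2 - (zeta i p + g' * corr i p) ^+ 2 by ring.
  by lra.
have : `|xs p - mu| <= U * b.
  apply: cV_norm_le => [|j]; first exact: mulr_ge0.
  rewrite !mxE eigen_expansion; apply: (le_trans (ler_norm_sum _ _ _)).
  rewrite /U mulr_suml [leRHS](bigID (fun i : 'I_N => (i < N.-1)%N)) /=.
  rewrite -[leLHS]addr0; apply: lerD; last first.
    by apply: sumr_ge0 => i _; rewrite mulr_ge0 //; apply: sumr_ge0.
  apply: ler_sum => i iN; rewrite normrM; apply: ler_pM => //; last exact: y_le.
  rewrite (bigD1 j) //= lerDl; exact: sumr_ge0.
move=> h; have : `|xs p - mu| ^+ 2 <= (U * b) ^+ 2 by rewrite ler_sqr ?nnegrE ?mulr_ge0.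
move=> h2; apply: (le_trans h2); rewrite exprMn sqr_sqrtr // -[leRHS]mulrA ler_wpM2l ?sqr_ge0 //.
have := mulr_ge0 e0 (sqr_ge0 Cc); have := sqr_ge0 g'; lra.
Qed.

End Constants.
End Linearization.

(** * Moment bounds, quadratic variation and characteristic functions *)

Section Moments.
Context (R : realType) (N : nat) (P : 'M[R]_N) (mu : 'cV[R]_N).
Context (lambda : 'I_N -> R) (u v : 'I_N -> 'cV[R]_N) (alpha a : R).
Hypothesis chain : ergodic_reversible P mu.
Hypothesis spec : spectral_decomposition P mu lambda u v.
Hypothesis alpha_ge0 : 0 <= alpha.
Context (x0 : 'cV[R]_N) (i0 : 'I_N).
Hypothesis x0_simplex : int_simplex x0.
Hypothesis a_gt : 2^-1 < a.
Hypothesis a_le1 : a <= 1.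

Local Notation g := (step_size a).
Local Notation xs := (xs a x0).
Local Notation Xs := (Xs i0).
Local Notation pker := (pker P mu alpha a x0 i0).
Local Notation rate := (rate lambda alpha).
Local Notation corr := (corr P mu v alpha a x0 i0).
Local Notation zeta := (zeta P mu v alpha a x0 i0).
Local Notation noise := (noise P mu v alpha a x0 i0).
Local Notation energy := (energy P mu v alpha a x0 i0).
Local Notation dM := (dM P mu alpha).

Context (r C : R) (m : nat).
Local Notation G := (good mu a x0 r m).
Hypothesis C_ge1 : 1 <= C.
Hypothesis r_ge0 : 0 <= r.
Hypothesis r_le1 : r <= 1.
(** Chosen for [energy_step]: N times the feedback 8 C^3 r^2 then costs at most 1/4 of the
    contraction rate. *)
Hypothesis r_small : 32 * N%:R * C ^+ 3 * r ^+ 2 <= 1.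
Hypothesis m_large : forall n, (m <= n)%N -> 4 * g n.+1 <= 1.
Hypothesis m_rate : forall n (i : 'I_N), (m <= n)%N -> rate i * g n.+1 <= 1.
Hypothesis Hstep : forall i : 'I_N, (i < N.-1)%N -> forall p i', G p ->
  `|zeta i (i' :: p) - ((1 - rate i * g (size p).+1) * zeta i p + g (size p).+1 * noise i p i')|
    <= C * (g (size p).+1 * (g (size p).+1 + `|xs p - mu| ^+ 2)).
Hypothesis Hnoise : forall i p i', G p -> `|noise i p i'| <= C.
Hypothesis Hcorr : forall i p, G p -> `|corr i p| <= C.
Hypothesis Hdist : forall p, G p -> `|xs p - mu| ^+ 2 <= C * (energy p + g (size p).+1 ^+ 2).
Hypothesis Hlip_noise : forall i p i', G p ->
  `|noise i p i' - vproj v i (dM mu (Xs p) i')| <= C * `|xs p - mu|.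
Hypothesis Hlip_ker : forall p i', G p -> `|pker p i' - P (Xs p) i'| <= C * `|xs p - mu|.

Let C_ge0 : 0 <= C. Proof. by rewrite (le_trans _ C_ge1). Qed.
Let g0 n : 0 <= g n := step_size_ge0 a n.
Let g_gt0 n : 0 < g n := step_size_gt0 a n.
Let k0 := pker_ge0 alpha chain i0 x0_simplex a_gt.
Let k1 := pker_sum1 alpha chain i0 x0_simplex a_gt.

Lemma good_cons p j : (m <= size p)%N -> G (j :: p) -> G p.
Proof.
move=> mp /= /andP[_ /orP[|//]].
by rewrite /= => /eqP h; move: mp; rewrite -h ltnn.
Qed.

Lemma good_dist p : G p -> `|xs p - mu| <= r.
Proof.
move=> Gp; have /forallP h : in_ball mu r (xs p) by case: p Gp => [|j p] /andP[].
by apply: cV_norm_le => // i; rewrite subE.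
Qed.

Lemma step_affine p (c d : R) (f : 'I_N -> R) :
  \sum_j pker p j * (c + d * f j) = c + d * \sum_j pker p j * f j.
Proof.
under eq_bigr do rewrite mulrDr mulrCA.
by rewrite big_split /= -mulr_suml k1 mul1r mulr_sumr.
Qed.

(** From time m on goodness is inherited by shorter paths, so the indicator can be taken one step
    back when only an upper bound is needed. *)
Lemma Ex_good_step (F Phi : seq 'I_N -> R) n : (m <= n)%N -> (forall p, 0 <= F p) ->
  (forall p, size p = n -> G p -> step pker F p <= Phi p) ->
  Ex pker n.+1 (fun p => F p * (G p)%:R) <= Ex pker n (fun p => Phi p * (G p)%:R).
Proof.
move=> mn F0 h.
change (Ex pker n (step pker (fun p => F p * (G p)%:R)) <= Ex pker n (fun p => Phi p * (G p)%:R)).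
apply: (Ex_le k0) => p sp; rewrite /step.
have mp : (m <= size p)%N by rewrite sp.
case: (boolP (G p)) => Gp; last first.
  rewrite mulr0 big1 // => j _; case: (boolP (G (j :: p))) => [|_].
    by move/(good_cons mp); rewrite (negbTE Gp).
  by rewrite !mulr0.
rewrite mulr1; apply: le_trans (h p sp Gp); apply: ler_sum => j _.
by apply: ler_wpM2l; [exact: k0|rewrite ler_piMr //; case: (G _)].
Qed.

Let x2 p := `|xs p - mu| ^+ 2.

Lemma energy_ge0 p : 0 <= energy p.
Proof. by apply: sumr_ge0 => i _; exact: sqr_ge0. Qed.

Lemma rate_contract i n : (m <= n)%N -> `|1 - rate i * g n.+1| <= 1 - g n.+1.
Proof.
move=> mn; rewrite ger0_norm ?subr_ge0 ?m_rate // lerD2l lerN2.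
by rewrite ler_peMl // (rate_ge1 spec).
Qed.

(** Young's inequality 2 B e <= g' (B^2 / 4 + 4 eb^2), where g' eb bounds |e|, leaves the rate 3/2,
    as (1 - g')^2 (1 + g' / 4) <= 1 - 3/2 g' for 4 g' <= 1. The constant 13 collects 9 from the
    square of 3 C g' and 2 + 2 from 4 g' eb^2. *)
Lemma zeta_sqr_step (i : 'I_N) p : (i < N.-1)%N -> (m <= size p)%N -> G p ->
  step pker (fun p => zeta i p ^+ 2) p <=
    (1 - 3 / 2 * g (size p).+1) * zeta i p ^+ 2 +
    8 * C ^+ 3 * r ^+ 2 * g (size p).+1 * energy p + 13 * C ^+ 3 * g (size p).+1 ^+ 2.
Proof.
move=> iN mp Gp; set g' := g (size p).+1.
have g4 : 4 * g' <= 1 := m_large mp.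
have gg : 0 < g' := g_gt0 _.
pose B := (1 - rate i * g') * zeta i p.
pose eb := C * (g' + x2 p).
have x20 : 0 <= x2 p by exact: sqr_ge0.
have xr : x2 p <= r ^+ 2 by rewrite ler_sqr ?nnegrE // good_dist.
have r1 : r ^+ 2 <= 1 by rewrite exprn_ile1.
have eb0 : 0 <= eb by rewrite mulr_ge0 // addr_ge0 // ltW.
have eb2 : eb <= 2 * C by rewrite /eb mulrC ler_wpM2r //; lra.
have ebs : eb ^+ 2 <= 2 * C ^+ 2 * g' ^+ 2 + 2 * C ^+ 3 * r ^+ 2 * (energy p + g' ^+ 2).
  have h1 : x2 p ^+ 2 <= r ^+ 2 * (C * (energy p + g' ^+ 2)).
    by rewrite expr2; apply: ler_pM => //; exact: Hdist.
  rewrite /eb exprMn; have h2 := sqr_ge0 (g' - x2 p).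
  have h3 : (g' + x2 p) ^+ 2 <= 2 * g' ^+ 2 + 2 * (r ^+ 2 * (C * (energy p + g' ^+ 2))).
    have -> : (g' + x2 p) ^+ 2 = 2 * g' ^+ 2 + 2 * x2 p ^+ 2 - (g' - x2 p) ^+ 2 by ring.
    by lra.
  apply: (le_trans (ler_wpM2l (sqr_ge0 C) h3)).
  by rewrite le_eqVlt; apply/orP; left; apply/eqP; ring.
have B2 : B ^+ 2 <= (1 - g') ^+ 2 * zeta i p ^+ 2.
  rewrite /B exprMn ler_wpM2r ?sqr_ge0 // -(real_normK (num_real (1 - rate i * g'))).
  rewrite ler_sqr ?nnegrE // ?rate_contract //; lra.
have stepj j : zeta i (j :: p) ^+ 2 <=
    B ^+ 2 + 2 * B * g' * noise i p j + (g' * (B ^+ 2 / 4 + 4 * eb ^+ 2) + g' ^+ 2 * (9 * C ^+ 2)).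
  have := Hstep iN j Gp; rewrite -/g' -/B.
  set e := zeta i (j :: p) - _; rewrite -/(x2 p) => he.
  have {}he : `|e| <= g' * eb by rewrite /eb mulrCA.
  have -> : zeta i (j :: p) = B + (g' * noise i p j + e) by rewrite /e; ring.
  have -> : (B + (g' * noise i p j + e)) ^+ 2 = B ^+ 2 + 2 * B * g' * noise i p j +
     (2 * B * e + (g' * noise i p j + e) ^+ 2) by ring.
  rewrite lerD2l; apply: lerD.
    have h1 : 2 * B * e <= 2 * `|B| * (g' * eb).
      have h2 : `|B * e| <= `|B| * (g' * eb).
        by move: (B) => b; rewrite normrM ler_wpM2l.
      by have := le_trans (ler_norm _) h2; lra.
    apply: (le_trans h1).
    rewrite [leLHS](_ : _ = g' * (2 * `|B| * eb)); last by ring.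
    rewrite ler_wpM2l ?(ltW gg) //.
    have := sqr_ge0 (`|B| / 2 - 2 * eb).
    have -> : (`|B| / 2 - 2 * eb) ^+ 2 = `|B| ^+ 2 / 4 + 4 * eb ^+ 2 - 2 * `|B| * eb by field.
    by rewrite real_normK ?num_real //; lra.
  have h : `|g' * noise i p j + e| <= g' * (3 * C).
    apply: (le_trans (ler_normD _ _)).
    rewrite normrM (gtr0_norm gg) [leRHS](_ : _ = g' * C + g' * (2 * C)); last by ring.
    apply: lerD; first by rewrite ler_pM2l // Hnoise.
    by apply: (le_trans he); rewrite ler_pM2l.
  rewrite -(real_normK (num_real (_ + _))).
  rewrite [leRHS](_ : _ = (g' * (3 * C)) ^+ 2); last by ring.
  by rewrite ler_sqr ?nnegrE // !mulr_ge0 // ltW.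
rewrite /step; apply: (@le_trans _ _ (\sum_j pker p j * (B ^+ 2 + 2 * B * g' * noise i p j +
   (g' * (B ^+ 2 / 4 + 4 * eb ^+ 2) + g' ^+ 2 * (9 * C ^+ 2))))).
  by apply: ler_sum => j _; apply: ler_wpM2l; [exact: k0|exact: stepj].
under eq_bigr do rewrite addrAC.
rewrite step_affine (noise_mean0 v alpha chain i0 x0_simplex a_gt) mulr0 addr0.
have z0 := sqr_ge0 (zeta i p).
have B3 : B ^+ 2 * (1 + g' / 4) <= (1 - 3 / 2 * g') * zeta i p ^+ 2.
  apply: (@le_trans _ _ ((1 - g') ^+ 2 * (1 + g' / 4) * zeta i p ^+ 2)).
    by rewrite [leRHS]mulrAC ler_wpM2r //; lra.
  by rewrite ler_wpM2r //; nra.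
have C2 : C ^+ 2 <= C ^+ 3 by rewrite [leRHS]exprS ler_peMl // sqr_ge0.
have C3 : 0 <= C ^+ 3 by rewrite exprn_ge0.
have C20 := sqr_ge0 C.
have gb := ler_wpM2l (ltW gg) ebs.
have g2 : 0 <= g' ^+ 2 := sqr_ge0 _.
have g3 : 4 * (g' * g' ^+ 2) <= g' ^+ 2 by nra.
have t1 : C ^+ 2 * (4 * (g' * g' ^+ 2)) <= C ^+ 3 * g' ^+ 2.
  by apply: ler_pM => //; rewrite !mulr_ge0 // ltW.
have t2 : (C ^+ 3 * r ^+ 2) * (4 * (g' * g' ^+ 2)) <= C ^+ 3 * g' ^+ 2.
  apply: ler_pM => //; rewrite ?mulr_ge0 ?sqr_ge0 // ?(ltW gg) //.
  by rewrite ler_piMr.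
have t3 : C ^+ 2 * g' ^+ 2 <= C ^+ 3 * g' ^+ 2 by rewrite ler_wpM2r.
have -> : 8 * C ^+ 3 * r ^+ 2 * g' * energy p = 4 * (g' * (2 * C ^+ 3 * r ^+ 2 * energy p)) by ring.
lra.
Qed.

Lemma energy_step p : (m <= size p)%N -> G p -> step pker energy p <=
  (1 - 5 / 4 * g (size p).+1) * energy p + 13 * N%:R * C ^+ 3 * g (size p).+1 ^+ 2.
Proof.
move=> mp Gp; set g' := g (size p).+1.
have -> : step pker energy p = \sum_(i < N | (i < N.-1)%N) step pker (fun p => zeta i p ^+ 2) p.
  rewrite /step exchange_big /=; apply: eq_bigr => j _.
  by rewrite /energy mulr_sumr.
have c3 : 0 <= C ^+ 3 by rewrite exprn_ge0.
have e0 := energy_ge0 p; have gg := g0 (size p).+1.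
apply: (@le_trans _ _ (\sum_(i < N | (i < N.-1)%N) (1 - 3 / 2 * g') * zeta i p ^+ 2 +
    \sum_(i < N) (8 * C ^+ 3 * r ^+ 2 * g' * energy p + 13 * C ^+ 3 * g' ^+ 2))).
  rewrite [X in _ <= _ + X](bigID (fun i : 'I_N => (i < N.-1)%N)) /= addrA -[leLHS]addr0.
  apply: lerD; last first.
    by apply: sumr_ge0 => i _; rewrite addr_ge0 ?mulr_ge0 ?sqr_ge0.
  by rewrite -big_split /=; apply: ler_sum => i iN; rewrite addrA zeta_sqr_step.
rewrite -mulr_sumr -/(energy p) sumr_const card_ord -[X in _ + X <= _]mulr_natl mulrDr.
have h : N%:R * (8 * C ^+ 3 * r ^+ 2 * g' * energy p) <= 1 / 4 * g' * energy p.
  have -> : N%:R * (8 * C ^+ 3 * r ^+ 2 * g' * energy p) =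
     (32 * N%:R * C ^+ 3 * r ^+ 2) * (1 / 4 * (g' * energy p)) by field.
  rewrite [leRHS](_ : _ = 1 * (1 / 4 * (g' * energy p))); last by ring.
  by rewrite ler_wpM2r // !mulr_ge0.
have -> : N%:R * (13 * C ^+ 3 * g' ^+ 2) = 13 * N%:R * C ^+ 3 * g' ^+ 2 by ring.
lra.
Qed.

Lemma step_ratio n : (1 - g n.+1) * g n <= g n.+1.
Proof. have := step_size_diff a_gt a_le1 n; lra. Qed.

Lemma step_double n : (m <= n)%N -> g n <= 2 * g n.+1.
Proof.
move=> mn; have := step_ratio n; have := m_large mn; have := g0 n; have := g0 n.+1; nra.
Qed.

(** Dividing by the step size costs at most a factor 1 / (1 - g). The rate 5/4 exceeds 1, and the
    rate 1/4 remains since 1 - 5/4 g <= (1 - g / 4) (1 - g). *)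
Lemma energy_bound : exists2 B : R, 0 <= B & forall n, (m <= n)%N ->
  Ex pker n (fun p => energy p * (G p)%:R) <= B * g n.
Proof.
pose w n := Ex pker n (fun p => energy p * (G p)%:R) / g n.
pose D := 13 * N%:R * C ^+ 3.
have D0 : 0 <= D by rewrite !mulr_ge0 ?exprn_ge0.
have w0 n : 0 <= w n.
  rewrite divr_ge0 //; apply: (Ex_ge0 k0 k1) => p _.
  by rewrite mulr_ge0 ?energy_ge0.
exists (w m + 4 * D) => [|n mn]; first exact: addr_ge0 (w0 m) (mulr_ge0 (ler0n _ 4) D0).
rewrite -ler_pdivrMr //.
apply: (@recursion_le R w (fun n => g n.+1) (1 / 4) D (w m + 4 * D) m) => //.
- by move=> k mk; have := m_large mk; have := g0 k.+1; lra.
- move=> k mk; rewrite /w ler_pdivrMr //.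
  apply: (le_trans (Ex_good_step mk energy_ge0 (Phi := fun p =>
     (1 - 5 / 4 * g k.+1) * energy p + D * g k.+1 ^+ 2) _)).
    by move=> p sp Gp; rewrite -sp; apply: energy_step => //; rewrite sp.
  apply: (@le_trans _ _ ((1 - 5 / 4 * g k.+1) * Ex pker k (fun p => energy p * (G p)%:R) +
     D * g k.+1 ^+ 2)).
    rewrite -(ExZ k0) -[X in _ <= _ + X](Ex_cst k0 k1 k) -(ExD k0); apply: (Ex_le k0) => p _.
    move: (energy p) (D) D0 => E d d0.
    by case: (G p); rewrite ?mulr1 // !mulr0 add0r mulr_ge0 ?sqr_ge0.
  have e0 := w0 k; set W := Ex pker k _ in e0 *.
  rewrite [leRHS]mulrDl [X in _ <= X + _](_ : _ = (1 - 1 / 4 * g k.+1) * (g k.+1 / g k) * W); last by ring.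
  apply: lerD; last by rewrite le_eqVlt; apply/orP; left; apply/eqP; ring.
  have W0 : 0 <= W by apply: (Ex_ge0 k0 k1) => p _; rewrite mulr_ge0 ?energy_ge0.
  rewrite ler_wpM2r //.
  have h : 1 - g k.+1 <= g k.+1 / g k by rewrite ler_pdivlMr // step_ratio.
  have h4 := m_large mk; have gg := g0 k.+1.
  apply: (@le_trans _ _ ((1 - 1 / 4 * g k.+1) * (1 - g k.+1))); first by nra.
  by rewrite ler_wpM2l //; lra.
- rewrite lerDl; exact: (mulr_ge0 (ler0n _ 4) D0).
- have := w0 m; lra.
Qed.

Lemma dist_bound : exists2 B : R, 0 <= B & forall n, (m <= n)%N ->
  Ex pker n (fun p => x2 p * (G p)%:R) <= B * g n.
Proof.
have [B B0 hB] := energy_bound; exists (C * (B + 1)).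
  by rewrite mulr_ge0 // addr_ge0.
move=> n mn; apply: (@le_trans _ _ (C * (Ex pker n (fun p => energy p * (G p)%:R) + g n.+1 ^+ 2))).
  rewrite -[X in _ <= _ * (_ + X)](Ex_cst k0 k1 n) -(ExD k0) -(ExZ k0); apply: (Ex_le k0) => p sp.
  case: (boolP (G p)) => Gp; last by rewrite !mulr0 add0r mulr_ge0 ?sqr_ge0.
  by rewrite !mulr1 -sp; exact: Hdist.
rewrite -mulrA ler_wpM2l // mulrDl mul1r lerD ?hB //.
have h1 := step_size_nonincr a_gt (leqnSn n); have h2 := m_large mn; have h3 := g0 n.+1.
by rewrite (le_trans _ h1) // expr2 ler_piMr //; lra.
Qed.

Lemma dist1_small (e : R) : 0 < e -> \forall n \near \oo,
  Ex pker n (fun p => `|xs p - mu| * (G p)%:R) <= e.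
Proof.
move=> e0; have [B B0 hB] := dist_bound.
have e1 : 0 < e ^+ 2 / (B + 1) by rewrite divr_gt0 ?exprn_gt0 // ltr_wpDl.
have [n1 _ h1] := step_size_small a_gt e1.
exists (maxn n1 m) => // n /=; rewrite geq_max => /andP[n1n mn].
apply: (Ex_le_sqrt k0 k1) => //.
apply: (@le_trans _ _ (Ex pker n (fun p => x2 p * (G p)%:R))).
  by apply: (Ex_le k0) => p _; rewrite exprMn; case: (G p); rewrite ?expr1n ?expr0n ?mulr0.
apply: (le_trans (hB _ mn)); apply: (@le_trans _ _ ((B + 1) * (e ^+ 2 / (B + 1)))).
  by apply: ler_pM => //; [rewrite lerDl|exact: h1].
by rewrite mulrC divfK // gt_eqF // ltr_wpDl.
Qed.

(* The recursion of [zeta i] without its second order terms. *)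
Fixpoint mpart i (p : seq 'I_N) : R :=
  if p is j :: p' then (1 - rate i * g (size p)) * mpart i p' +
    g (size p) * ((G p')%:R * noise i p' j) else 0.

(** The difference contracts at rate 1 with forcing O(g^2). Dividing by the square root of the step
    costs rate 1/2 only, and the normalized forcing is g times a quantity of order g^{1/2}. *)
Lemma remainder_small (i : 'I_N) (e : R) : (i < N.-1)%N -> 0 < e -> \forall n \near \oo,
  Ex pker n (fun p => `|zeta i p - mpart i p| * (G p)%:R) <= e * Num.sqrt (g n).
Proof.
move=> iN e0; have [B B0 hB] := dist_bound.
pose U n := Ex pker n (fun p => `|zeta i p - mpart i p| * (G p)%:R).
pose s n := Num.sqrt (g n).
have s0 n : 0 < s n by rewrite sqrtr_gt0.
have ss n : s n ^+ 2 = g n by rewrite sqr_sqrtr.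
have U0 n : 0 <= U n by apply: (Ex_ge0 k0 k1) => p _; rewrite mulr_ge0.
have Urec n : (m <= n)%N -> U n.+1 <= (1 - g n.+1) * U n + C * (1 + 2 * B) * g n.+1 ^+ 2.
  move=> mn; have F0 p : 0 <= `|zeta i p - mpart i p| by [].
  apply: (le_trans (Ex_good_step mn F0 (Phi := fun p =>
    (1 - g n.+1) * `|zeta i p - mpart i p| + C * (g n.+1 * (g n.+1 + x2 p))) _)).
    move=> p sp Gp; rewrite /step.
    rewrite -[leRHS](step_cst k1 _ p) /step; apply: ler_sum => j _.
    apply: ler_wpM2l; first exact: k0.
    have := Hstep iN j Gp; have := @rate_contract i n mn; rewrite sp -/(x2 p).
    move=> h1 h2; rewrite [mpart _ _]/= sp Gp mul1r.
    rewrite (_ : _ - _ = (1 - rate i * g n.+1) * (zeta i p - mpart i p) +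
      (zeta i (j :: p) - ((1 - rate i * g n.+1) * zeta i p + g n.+1 * noise i p j))); last by ring.
    apply: (le_trans (ler_normD _ _)); apply: lerD => //.
    by rewrite normrM ler_wpM2r.
  apply: (@le_trans _ _ ((1 - g n.+1) * U n + C * (g n.+1 * (g n.+1 + Ex pker n (fun p => x2 p * (G p)%:R))))).
    rewrite /U -[X in _ * (X + _)](Ex_cst k0 k1 n) -(ExD k0) -!(ExZ k0) -(ExD k0).
    apply: (Ex_le k0) => p _; case: (G p); first by rewrite !mulr1.
    rewrite !mulr0 addr0 add0r !mulr_ge0 //.
  rewrite lerD2l -mulrA ler_wpM2l // expr2 mulrCA ler_wpM2l // mulrDl mul1r lerD2l.
  apply: (le_trans (hB _ mn)); rewrite mulrAC [leRHS]mulrC ler_wpM2l //.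
  exact: step_double.
have lim := @recursion_eventually_le R (fun n => U n / s n) (fun n => g n.+1) (1 / 2) (e / 4).
have {}lim : \forall n \near \oo, U n / s n <= e / 4 / (1 / 2) + e / 2.
  apply: lim; rewrite ?divr_gt0 //.
  - exact: step_size_dvg.
  - exact: nearW.
  - by apply: nearW => n; have := step_size_le1 a_gt n.+1; have := g0 n.+1; lra.
  - have e1 : 0 < (e / 4 / (C * (1 + 2 * B) + 1)) ^+ 2.
      by rewrite exprn_gt0 // !divr_gt0 // ltr_wpDl // mulr_ge0 // addr_ge0 // mulr_ge0.
    have [n1 _ h1] := step_size_small a_gt e1.
    exists (maxn n1 m) => // n /=; rewrite geq_max => /andP[n1n mn].
    have gs : s n.+1 <= e / 4 / (C * (1 + 2 * B) + 1).
      rewrite -ler_sqr ?nnegrE ?ss ?(ltW (s0 _)) //.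
        by apply: h1; rewrite /= (leq_trans n1n).
      by rewrite !divr_ge0 ?(ltW e0) // addr_ge0 // mulr_ge0 // addr_ge0 // mulr_ge0.
    have CB : 0 <= C * (1 + 2 * B) by rewrite mulr_ge0 // addr_ge0 // mulr_ge0.
    rewrite ler_pdivrMr //; apply: (le_trans (Urec _ mn)).
    rewrite [leRHS]mulrDl; apply: lerD.
      rewrite (_ : (1 - 1 / 2 * g n.+1) * (U n / s n) * s n.+1 =
        ((1 - 1 / 2 * g n.+1) * s n.+1 / s n) * U n); last by ring.
      rewrite ler_wpM2r // ler_pdivlMr //.
      have g4 := m_large mn; have gg := g0 n.+1.
      rewrite -ler_sqr ?nnegrE ?mulr_ge0 ?(ltW (s0 _)) //; try lra.
      rewrite !exprMn !ss; have h2 := step_ratio n.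
      apply: (@le_trans _ _ ((1 - g n.+1) * g n.+1)).
        rewrite expr2 -mulrA ler_wpM2l //; lra.
      rewrite ler_wpM2r //; nra.
    rewrite [leRHS](_ : _ = g n.+1 * (e / 4 * s n.+1)); last by ring.
    rewrite (_ : _ * g n.+1 ^+ 2 = g n.+1 * (C * (1 + 2 * B) * s n.+1 * s n.+1)); last first.
      by rewrite -(mulrA _ (s n.+1)) -expr2 ss; ring.
    rewrite ler_wpM2l // ler_wpM2r ?(ltW (s0 _)) //.
    apply: (@le_trans _ _ ((C * (1 + 2 * B) + 1) * (e / 4 / (C * (1 + 2 * B) + 1)))).
      by apply: ler_pM => //; rewrite ?(ltW (s0 _)) // lerDl.
    by rewrite mulrC divfK // gt_eqF // ltr_wpDl.
apply: filterS lim => n; rewrite ler_pdivrMr //.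
by rewrite (_ : e / 4 / (1 / 2) + e / 2 = e); last by field.
Qed.

(** At mu, Q acts on v_i as division by 1 - lambda_i, and K Q adds the factor lambda_i. *)
Lemma dM_mu_proj (i : 'I_N) i' j : (i < N.-1)%N ->
  vproj v i (dM mu i' j) = (v i j 0 - lambda i * v i i' 0) / (1 - lambda i).
Proof.
move=> iN; have l1 : lambda i != 1 by rewrite lt_eqF // (lambda_lt1 spec).
have hQ j := Q_mu_eigen alpha chain j (right_eigen spec i) (mu_proj0 spec iN) l1.
rewrite /vproj; under eq_bigr do rewrite dME mulrBr.
rewrite sumrB mulrBl; congr (_ - _).
  by rewrite -(hQ j); apply: eq_bigr => l _; rewrite mulrC.
transitivity (\sum_k P i' k * \sum_l Q P mu alpha mu k l * v i l 0).
  under [RHS]eq_bigr do rewrite mulr_sumr.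
  rewrite exchange_big /=; apply: eq_bigr => l _.
  rewrite -(KQ alpha chain i' l (mu_pos chain)) mulr_sumr; apply: eq_bigr => k _.
  by rewrite (kernel_mu alpha chain); ring.
under eq_bigr do rewrite hQ mulrA.
by rewrite -mulr_suml (P_eigen spec).
Qed.

(** Expanding the product and using stationarity gives (1 - lambda_i lambda_k) / ((1 - lambda_i) (1
    - lambda_k)) times the inner product of v_i and v_k in L^2(mu). For i = k this is (1 - lambda^2)
    / (1 - lambda)^2. *)
Lemma noise_covariance (i k : 'I_N) : (i < N.-1)%N -> (k < N.-1)%N ->
  \sum_i' mu i' 0 * \sum_j P i' j * (vproj v i (dM mu i' j) * vproj v k (dM mu i' j)) =
  (i == k)%:R * ((1 + lambda i) / (1 - lambda i)).
Proof.
move=> iN kN.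
have li : 1 - lambda i != 0 by rewrite subr_eq0 eq_sym lt_eqF // (lambda_lt1 spec).
have lk : 1 - lambda k != 0 by rewrite subr_eq0 eq_sym lt_eqF // (lambda_lt1 spec).
pose w := ((1 - lambda i) * (1 - lambda k))^-1.
have inner i' : \sum_j P i' j * (vproj v i (dM mu i' j) * vproj v k (dM mu i' j)) =
    w * (\sum_j P i' j * (v i j 0 * v k j 0) - lambda i * lambda k * (v i i' 0 * v k i' 0)).
  transitivity (w * (\sum_j P i' j * (v i j 0 * v k j 0) - lambda k * v k i' 0 * (\sum_j P i' j * v i j 0)
     - lambda i * v i i' 0 * (\sum_j P i' j * v k j 0) +
     lambda i * lambda k * (v i i' 0 * v k i' 0) * \sum_j P i' j)).
    rewrite !mulr_sumr -!sumrB -big_split /= mulr_sumr; apply: eq_bigr => j _.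
    by rewrite !dM_mu_proj // /w; field; rewrite li lk.
  by rewrite !(P_eigen spec) (trans_sum1 chain); ring.
transitivity (w * (\sum_j mu j 0 * (v i j 0 * v k j 0) * (1 - lambda i * lambda k))).
  under eq_bigr do rewrite inner mulrCA mulrBr.
  rewrite -mulr_sumr sumrB; congr (w * _).
  under eq_bigr do rewrite mulr_sumr.
  rewrite exchange_big -sumrB; apply: eq_bigr => j _.
  have -> : \sum_i' mu i' 0 * (P i' j * (v i j 0 * v k j 0)) = mu j 0 * (v i j 0 * v k j 0).
    by rewrite -(mu_stat chain j) mulr_suml; apply: eq_bigr => l _; rewrite mulrA.
  ring.
rewrite -mulr_suml (v_orthonormal spec) /w.
by have [->|_] := eqVneq i k; rewrite ?mul0r ?mulr0 //; field.
Qed.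

(* The factor by which [qv i k / g] is multiplied at each step. *)
Definition ratio (i k : 'I_N) n : R :=
  g n / g n.+1 * ((1 - rate i * g n.+1) * (1 - rate k * g n.+1)).

(** Contraction rate of the normalized covariation: both rates act, and growth of 1 / g takes away
    the indicator. *)
Definition slope (i k : 'I_N) : R := rate i + rate k - (a == 1)%:R.

Lemma slope_ge1 i k : 1 <= slope i k.
Proof.
have := rate_ge1 spec alpha_ge0 i; have := rate_ge1 spec alpha_ge0 k.
by rewrite /slope; case: (a == 1) => /=; lra.
Qed.

(** g n / g n.+1 = 1 + [step_delta] n * g n contributes the limit of [step_delta]; [T] bounds the
    second order products. *)
Lemma ratio_approx i k (eta : R) : 0 < eta ->
  \forall n \near \oo, `|ratio i k n - (1 - slope i k * g n.+1)| <= eta * g n.+1.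
Proof.
move=> eta0; have ri := rate_ge1 spec alpha_ge0 i; have rk := rate_ge1 spec alpha_ge0 k.
have e2 : 0 < eta / 2 by rewrite divr_gt0.
pose T := 1 + rate i + rate k + 2 * (rate i * rate k).
have rik : 1 <= rate i * rate k by rewrite -[leLHS]mulr1; apply: ler_pM.
have T0 : 0 < T by rewrite /T; lra.
have := step_delta_cvg a_gt a_le1 e2; have := step_size_small a_gt (divr_gt0 e2 T0).
apply: filterS2 => n hg hd.
have gg := g0 n.+1; have gg0 := g0 n; have g1 := step_size_le1 a_gt n.
have gm := step_size_nonincr a_gt (leqnSn n).
have d0 := step_delta_ge0 a_gt n; have d1 := step_delta_le1 a_gt a_le1 n.
have gE : g n = g n.+1 * (1 + step_delta a n * g n).
  by rewrite -(step_deltaE a n) mulrC divfK // gt_eqF.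
rewrite /ratio (step_deltaE a n); set d := step_delta a n in hd d0 d1 gE *.
set dl := (a == 1)%:R in hd *.
have -> : (1 + d * g n) * ((1 - rate i * g n.+1) * (1 - rate k * g n.+1)) - (1 - slope i k * g n.+1) =
    g n.+1 * ((d - dl) + (d ^+ 2 * g n - d * g n * (rate i + rate k) +
      (1 + d * g n) * (rate i * rate k) * g n.+1)).
  have -> : (1 + d * g n) * ((1 - rate i * g n.+1) * (1 - rate k * g n.+1)) - (1 - slope i k * g n.+1) =
      (g n - g n.+1 * (1 + d * g n)) * d + g n.+1 * ((d - dl) + (d ^+ 2 * g n - d * g n * (rate i + rate k) +
      (1 + d * g n) * (rate i * rate k) * g n.+1)).
    by rewrite /slope -/dl; ring.
  by rewrite -gE subrr mul0r add0r.
rewrite normrM (ger0_norm gg) mulrC ler_wpM2r //.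
apply: (le_trans (ler_normD _ _)); rewrite [leRHS]splitr; apply: lerD => //.
rewrite ler_pdivlMr // in hg; apply: le_trans hg.
have dg : 0 <= d * g n by rewrite mulr_ge0.
have dgle : d * g n <= g n by rewrite ler_piMl.
have h1 : 0 <= d ^+ 2 * g n <= g n.
  by rewrite mulr_ge0 ?sqr_ge0 //= ler_piMl // expr_le1.
have h2 : 0 <= d * g n * (rate i + rate k) <= g n * (rate i + rate k).
  by rewrite mulr_ge0 //= ?ler_wpM2r //; lra.
have h3 : 0 <= (1 + d * g n) * (rate i * rate k) * g n.+1 <= 2 * (rate i * rate k) * g n.
  rewrite !mulr_ge0 //=; try lra.
  by apply: ler_pM => //; rewrite ?mulr_ge0 ?ler_wpM2r //; lra.
rewrite ler_norml /T; apply/andP.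
move: h1 h2 h3 => /andP[h1 h1'] /andP[h2 h2'] /andP[h3 h3']; split; lra.
Qed.

Lemma ratio_contract i k :
  \forall n \near \oo, `|ratio i k n| <= 1 - 1 / 2 * g n.+1.
Proof.
have c1 := slope_ge1 i k.
have c0 : 0 < (slope i k)^-1 by rewrite invr_gt0; lra.
have [n1 _ h1] := step_size_small a_gt c0.
have e2 : 0 < (2^-1 : R) by rewrite invr_gt0.
have [n2 _ h2] := ratio_approx i k e2.
exists (maxn n1 n2) => // n /=; rewrite geq_max => /andP[n1n n2n].
have := h1 n.+1 (leqW n1n); rewrite /= -[leRHS]mul1r ler_pdivlMr; last by lra.
have := h2 n n2n; have gg := g0 n.+1; rewrite /= mulrC.
have : g n.+1 <= slope i k * g n.+1 by rewrite ler_peMl.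
rewrite !ler_norml => x1 /andP[x2' x3] x4; apply/andP; split; lra.
Qed.

Fixpoint avg (rho : nat -> R) (h : seq 'I_N -> 'I_N -> R) (p : seq 'I_N) : R :=
  if p is j :: p' then rho (size p') * avg rho h p' + g (size p) * h p' j else 0.

(** By orthogonality the second moment contracts while each step adds only (g B)^2. *)
Lemma avg_mart_small rho h (B e : R) : 0 <= B ->
  (\forall n \near \oo, `|rho n| <= 1 - 1 / 2 * g n.+1) ->
  (forall p, \sum_j pker p j * h p j = 0) -> (forall p j, `|h p j| <= B) ->
  0 < e -> \forall n \near \oo, Ex pker n (fun p => avg rho h p ^+ 2) <= e.
Proof.
move=> B0 hrho mh hB e0.
have step_avg n : Ex pker n.+1 (fun p => avg rho h p ^+ 2) <=
    rho n ^+ 2 * Ex pker n (fun p => avg rho h p ^+ 2) + (g n.+1 * B) ^+ 2.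
  have -> : Ex pker n.+1 (fun p => avg rho h p ^+ 2) =
    Ex pker n (step pker (fun p => avg rho h p ^+ 2)) by [].
  rewrite -[X in _ <= _ + X](Ex_cst k0 k1 n) -(ExZ k0) -(ExD k0).
  apply: (Ex_le k0) => p sp; rewrite /step /= sp.
  set b := rho n * avg rho h p.
  apply: (@le_trans _ _ (\sum_j pker p j * ((b ^+ 2 + (g n.+1 * B) ^+ 2) + 2 * b * g n.+1 * h p j))).
    apply: ler_sum => j _; apply: ler_wpM2l; first exact: k0.
    have -> : (b + g n.+1 * h p j) ^+ 2 = b ^+ 2 + (g n.+1 * h p j) ^+ 2 + 2 * b * g n.+1 * h p j by ring.
    rewrite lerD2r lerD2l !exprMn ler_wpM2l ?sqr_ge0 // -(real_normK (num_real (h p j))).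
    by rewrite ler_sqr ?nnegrE.
  by rewrite step_affine mh mulr0 addr0 /b exprMn.
have lim := @recursion_eventually_le R (fun n => Ex pker n (fun p => avg rho h p ^+ 2))
  (fun n => g n.+1) (1 / 2) (e / 4).
have {}lim : \forall n \near \oo, Ex pker n (fun p => avg rho h p ^+ 2) <= e / 4 / (1 / 2) + e / 2.
  apply: lim; rewrite ?divr_gt0 //.
  - exact: step_size_dvg.
  - exact: nearW.
  - by apply: nearW => n; have := step_size_le1 a_gt n.+1; have := g0 n.+1; lra.
  - have B1 : 0 < B ^+ 2 + 1 by rewrite ltr_wpDl ?sqr_ge0.
    have e1 : 0 < e / 4 / (B ^+ 2 + 1) by rewrite !divr_gt0.
    have := step_size_small a_gt e1; move: hrho; apply: filterS2 => n hr hg.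
    apply: (le_trans (step_avg n)); apply: lerD.
      apply: ler_wpM2r; first by apply: (Ex_ge0 k0 k1) => p _; exact: sqr_ge0.
      have g1 := step_size_le1 a_gt n.+1; have gg := g0 n.+1.
      rewrite -(real_normK (num_real (rho n))).
      apply: (@le_trans _ _ ((1 - 1 / 2 * g n.+1) ^+ 2)).
        by rewrite ler_sqr ?nnegrE //; lra.
      by rewrite expr2 ler_piMr //; lra.
    rewrite exprMn expr2 -mulrA ler_wpM2l //.
    apply: (@le_trans _ _ (e / 4 / (B ^+ 2 + 1) * (B ^+ 2 + 1))).
      apply: ler_pM => //; rewrite ?sqr_ge0 // ?lerDl //.
      by apply: le_trans hg; exact: (step_size_nonincr a_gt (leqnSn n)).
    by rewrite divfK // gt_eqF.
by apply: filterS lim => n; rewrite (_ : e / 4 / (1 / 2) + e / 2 = e); last by field.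
Qed.

(* The quadratic covariation of [mpart i] and [mpart k], discounted in the same
   way. *)
Fixpoint qv (i k : 'I_N) (p : seq 'I_N) : R :=
  if p is j :: p' then (1 - rate i * g (size p)) * (1 - rate k * g (size p)) * qv i k p' +
    g (size p) ^+ 2 * ((G p')%:R * (noise i p' j * noise k p' j)) else 0.

Definition qlim (i k : 'I_N) : R :=
  (i == k)%:R * ((1 + lambda i) / (1 - lambda i)) / slope i k.

(** Near mu the product of noises is F(X, j), with conditional mean f(X). The Poisson equation
    writes f minus its mu-average as phi - P phi, so that averaging in time leaves a discounted
    martingale, a telescoping term and errors O(|x - mu|), all small in mean. *)
Lemma qv_cvg (i k : 'I_N) (e : R) : (i < N.-1)%N -> (k < N.-1)%N -> 0 < e ->
  \forall n \near \oo, Ex pker n (fun p => `|qv i k p / g n - qlim i k| * (G p)%:R) <= e.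
Proof.
move=> iN kN e0.
pose d l i' j := vproj v l (dM mu i' j).
pose F i' j := d i i' j * d k i' j.
pose f i' := \sum_j P i' j * F i' j.
pose phi i' := \sum_j Q P mu alpha mu i' j * f j.
pose s := qlim i k; pose c := slope i k.
have c1 : 1 <= c := slope_ge1 i k.
have cs : c * s = (i == k)%:R * ((1 + lambda i) / (1 - lambda i)).
  by rewrite /s /qlim mulrC divfK // gt_eqF // (lt_le_trans _ c1).
have poisson i' : f i' - c * s - phi i' + \sum_l P i' l * phi l = 0.
  have := poisson_eq alpha chain f i' (mu_pos chain).
  under eq_bigr do rewrite (pv_mu alpha chain).
  under [X in _ = _ - X]eq_bigr do rewrite (kernel_mu alpha chain).
  by rewrite (noise_covariance iN kN) -cs -/(phi i') => ->; rewrite /phi; ring.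
pose Bd := \sum_i' \sum_j (`|d i i' j| + `|F i' j|).
have dF i' j : `|d i i' j| + `|F i' j| <= Bd.
  rewrite /Bd (bigD1 i') //= (bigD1 j) //= -addrA lerDl addr_ge0 //.
    by apply: sumr_ge0 => *; exact: addr_ge0.
  by apply: sumr_ge0 => *; apply: sumr_ge0 => *; exact: addr_ge0.
have dB i' j : `|d i i' j| <= Bd by apply: le_trans (dF i' j); rewrite lerDl.
have FB i' j : `|F i' j| <= Bd by apply: le_trans (dF i' j); rewrite lerDr.
have Bd0 : 0 <= Bd by exact: le_trans (normr_ge0 _) (dB i0 i0).
pose Bp := \sum_i' `|phi i'|.
have pB i' : `|phi i'| <= Bp by rewrite /Bp (bigD1 i') //= lerDl sumr_ge0.
have Bp0 : 0 <= Bp by exact: le_trans (normr_ge0 _) (pB i0).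
pose KF p := \sum_l pker p l * F (Xs p) l.
pose Kp p := \sum_l pker p l * phi l.
pose mrt p j := F (Xs p) j - KF p + (phi j - Kp p).
have ker_avg p (y : 'I_N -> R) b : (forall l, `|y l| <= b) -> `|\sum_l pker p l * y l| <= b.
  move=> hy; apply: (le_trans (ler_norm_sum _ _ _)); rewrite -[leRHS]mul1r -(k1 p) mulr_suml.
  by apply: ler_sum => l _; rewrite normrM (ger0_norm (k0 _ _)) ler_wpM2l // k0.
have mrt0 p : \sum_j pker p j * mrt p j = 0.
  rewrite /mrt; under eq_bigr do rewrite mulrDr !mulrBr.
  rewrite big_split !sumrB /= -/(KF p) -/(Kp p).
  have kc c' : \sum_j pker p j * c' = c' by exact: (step_cst k1 _ p).
  by rewrite !kc !subrr addr0.
have mrtB p j : `|mrt p j| <= (Bd + Bd) + (Bp + Bp).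
  apply: (le_trans (ler_normD _ _)); apply: lerD; apply: (le_trans (ler_normB _ _));
    by apply: lerD => //; exact: ker_avg.
have B40 : 0 <= (Bd + Bd) + (Bp + Bp) by rewrite !addr_ge0.
pose rho := ratio i k; pose A := avg rho mrt.
(* The term g phi compensates the telescoping part; after subtracting [A] only small forcing remains
   in the recursion. *)
pose Es n p := qv i k p / g n - s + g n * phi (Xs p).
(* In order: replacing both noises by their values at mu, then the kernel by P in the means of F and
   of phi. *)
pose C1 := (C + Bd) * C + N%:R * (C * Bd) + N%:R * (C * Bp).
have C10 : 0 <= C1 by rewrite !addr_ge0 ?mulr_ge0 ?addr_ge0.
have U0 n : 0 <= Ex pker n (fun p => `|Es n p - A p| * (G p)%:R).
  by apply: (Ex_ge0 k0 k1) => p _; rewrite mulr_ge0.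
have hstep (eta : R) n p j : size p = n -> G p -> 0 < eta -> eta <= 1 ->
    `|rho n - (1 - c * g n.+1)| <= eta * g n.+1 ->
    `|Es n.+1 (j :: p) - A (j :: p)| <= `|rho n| * `|Es n p - A p| +
       g n.+1 * (C1 * `|xs p - mu| + (eta * `|s| + (c + 2) * Bp * g n)).
  move=> sp Gp eta0 eta1 hrho; have gg := g0 n.+1.
  set x := `|xs p - mu|; have x00 : 0 <= x by exact: normr_ge0.
  set rc := rho n - _ in hrho.
  have gE := gt_eqF (g_gt0 n); have gE1 := gt_eqF (g_gt0 n.+1).
  rewrite (_ : Es n.+1 (j :: p) - A (j :: p) = rho n * (Es n p - A p) + (rc * s +
    g n.+1 * (noise i p j * noise k p j - F (Xs p) j) +
    g n.+1 * (\sum_l (pker p l - P (Xs p) l) * F (Xs p) l) +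
    g n.+1 * (\sum_l (pker p l - P (Xs p) l) * phi l) +
    (g n.+1 - rho n * g n) * phi (Xs p))); last first.
    rewrite (eq_bigr _ (fun l _ => mulrBl _ _ _)) sumrB -/(KF p) -/(f (Xs p)).
    rewrite (eq_bigr _ (fun l _ => mulrBl _ _ _)) sumrB -/(Kp p).
    have -> : \sum_l P (Xs p) l * phi l = - (f (Xs p) - c * s - phi (Xs p)).
      by apply/eqP; rewrite -addr_eq0 addrC poisson.
    rewrite /Es /A [avg _ _ _]/= [qv _ _ _]/= sp Gp mul1r [Xs _]/= /mrt /rc /rho /ratio.
    by field; rewrite gE gE1.
  apply: (le_trans (ler_normD _ _)); rewrite normrM; apply: lerD => //.
  have hrho1 : `|1 - rho n| <= (c + 1) * g n.+1.
    have -> : 1 - rho n = c * g n.+1 - rc by rewrite /rc; ring.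
    apply: (le_trans (ler_normB _ _)); rewrite [leRHS]mulrDl; apply: lerD.
      by rewrite ger0_norm // mulr_ge0 //; lra.
    by apply: (le_trans hrho); rewrite ler_wpM2r.
  have h1 : `|rc * s| <= g n.+1 * (eta * `|s|).
    by rewrite normrM mulrCA mulrA ler_wpM2r.
  have h2 : `|g n.+1 * (noise i p j * noise k p j - F (Xs p) j)| <= g n.+1 * ((C + Bd) * C * x).
    rewrite normrM (ger0_norm gg) ler_wpM2l //.
    rewrite (_ : noise i p j * noise k p j - F (Xs p) j =
      (noise i p j - d i (Xs p) j) * noise k p j + d i (Xs p) j * (noise k p j - d k (Xs p) j)); last first.
      by rewrite /F; ring.
    apply: (le_trans (ler_normD _ _)); rewrite !normrM.
    rewrite (_ : (C + Bd) * C * x = (C * x) * C + Bd * (C * x)); last by ring.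
    by apply: lerD; apply: ler_pM => //; [exact: Hlip_noise|exact: Hnoise|exact: Hlip_noise].
  have hK (y : 'I_N -> R) b : (forall l, `|y l| <= b) ->
      `|g n.+1 * (\sum_l (pker p l - P (Xs p) l) * y l)| <= g n.+1 * (N%:R * (C * b) * x).
    move=> hy; rewrite normrM (ger0_norm gg) ler_wpM2l //.
    apply: (le_trans (ler_norm_sum _ _ _)).
    rewrite (_ : _ * x = \sum_(l < N) (C * x) * b); last first.
      by rewrite sumr_const card_ord -[RHS]mulr_natl; ring.
    by apply: ler_sum => l _; rewrite normrM; apply: ler_pM => //; exact: Hlip_ker.
  have h3 := hK _ _ (FB (Xs p)); have h4 := hK _ _ pB.
  have h5 : `|(g n.+1 - rho n * g n) * phi (Xs p)| <= g n.+1 * ((c + 2) * Bp * g n).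
    rewrite normrM (_ : g n.+1 * _ = g n.+1 * ((c + 2) * g n) * Bp); last by ring.
    apply: ler_pM => //.
    have -> : g n.+1 - rho n * g n = - (g n - g n.+1) + (1 - rho n) * g n by ring.
    apply: (le_trans (ler_normD _ _)); rewrite normrN ger0_norm; last first.
      by rewrite subr_ge0; exact: (step_size_nonincr a_gt (leqnSn n)).
    rewrite (_ : g n.+1 * _ = g n * g n.+1 + (c + 1) * g n.+1 * g n); last by ring.
    apply: lerD; first exact: step_size_diff.
    by rewrite normrM (ger0_norm (g0 n)) ler_wpM2r.
  rewrite (_ : g n.+1 * (C1 * x + _) = g n.+1 * (eta * `|s|) + g n.+1 * ((C + Bd) * C * x) +
    g n.+1 * (N%:R * (C * Bd) * x) + g n.+1 * (N%:R * (C * Bp) * x) + g n.+1 * ((c + 2) * Bp * g n)); last first.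
    by rewrite /C1; ring.
  do 4 (apply: (le_trans (ler_normD _ _)); apply: lerD => //).
have U_small : \forall n \near \oo, Ex pker n (fun p => `|Es n p - A p| * (G p)%:R) <= e / 2.
  have lim := @recursion_eventually_le R (fun n => Ex pker n (fun p => `|Es n p - A p| * (G p)%:R))
    (fun n => g n.+1) (1 / 2) (e / 8).
  have {}lim : \forall n \near \oo, Ex pker n (fun p => `|Es n p - A p| * (G p)%:R) <= e / 8 / (1 / 2) + e / 4.
    apply: lim; rewrite ?divr_gt0 //.
    - exact: step_size_dvg.
    - exact: nearW.
    - by apply: nearW => n; have := step_size_le1 a_gt n.+1; have := g0 n.+1; lra.
    - pose M := C1 + `|s| + (c + 2) * Bp + 1.
      have M0 : 0 < M.
        have := normr_ge0 s; have : 0 <= (c + 2) * Bp by rewrite mulr_ge0 //; lra.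
        by rewrite /M; lra.
      pose eta := Num.min 1 (e / 8 / M).
      have eta0 : 0 < eta by rewrite lt_min ltr01 !divr_gt0.
      have eta1 : eta <= 1 by rewrite ge_min lexx.
      have etaM : eta * M <= e / 8 by rewrite -ler_pdivlMr // ge_min lexx orbT.
      have [n1 _ h1] := ratio_approx i k eta0.
      have [n2 _ h2] := step_size_small a_gt eta0.
      have [n3 _ h3] := dist1_small eta0.
      have [n4 _ h4] := ratio_contract i k.
      exists (maxn m (maxn (maxn n1 n2) (maxn n3 n4))) => // n /=.
      rewrite !geq_max => /andP[mn /andP[/andP[n1n n2n] /andP[n3n n4n]]].
      have gg := g0 n.+1; have r4 := h4 _ n4n; rewrite /= in r4.
      have F0 p : 0 <= `|Es n.+1 p - A p| by [].
      apply: (le_trans (Ex_good_step mn F0 (Phi := fun p => `|rho n| * `|Es n p - A p| +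
         g n.+1 * (C1 * `|xs p - mu| + (eta * `|s| + (c + 2) * Bp * g n))) _)).
        move=> p sp Gp; rewrite -[leRHS](step_cst k1 _ p) /step; apply: ler_sum => j _.
        apply: ler_wpM2l; first exact: k0.
        by apply: hstep => //; exact: (h1 _ n1n).
      apply: (@le_trans _ _ ((1 - 1 / 2 * g n.+1) * Ex pker n (fun p => `|Es n p - A p| * (G p)%:R) +
        g n.+1 * (C1 * Ex pker n (fun p => `|xs p - mu| * (G p)%:R) + (eta * `|s| + (c + 2) * Bp * g n)))).
        rewrite -[X in _ <= _ + _ * (_ + X)](Ex_cst k0 k1 n) -!(ExZ k0) -(ExD k0) -(ExZ k0) -(ExD k0).
        apply: (Ex_le k0) => p _; case: (G p); rewrite ?mulr1 ?mulr0.
          by rewrite lerD2r ler_wpM2r.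
        rewrite !add0r mulr_ge0 // addr_ge0 ?mulr_ge0 // ?(ltW eta0) //; lra.
      rewrite lerD2l ler_wpM2l //; apply: le_trans etaM.
      rewrite /M [leRHS](_ : _ = C1 * eta + (eta * `|s| + (c + 2) * Bp * eta) + eta); last by ring.
      rewrite -[leLHS]addr0; apply: lerD; last exact: ltW.
      apply: lerD; first by rewrite ler_wpM2l //; exact: (h3 _ n3n).
      by rewrite lerD2l ler_wpM2l ?(h2 _ n2n) // mulr_ge0 //; lra.
  by apply: filterS lim => n; rewrite (_ : e / 8 / (1 / 2) + e / 4 = e / 2); last by field.
have e4 : 0 < e / 4 by rewrite divr_gt0.
have A_small := avg_mart_small B40 (ratio_contract i k) mrt0 mrtB (exprn_gt0 2 e4).
have ep : 0 < e / 4 / (Bp + 1) by rewrite divr_gt0 // ltr_wpDl.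
have g_small := step_size_small a_gt ep.
move: U_small A_small g_small; apply: filterS3 => n hU hA hg.
have {}hA : Ex pker n (fun p => `|A p|) <= e / 4.
  apply: (Ex_le_sqrt k0 k1) => //; apply: le_trans hA; apply: (Ex_le k0) => p _.
  by rewrite real_normK ?num_real.
apply: (@le_trans _ _ (Ex pker n (fun p => `|Es n p - A p| * (G p)%:R + `|A p| + g n * Bp))).
  apply: (Ex_le k0) => p _; case: (G p); rewrite ?mulr1 ?mulr0; last first.
    by rewrite add0r addr_ge0 // mulr_ge0.
  rewrite (_ : _ - qlim i k = (Es n p - A p) + A p - g n * phi (Xs p)); last by rewrite /Es /s; ring.
  apply: (le_trans (ler_normB _ _)); apply: lerD; first exact: ler_normD.
  by rewrite normrM (ger0_norm (g0 n)) ler_wpM2l.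
rewrite !(ExD k0) (Ex_cst k0 k1).
have : g n * Bp <= e / 4.
  apply: (@le_trans _ _ (e / 4 / (Bp + 1) * (Bp + 1))).
    by apply: ler_pM => //; rewrite lerDl.
  by rewrite divfK // gt_eqF // ltr_wpDl.
lra.
Qed.

Definition aw (i : 'I_N) (k n : nat) : R := \prod_(k <= l < n) (1 - rate i * g l.+1).
(** Contraction at rate one, a majorant of every [aw] that is comparable with the step sizes through
    [step_dw]. *)
Definition dw (k n : nat) : R := \prod_(k <= l < n) (1 - g l.+1).

Lemma awS i k n : (k < n)%N -> aw i k n = (1 - rate i * g k.+1) * aw i k.+1 n.
Proof. by move=> kn; rewrite /aw big_ltn. Qed.

Lemma dwS k n : (k < n)%N -> dw k n = (1 - g k.+1) * dw k.+1 n.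
Proof. by move=> kn; rewrite /dw big_ltn. Qed.

Lemma dw_bound k n : 0 <= dw k n <= 1.
Proof.
rewrite /dw; elim/big_ind: _ => [|x y /andP[x_ge0 x_le1] /andP[y_ge0 y_le1]|l _].
- by rewrite ler01 lexx.
- by rewrite mulr_ge0 // mulr_ile1.
- by have := step_size_le1 a_gt l.+1; have := g0 l.+1; lra.
Qed.

Lemma aw_bound i k n : (m <= k)%N -> 0 <= aw i k n <= dw k n.
Proof.
move=> mk; case: (leqP k n) => [|nk]; last first.
  by rewrite /aw /dw !big_geq ?lexx ?ler01 // ltnW.
move=> kn; have -> : n = (k + (n - k))%N by rewrite subnKC.
elim: (n - k)%N => [|h IH]; first by rewrite addn0 /aw /dw !big_geq // lexx ler01.
rewrite addnS /aw /dw !big_nat_recr ?leq_addr //= -/(aw _ _ _) -/(dw _ _).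
have mh : (m <= k + h)%N by rewrite (leq_trans mk) ?leq_addr.
have := m_rate i mh; have := rate_contract i mh; have := m_large mh; have := g0 (k + h).+1.
move=> h1 h2 h3 h4; rewrite ger0_norm ?subr_ge0 // in h3.
case/andP: IH => IH1 IH2; rewrite mulr_ge0 ?subr_ge0 //=.
by apply: ler_pM => //; rewrite subr_ge0.
Qed.

Lemma step_dw k n : (k <= n)%N -> g k * dw k n <= g n.
Proof.
move=> kn; have -> : n = (k + (n - k))%N by rewrite subnKC.
elim: (n - k)%N => [|h IH]; first by rewrite addn0 /dw big_geq // mulr1.
rewrite addnS /dw big_nat_recr ?leq_addr //= -/(dw _ _) mulrA.
have g1 := step_size_le1 a_gt (k + h).+1.
apply: (@le_trans _ _ (g (k + h) * (1 - g (k + h).+1))).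
  by rewrite ler_wpM2r // subr_ge0.
by rewrite mulrC step_ratio.
Qed.

Section Weights.
Variable tau : 'I_N -> R.

Local Notation tsum F := (\sum_(i < N | (i < N.-1)%N) tau i * F i).
Definition tnorm : R := \sum_(i < N | (i < N.-1)%N) `|tau i|.
Definition clt_var : R :=
  \sum_(i < N | (i < N.-1)%N) tau i ^+ 2 * ((1 + lambda i) / (1 - lambda i) / slope i i).
(** Unrolling [mpart] gives weights [aw], so at time n the sum of these increments is the
    combination of [mpart] with weights tau, divided by the square root of g n. *)
Definition xi (n : nat) (p : seq 'I_N) (j : 'I_N) : R :=
  (Num.sqrt (g n))^-1 *
  \sum_(i < N | (i < N.-1)%N)
    tau i * (aw i (size p).+1 n * (g (size p).+1 * ((G p)%:R * noise i p j))).

Lemma psum_xi n p : (size p <= n)%N -> psum (xi n) p = (Num.sqrt (g n))^-1 *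
  \sum_(i < N | (i < N.-1)%N) tau i * (aw i (size p) n * mpart i p).
Proof.
elim: p => [|j p IHp] /= sp; first by rewrite big1 ?mulr0 // => i _; rewrite !mulr0.
rewrite IHp ?(ltnW sp) // /xi -mulrDr -big_split /=; congr (_ * _).
by apply: eq_bigr => i _; rewrite (awS i sp); ring.
Qed.

Lemma psum_xi_sqr n p : (size p <= n)%N -> psum (fun p j => xi n p j ^+ 2) p =
  \sum_(i < N | (i < N.-1)%N) \sum_(k < N | (k < N.-1)%N)
    tau i * tau k * (aw i (size p) n * aw k (size p) n * (qv i k p / g n)).
Proof.
elim: p => [|j p IHp] /= sp.
  by rewrite big1 // => i _; rewrite big1 // => k _; rewrite mul0r !mulr0.
rewrite IHp ?(ltnW sp) // /xi exprMn exprVn sqr_sqrtr // expr2 mulr_suml mulr_sumr -big_split /=.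
apply: eq_bigr => i _; rewrite mulr_sumr mulr_sumr -big_split /=.
apply: eq_bigr => k _; rewrite (awS i sp) (awS k sp).
by case: (G p); rewrite /= ?mul0r ?mulr0; field; rewrite gt_eqF.
Qed.

Lemma xi_mart n p : \sum_j pker p j * xi n p j = 0.
Proof.
rewrite /xi; under eq_bigr do rewrite mulrCA.
rewrite -mulr_sumr; under eq_bigr do rewrite mulr_sumr.
rewrite exchange_big big1 ?mulr0 //= => i _.
rewrite (eq_bigr (fun j => tau i * (aw i (size p).+1 n * (g (size p).+1 * (G p)%:R)) *
  (pker p j * noise i p j))); last by move=> j _; ring.
by rewrite -mulr_sumr (noise_mean0 v alpha chain i0 x0_simplex a_gt) mulr0.
Qed.

Let T0 : 0 <= tnorm. Proof. exact: sumr_ge0. Qed.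

Lemma xi_dw n p j : `|xi n p j| <=
  (Num.sqrt (g n))^-1 * (tnorm * C * (dw (size p).+1 n * g (size p).+1)).
Proof.
have gg := g0 (size p).+1; have /andP[d0 _] := dw_bound (size p).+1 n.
rewrite /xi normrM ger0_norm ?invr_ge0 ?sqrtr_ge0 // ler_wpM2l ?invr_ge0 ?sqrtr_ge0 //.
apply: (le_trans (ler_norm_sum _ _ _)); rewrite /tnorm -mulrA mulr_suml; apply: ler_sum => i _.
rewrite normrM ler_wpM2l //; case: (boolP (G p)) => Gp; last first.
  by rewrite mul0r !mulr0 normr0 !mulr_ge0.
have mp := leqW (good_size Gp).
(* The bound on [aw] holds from time m only; before m the indicator kills the increment. *)
have /andP[a0 a1] := aw_bound i n mp.
rewrite mul1r mulrA normrM mulrC; apply: ler_pM => //; first exact: Hnoise.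
by rewrite ger0_norm ?mulr_ge0 // ler_wpM2r.
Qed.

Lemma xi_le n p j : (size p < n)%N -> `|xi n p j| <= tnorm * C * Num.sqrt (g n).
Proof.
move=> sp; apply: (le_trans (xi_dw n p j)).
rewrite mulrCA ler_wpM2l ?mulr_ge0 // mulrC ler_pdivrMr ?sqrtr_gt0 //.
by rewrite -expr2 sqr_sqrtr // mulrC step_dw.
Qed.

(** Using [step_dw] for one of the two factors, each square is at most (tnorm C)^2 g dw, and dw (k +
    1) - dw k = g dw (k + 1) telescopes. *)
Lemma psum_xi_le n p : (size p <= n)%N ->
  psum (fun p j => xi n p j ^+ 2) p <= (tnorm * C) ^+ 2 * dw (size p) n.
Proof.
elim: p => [|j p IHp] /= sp.
  by rewrite mulr_ge0 ?sqr_ge0 //; case/andP: (dw_bound 0 n).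
have gg := g0 (size p).+1; have /andP[d0 _] := dw_bound (size p).+1 n.
apply: (@le_trans _ _ ((tnorm * C) ^+ 2 * dw (size p) n +
    (tnorm * C) ^+ 2 * (g (size p).+1 * dw (size p).+1 n))); last first.
  by rewrite (dwS sp) le_eqVlt; apply/orP; left; apply/eqP; ring.
apply: lerD; first by rewrite IHp // ltnW.
have h := xi_dw n p j.
rewrite -(real_normK (num_real (xi n p j))).
apply: (@le_trans _ _ (((Num.sqrt (g n))^-1 * (tnorm * C * (dw (size p).+1 n * g (size p).+1))) ^+ 2)).
  by rewrite ler_sqr ?nnegrE // (le_trans _ h).
rewrite (exprMn _ (Num.sqrt (g n))^-1) exprVn sqr_sqrtr //.
rewrite [leLHS](_ : _ = (tnorm * C) ^+ 2 * (g (size p).+1 * dw (size p).+1 n) *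
   ((g (size p).+1 * dw (size p).+1 n) / g n)); last by ring.
rewrite ler_piMr // ?mulr_ge0 ?sqr_ge0 // ler_pdivrMr // mul1r.
exact: step_dw.
Qed.

Lemma clt_var_ge0 : 0 <= clt_var.
Proof.
apply: sumr_ge0 => i iN; rewrite mulr_ge0 ?sqr_ge0 //.
have := lambda_gtN1 spec i; have := lambda_lt1 spec iN; have := slope_ge1 i i => h1 h2 h3.
by rewrite !divr_ge0 //; lra.
Qed.

Lemma clt_var_double : clt_var =
  \sum_(i < N | (i < N.-1)%N) \sum_(k < N | (k < N.-1)%N) tau i * tau k * qlim i k.
Proof.
apply: eq_bigr => i iN; rewrite (bigD1 i) //= big1 => [|k /andP[_ ki]].
  by rewrite /qlim eqxx mul1r addr0; ring.
by rewrite /qlim eq_sym (negbTE ki) !mul0r mulr0.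
Qed.

(** A common bound for the quadratic variation and its limit; neither this nor [clt_const] involves
    m. *)
Definition clt_bound : R := (tnorm * C) ^+ 2 + clt_var.
Definition clt_const : R :=
  expR clt_bound * (1 + 6 * clt_bound * expR (6 * clt_bound)).

Lemma clt_bound_ge0 : 0 <= clt_bound.
Proof. exact: addr_ge0 (sqr_ge0 _) clt_var_ge0. Qed.

Lemma clt_const_ge0 : 0 <= clt_const.
Proof.
have c0 := clt_bound_ge0; apply: mulr_ge0; first exact: expR_ge0.
by apply: addr_ge0 => //; apply: mulr_ge0; [exact: mulr_ge0|exact: expR_ge0].
Qed.

(** At the final time the weights [aw] are 1, so the quadratic variation is the double sum of qv /
    g, and [qv_cvg] applies termwise. *)
Lemma lindeberg_error (e : R) : 0 < e -> \forall n \near \oo,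
  Ex pker n (fun p => `|psum (fun p j => xi n p j ^+ 2) p - clt_var| * (G p)%:R) <= e.
Proof.
move=> e0; pose T2 := \sum_(i < N) \sum_(k < N) `|tau i * tau k| + 1.
have T20 : 0 < T2.
  by rewrite ltr_wpDl // sumr_ge0 // => i _; exact: sumr_ge0.
have e1 : 0 < e / T2 by rewrite divr_gt0.
have : \forall n \near \oo, forall ik : 'I_N * 'I_N, (ik.1 < N.-1)%N -> (ik.2 < N.-1)%N ->
    Ex pker n (fun p => `|qv ik.1 ik.2 p / g n - qlim ik.1 ik.2| * (G p)%:R) <= e / T2.
  apply: filter_forall => -[i k] /=; case: (boolP (i < N.-1)%N) => iN; last exact: nearW.
  case: (boolP (k < N.-1)%N) => kN; last exact: nearW.
  by have := qv_cvg iN kN e1; apply: filterS.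
apply: filterS => n h.
apply: (@le_trans _ _ (\sum_(i < N | (i < N.-1)%N) \sum_(k < N | (k < N.-1)%N)
   `|tau i * tau k| * Ex pker n (fun p => `|qv i k p / g n - qlim i k| * (G p)%:R))).
  under eq_bigr do under eq_bigr do rewrite -(ExZ k0).
  under eq_bigr do rewrite -(Ex_sum k0 k1).
  rewrite -(Ex_sum k0 k1); apply: (Ex_le k0) => p sp.
  rewrite psum_xi_sqr ?sp // clt_var_double -sumrB.
  case: (G p); rewrite ?mulr0 ?mulr1; last first.
    by apply: sumr_ge0 => i _; apply: sumr_ge0 => k _; rewrite !mulr0.
  apply: (le_trans (ler_norm_sum _ _ _)); apply: ler_sum => i _.
  rewrite -sumrB; apply: (le_trans (ler_norm_sum _ _ _)); apply: ler_sum => k _.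
  by rewrite /aw !big_geq // !mul1r mulr1 -mulrBr normrM.
apply: (@le_trans _ _ (\sum_(i < N | (i < N.-1)%N) \sum_(k < N | (k < N.-1)%N)
   `|tau i * tau k| * (e / T2))).
  apply: ler_sum => i iN; apply: ler_sum => k kN; rewrite ler_wpM2l //.
  exact: (h (i, k)).
apply: (@le_trans _ _ ((\sum_(i < N) \sum_(k < N) `|tau i * tau k|) * (e / T2))); last first.
  apply: (@le_trans _ _ (T2 * (e / T2))); last by rewrite mulrC divfK // gt_eqF.
  by rewrite ler_wpM2r ?(ltW e1) // lerDl.
rewrite mulr_suml [leRHS](bigID (fun i : 'I_N => (i < N.-1)%N)) /= -[leLHS]addr0.
apply: lerD; last first.
  by apply: sumr_ge0 => i _; rewrite mulr_ge0 ?(ltW e1) // sumr_ge0.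
apply: ler_sum => i _; rewrite mulr_suml [leRHS](bigID (fun i : 'I_N => (i < N.-1)%N)) /= lerDl.
by apply: sumr_ge0 => k _; rewrite mulr_ge0 // ltW.
Qed.

(* The noise vanishes off the good event, so McLeish's bound applies on all
   paths; off that event the quadratic variation is only known to be bounded,
   which costs the term in [dlt]. *)
Lemma mpart_charfn (dlt e : R) :
  (forall n, (m <= n)%N -> Ex pker n (fun p => (~~ G p)%:R) <= dlt) -> 0 < e ->
  \forall n \near \oo,
  `|Ex pker n (fun p => cos (psum (xi n) p)) - expR (- (clt_var / 2))|
    <= clt_const * (2 * clt_bound * dlt + e) /\
  `|Ex pker n (fun p => sin (psum (xi n) p))|
    <= clt_const * (2 * clt_bound * dlt + e).
Proof.
move=> hd e0; have s20 := clt_var_ge0.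
have e2 : 0 < e / 2 by rewrite divr_gt0.
pose e3 := Num.min 1 (e / 2) / (tnorm * C + 1).
have TC : 0 <= tnorm * C by rewrite mulr_ge0.
have e30 : 0 < e3 by rewrite divr_gt0 ?lt_min ?ltr01 // ltr_wpDl.
have [n1 _ h1] := lindeberg_error e2.
have [n2 _ h2] := step_size_small a_gt (exprn_gt0 2 e30).
exists (maxn m (maxn n1 n2)) => // n /=; rewrite !geq_max => /andP[mn /andP[n1n n2n]].
have small : tnorm * C * Num.sqrt (g n) <= Num.min 1 (e / 2).
  apply: (@le_trans _ _ ((tnorm * C + 1) * e3)).
    apply: ler_pM; rewrite ?sqrtr_ge0 ?lerDl //.
    rewrite -ler_sqr ?nnegrE ?sqrtr_ge0 ?(ltW e30) // sqr_sqrtr //.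
    exact: (h2 _ n2n).
  by rewrite mulrC divfK // gt_eqF // ltr_wpDl.
move: small; rewrite le_min => /andP[s1 s2].
have qv_le p : (size p <= n)%N -> psum (fun p j => xi n p j ^+ 2) p <= clt_bound.
  move=> sp; apply: (le_trans (psum_xi_le sp)).
  apply: (@le_trans _ _ ((tnorm * C) ^+ 2)); last by rewrite lerDl.
  by rewrite ler_piMr ?sqr_ge0 //; case/andP: (dw_bound (size p) n).
have V0 p : 0 <= psum (fun p j => xi n p j ^+ 2) p.
  by elim: p => //= j p IH; rewrite addr_ge0 ?sqr_ge0.
have := mcleish k0 k1 (fun p _ => xi_mart n p) s1 (fun p j => @xi_le n p j) qv_le.
move=> /(_ clt_var); rewrite -/clt_const => /(_ _ _)[].
- by rewrite mulr_ge0 ?sqrtr_ge0.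
- by rewrite s20 /= lerDr sqr_ge0.
have cb0 := clt_bound_ge0; have cc0 := clt_const_ge0.
have bnd : Ex pker n (fun p => `|psum (fun p j => xi n p j ^+ 2) p - clt_var|) +
    tnorm * C * Num.sqrt (g n) <= 2 * clt_bound * dlt + e.
  rewrite [in leRHS](splitr e) addrA; apply: lerD => //.
  rewrite [leRHS]addrC; apply: (@le_trans _ _ (e / 2 + 2 * clt_bound * Ex pker n (fun p => (~~ G p)%:R))).
    apply: (@le_trans _ _ (Ex pker n (fun p =>
      `|psum (fun p j => xi n p j ^+ 2) p - clt_var| * (G p)%:R + 2 * clt_bound * (~~ G p)%:R))).
      apply: (Ex_le k0) => p sp; case: (G p); rewrite /= ?mulr1 ?mulr0 ?addr0 ?add0r //.
      have := qv_le p (eq_leq sp); have := V0 p; have : clt_var <= clt_bound by rewrite lerDr sqr_ge0.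
      by move=> v1 v2 v3; rewrite ler_norml; apply/andP; split; lra.
    by rewrite (ExD k0) (ExZ k0) lerD2r; exact: (h1 _ n1n).
  by rewrite lerD2l ler_wpM2l ?hd // mulr_ge0.
move=> hc hs; split; [apply: (le_trans hc)|apply: (le_trans hs)]; exact: ler_wpM2l.
Qed.

End Weights.

Lemma cos_lip (x y : R) : `|cos x - cos y| <= 2 * `|x - y|.
Proof.
rewrite -{1}(subrK y x) cosD.
have -> : cos (x - y) * cos y - sin (x - y) * sin y - cos y =
  (cos (x - y) - 1) * cos y - sin (x - y) * sin y by ring.
apply: (le_trans (ler_normB _ _)); rewrite !normrM mulr_natl mulr2n.
apply: lerD; rewrite -[leRHS]mulr1; apply: ler_pM => //.
- exact: cos_sub1_le.
- exact: cos_max.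
- exact: norm_sin_le.
- exact: sin_max.
Qed.

(** The eigen-expansion turns the linear form into projections, which differ from [mpart] by the
    remainder and the corrector. The 2 in front of [dlt] bounds the difference of two cosines off
    the good event. *)
Lemma clt_charfn (t : 'cV[R]_N) (phi dlt e : R) (tau := fun i => \sum_j t j 0 * u i j 0) :
  (forall n, (m <= n)%N -> Ex pker n (fun p => (~~ G p)%:R) <= dlt) -> 0 < e ->
  \forall n \near \oo,
  `|Ex pker n (fun p => cos ((\sum_j t j 0 * (xs p j 0 - mu j 0)) / Num.sqrt (g n) + phi)) -
     cos phi * expR (- (clt_var tau / 2))|
    <= (2 + 4 * clt_const tau * clt_bound tau) * dlt + e.
Proof.
move=> hd e0.
have cb0 := clt_bound_ge0 tau; have cc0 := clt_const_ge0 tau.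
have T0 : 0 <= tnorm tau by exact: sumr_ge0.
pose lin p := \sum_j t j 0 * (xs p j 0 - mu j 0).
have linE p : lin p = \sum_(i < N | (i < N.-1)%N) tau i * vproj v i (fun j => xs p j 0 - mu j 0).
  rewrite /lin; under eq_bigr do rewrite (eigen_expansion chain spec x0_simplex a_gt) mulr_sumr.
  rewrite exchange_big /=; apply: eq_bigr => i _; rewrite /tau mulr_suml.
  by apply: eq_bigr => j _; rewrite mulrA.
have e1 : 0 < e / (8 * (tnorm tau + 1)) by rewrite divr_gt0 // mulr_gt0 // ltr_wpDl.
have e2 : 0 < e / (4 * (clt_const tau + 1)) by rewrite divr_gt0 // mulr_gt0 // ltr_wpDl.
have e3 : 0 < e / (8 * (tnorm tau * C + 1)).
  by rewrite divr_gt0 // mulr_gt0 // ltr_wpDl // mulr_ge0.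
have rem : \forall n \near \oo, forall i : 'I_N, (i < N.-1)%N ->
    Ex pker n (fun p => `|zeta i p - mpart i p| * (G p)%:R) <= e / (8 * (tnorm tau + 1)) * Num.sqrt (g n).
  apply: filter_forall => i; case: (boolP (i < N.-1)%N) => iN; last exact: nearW.
  by have := remainder_small iN e1; apply: filterS.
have [n1 _ h1] := rem; have [n2 _ h2] := mpart_charfn tau hd e2.
have [n3 _ h3] := step_size_small a_gt (exprn_gt0 2 e3).
exists (maxn m (maxn n1 (maxn n2 n3))) => // n /=.
rewrite !geq_max => /andP[mn /andP[n1n /andP[n2n n3n]]].
have sg : 0 < Num.sqrt (g n) by rewrite sqrtr_gt0.
have [hc hs] := h2 _ n2n.
set M := psum _ in hc hs.
set E := expR _ in hc *.
have lin_M : Ex pker n (fun p => `|cos (lin p / Num.sqrt (g n) + phi) - cos (M p + phi)|) <=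
    e / 2 + 2 * dlt.
  pose err p := \sum_(i < N | (i < N.-1)%N) `|tau i| * (`|zeta i p - mpart i p| * (G p)%:R).
  apply: (@le_trans _ _ (Ex pker n (fun p => 2 / Num.sqrt (g n) * err p + 2 * (tnorm tau * C) * Num.sqrt (g n) +
     2 * (~~ G p)%:R))).
    apply: (Ex_le k0) => p sp; case: (boolP (G p)) => Gp /=; last first.
      rewrite mulr1; apply: (@le_trans _ _ 2).
        apply: (le_trans (ler_normB _ _)).
        have := cos_max (lin p / Num.sqrt (g n) + phi); have := cos_max (M p + phi); lra.
      rewrite lerDr addr_ge0 ?mulr_ge0 ?invr_ge0 ?(ltW sg) //.
      by apply: sumr_ge0 => i _; rewrite !mulr_ge0.
    rewrite mulr0 addr0; apply: (le_trans (cos_lip _ _)).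
    have -> : lin p / Num.sqrt (g n) + phi - (M p + phi) = (Num.sqrt (g n))^-1 *
       \sum_(i < N | (i < N.-1)%N) tau i * ((zeta i p - mpart i p) - g n.+1 * corr i p).
      rewrite /M psum_xi ?sp // linE.
      have -> : \sum_(i < N | (i < N.-1)%N) tau i * (aw i n n * mpart i p) =
          \sum_(i < N | (i < N.-1)%N) tau i * mpart i p.
        by apply: eq_bigr => i _; rewrite /aw big_geq // mul1r.
      have -> : \sum_(i < N | (i < N.-1)%N) tau i * ((zeta i p - mpart i p) - g n.+1 * corr i p) =
         \sum_(i < N | (i < N.-1)%N) tau i * vproj v i (fun j => xs p j 0 - mu j 0) -
         \sum_(i < N | (i < N.-1)%N) tau i * mpart i p.
        by rewrite -sumrB; apply: eq_bigr => i _; rewrite zetaE sp; ring.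
      ring.
    rewrite normrM ger0_norm ?invr_ge0 ?(ltW sg) //.
    apply: (@le_trans _ _ (2 * ((Num.sqrt (g n))^-1 * (err p + tnorm tau * C * g n)))).
      rewrite ler_pM2l // ler_wpM2l ?invr_ge0 ?(ltW sg) //.
      apply: (le_trans (ler_norm_sum _ _ _)).
      rewrite /err /tnorm -mulrA mulr_suml -big_split /=; apply: ler_sum => i _.
      rewrite Gp mulr1 normrM -mulrDr ler_wpM2l //.
      apply: (le_trans (ler_normB _ _)); rewrite lerD2l normrM ger0_norm // mulrC.
      by apply: ler_pM => //; [exact: Hcorr|exact: (step_size_nonincr a_gt (leqnSn n))].
    rewrite le_eqVlt; apply/orP; left; apply/eqP.
    by rewrite -{2}(sqr_sqrtr (g0 n)); field; rewrite gt_eqF.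
  rewrite !(ExD k0) (ExZ k0 n (2 / Num.sqrt (g n))) (Ex_cst k0 k1) (ExZ k0 n 2).
  have b1 : 2 / Num.sqrt (g n) * Ex pker n err <= e / 4.
    rewrite /err (Ex_sum k0 k1).
    apply: (@le_trans _ _ (2 / Num.sqrt (g n) * (tnorm tau * (e / (8 * (tnorm tau + 1)) * Num.sqrt (g n))))).
      rewrite ler_wpM2l ?divr_ge0 ?(ltW sg) // /tnorm mulr_suml; apply: ler_sum => i iN.
      by rewrite (ExZ k0) ler_wpM2l //; exact: (h1 _ n1n).
    rewrite [leLHS](_ : _ = e / 4 * (tnorm tau / (tnorm tau + 1))); last first.
      by field; rewrite !gt_eqF //= ltr_wpDl.
    rewrite ler_piMr ?divr_ge0 ?(ltW e0) // ler_pdivrMr ?mul1r ?lerDl //.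
    by rewrite ltr_wpDl.
  have b2 : 2 * (tnorm tau * C) * Num.sqrt (g n) <= e / 4.
    have TC : 0 <= tnorm tau * C by rewrite mulr_ge0.
    have gs : Num.sqrt (g n) <= e / (8 * (tnorm tau * C + 1)).
      rewrite -ler_sqr ?nnegrE ?sqrtr_ge0 ?(ltW e3) // sqr_sqrtr //.
      exact: (h3 _ n3n).
    apply: (@le_trans _ _ (2 * (tnorm tau * C) * (e / (8 * (tnorm tau * C + 1))))).
      by rewrite ler_wpM2l // mulr_ge0.
    rewrite [leLHS](_ : _ = e / 4 * ((tnorm tau * C) / (tnorm tau * C + 1))); last first.
      by field; rewrite !gt_eqF //= ltr_wpDl.
    rewrite ler_piMr ?divr_ge0 ?(ltW e0) // ler_pdivrMr ?mul1r ?lerDl //.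
    by rewrite ltr_wpDl.
  have := hd _ mn; lra.
have M_lim : `|Ex pker n (fun p => cos (M p + phi)) - cos phi * E| <=
    2 * (clt_const tau * (2 * clt_bound tau * dlt + e / (4 * (clt_const tau + 1)))).
  have -> : Ex pker n (fun p => cos (M p + phi)) - cos phi * E =
    cos phi * (Ex pker n (fun p => cos (M p)) - E) - sin phi * Ex pker n (fun p => sin (M p)).
    rewrite mulrBr addrAC; congr (_ - _); rewrite -!(ExZ k0) -(ExB k0).
    by apply: (Ex_ext k0) => p _; rewrite cosD; ring.
  apply: (le_trans (ler_normB _ _)); rewrite !normrM mulr_natl mulr2n.
  by apply: lerD; rewrite -[leRHS]mul1r; apply: ler_pM => //; [exact: cos_max|exact: sin_max].
have e4 : 2 * (clt_const tau * (e / (4 * (clt_const tau + 1)))) <= e / 2.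
  rewrite [leLHS](_ : _ = e / 2 * (clt_const tau / (clt_const tau + 1))); last first.
    by field; rewrite !gt_eqF //= ltr_wpDl.
  rewrite ler_piMr ?divr_ge0 ?(ltW e0) // ler_pdivrMr ?mul1r ?lerDl //.
  by rewrite ltr_wpDl.
have := le_trans (ler_norm _) (Ex_norm k0 n (fun p => cos (lin p / Num.sqrt (g n) + phi) - cos (M p + phi))).
have /= := Ex_norm k0 n (fun p => cos (lin p / Num.sqrt (g n) + phi) - cos (M p + phi)).
rewrite (ExB k0) => h4 _.
rewrite -(subrKA (Ex pker n (fun p => cos (M p + phi)))).
apply: (le_trans (ler_normD _ _)).
have := le_trans h4 lin_M; rewrite mulrDl mulrDr mulrDr in M_lim *.
lra.
Qed.

End Moments.

(** * Choice of constants, limit of characteristic functions, tightness *)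

Section CharFnLimit.
Context (R : realType) (N D : nat) (P : 'M[R]_N) (mu : 'cV[R]_N).
Context (lambda : 'I_N -> R) (u v : 'I_N -> 'cV[R]_N) (alpha a : R).
Hypothesis chain : ergodic_reversible P mu.
Hypothesis spec : spectral_decomposition P mu lambda u v.
Hypothesis alpha_ge0 : 0 <= alpha.
Context (x0 : 'cV[R]_N) (i0 : 'I_N).
Hypothesis x0_simplex : int_simplex x0.
Hypothesis a_gt : 2^-1 < a.
Hypothesis a_le1 : a <= 1.

Local Notation g := (step_size a).
Local Notation xs := (xs a x0).
Local Notation Xs := (Xs i0).
Local Notation pker := (pker P mu alpha a x0 i0).
Local Notation rate := (rate lambda alpha).
Local Notation corr := (corr P mu v alpha a x0 i0).
Local Notation zeta := (zeta P mu v alpha a x0 i0).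
Local Notation noise := (noise P mu v alpha a x0 i0).
Local Notation energy := (energy P mu v alpha a x0 i0).
Local Notation dM := (dM P mu alpha).
Local Notation good r m := (good mu a x0 r m).

Let g0 n : 0 <= g n := step_size_ge0 a n.

(** The radius and C are obtained before m and serve every late m, so that m can be increased
    afterwards without changing the error constants. *)
Lemma linear_regime : exists r C : R, exists m1 : nat,
  [/\ 1 <= C, 0 < r, r <= 1 & 32 * N%:R * C ^+ 3 * r ^+ 2 <= 1] /\
  forall m, (m1 <= m)%N ->
  [/\ forall n, (m <= n)%N -> 4 * g n.+1 <= 1,
      forall n (i : 'I_N), (m <= n)%N -> rate i * g n.+1 <= 1,
      forall i : 'I_N, (i < N.-1)%N -> forall p i', good r m p ->
        `|zeta i (i' :: p) -
          ((1 - rate i * g (size p).+1) * zeta i p + g (size p).+1 * noise i p i')|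
        <= C * (g (size p).+1 * (g (size p).+1 + `|xs p - mu| ^+ 2))
    & forall i p i', good r m p -> `|noise i p i'| <= C] /\
  [/\ forall i p, good r m p -> `|corr i p| <= C,
      forall p, good r m p ->
        `|xs p - mu| ^+ 2 <= C * (energy p + g (size p).+1 ^+ 2),
      forall i p i', good r m p ->
        `|noise i p i' - vproj v i (dM mu (Xs p) i')| <= C * `|xs p - mu|
    & forall p i', good r m p -> `|pker p i' - P (Xs p) i'| <= C * `|xs p - mu|].
Proof.
have [b b0 hb] := mu_lower_bound chain.
pose rho := b / 2; have rho0 : 0 < rho by rewrite divr_gt0.
have rho_le i : 2 * rho <= mu i 0 by rewrite /rho mulrC divfK.
have [Cz Cz0 hz] := zeta_step chain spec alpha_ge0 i0 x0_simplex a_gt a_le1 rho0 rho_le.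
have [Cn Cn0 hn] := noise_bound v a chain alpha_ge0 x0 i0 rho0.
have [Cc Cc0 hc] := corr_bound v a chain alpha_ge0 x0 i0 rho0.
have [Cd Cd0 hd] := dist_energy chain spec alpha_ge0 i0 x0_simplex a_gt rho0.
have [Cl Cl0 [_ hl]] := blip_unif (fun ij : 'I_N * 'I_N * 'I_N =>
  blip_dM chain alpha_ge0 rho0 ij.1.1 ij.1.2 ij.2).
have [Ck Ck0 [_ hk]] := blip_unif (fun ij : 'I_N * 'I_N =>
  blip_kernel chain alpha_ge0 rho0 ij.1 ij.2).
pose V := \sum_i \sum_j `|v i j 0|.
have V0 : 0 <= V by apply: sumr_ge0 => i _; apply: sumr_ge0.
have VCl : 0 <= V * Cl by rewrite mulr_ge0.
pose C := 1 + Cz + Cn + Cc + Cd + V * Cl + Ck.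
have C1 : 1 <= C by rewrite /C; lra.
have Cz_le : Cz <= C by rewrite /C; lra.
have Cn_le : Cn <= C by rewrite /C; lra.
have Cc_le : Cc <= C by rewrite /C; lra.
have Cd_le : Cd <= C by rewrite /C; lra.
have Cl_le : V * Cl <= C by rewrite /C; lra.
have Ck_le : Ck <= C by rewrite /C; lra.
clearbody C.
have K0 : 0 <= 32 * N%:R * C ^+ 3 by rewrite mulr_ge0 ?exprn_ge0 // (le_trans _ C1).
(* The last entry suffices for the quadratic smallness condition, because r^2 <= r when r <= 1. *)
pose r := Num.min (Num.min 1 (rho / 2)) (32 * N%:R * C ^+ 3 + 1)^-1.
have r0 : 0 < r by rewrite !lt_min ltr01 divr_gt0 //= invr_gt0 ltr_wpDl.
have r1 : r <= 1 by rewrite !ge_min lexx.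
have rr : r <= rho / 2 by rewrite !ge_min lexx orbT.
have rK : r <= (32 * N%:R * C ^+ 3 + 1)^-1 by rewrite ge_min lexx orbT.
pose S := \sum_(i < N) `|rate i|.
have S0 : 0 <= S by exact: sumr_ge0.
pose e := Num.min (Num.min 4^-1 (rho / 2)) (S + 1)^-1.
have e0 : 0 < e by rewrite !lt_min invr_gt0 ltr0n divr_gt0 //= invr_gt0 ltr_wpDl.
have [m1 _ hm1] := step_size_small a_gt e0.
exists r, C, m1; split.
  split=> //; rewrite expr2 mulrA; apply: (@le_trans _ _ (32 * N%:R * C ^+ 3 * r)).
    by rewrite ler_piMr // mulr_ge0 // ltW.
  apply: (@le_trans _ _ ((32 * N%:R * C ^+ 3 + 1) * (32 * N%:R * C ^+ 3 + 1)^-1)).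
    by apply: ler_pM => //; rewrite ?(ltW r0) // lerDl.
  by rewrite divff // gt_eqF // ltr_wpDl.
move=> m m1m.
have gs n : (m <= n)%N -> [/\ g n.+1 <= 4^-1, g n.+1 <= rho / 2 & g n.+1 <= (S + 1)^-1].
  move=> mn; have := hm1 n.+1 (leq_trans m1m (leqW mn)).
  by rewrite /= !le_min => /andP[/andP[-> ->] ->].
have gb p : good r m p -> in_ball mu (rho / 2) (xs p).
  move=> Gp; have /forallP h : in_ball mu r (xs p) by case: p Gp => [|j p] /andP[].
  by apply/forallP => i; exact: le_trans (h i) rr.
have gx p : good r m p -> box rho (xs p).
  by move=> /gb; exact: (half_ball_box chain rho0 rho_le).
have mb : box rho mu by exact: (mu_box chain rho0 rho_le).
split; split.
- by move=> n mn; have [h _ _] := gs n mn; lra.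
- move=> n i mn; have [_ _ h] := gs n mn.
  apply: (@le_trans _ _ ((S + 1) * (S + 1)^-1)); last by rewrite divff // gt_eqF // ltr_wpDl.
  apply: (@le_trans _ _ ((S + 1) * g n.+1)); last by rewrite ler_wpM2l // addr_ge0.
  rewrite ler_wpM2r //; apply: (le_trans (ler_norm _)).
  apply: (@le_trans _ _ S); last by rewrite lerDl.
  by rewrite /S (bigD1 i) //= lerDl sumr_ge0.
- move=> i iN p i' Gp; have [_ h _] := gs _ (good_size Gp).
  apply: (le_trans (hz i iN p i' (gb _ Gp) h)); rewrite ler_wpM2r //.
  by rewrite mulr_ge0 // addr_ge0 ?sqr_ge0.
- by move=> i p i' Gp; apply: le_trans (hn _ _ _ (gx _ Gp)) _.
- by move=> i p Gp; apply: le_trans (hc _ _ (gx _ Gp)) _.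
- move=> p Gp; apply: le_trans (hd _ (gx _ Gp)) _; rewrite ler_wpM2r //.
  by rewrite addr_ge0 ?sqr_ge0 //; apply: sumr_ge0 => i _; exact: sqr_ge0.
- move=> i p i' Gp.
  have -> : noise i p i' - vproj v i (dM mu (Xs p) i') =
      vproj v i (fun j => dM (xs p) (Xs p) i' j - dM mu (Xs p) i' j).
    by rewrite noiseE /vproj -sumrB; apply: eq_bigr => j _; rewrite -mulrBr.
  apply: (le_trans (vproj_le v i (b := Cl * `|xs p - mu|) _)).
    by move=> j; exact: (hl (_, _, _) _ _ (gx _ Gp) mb).
  rewrite mulrA ler_wpM2r //; apply: le_trans Cl_le; rewrite ler_wpM2r //.
  exact: vsum_le.
- move=> p i' Gp; rewrite -(kernel_mu alpha chain).
  apply: (le_trans (hk (_, i') _ _ (gx _ Gp) mb)).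
  by rewrite ler_wpM2r.
Qed.

Context (beta : nat -> R) (H : 'cV[R]_D -> 'I_N -> 'cV[R]_D) (theta0 : 'cV[R]_D).
Context (d : measure_display) (Omega : measurableType d) (Pr : probability Omega R).
Context (theta : nat -> Omega -> 'cV[R]_D) (x : nat -> Omega -> 'cV[R]_N).
Context (X : nat -> Omega -> 'I_N).
Hypothesis proc : sa_srrw P mu alpha beta (step_size a) H theta0 x0 i0 Pr theta x X.
Hypothesis x_compact : {ae Pr, forall w, exists2 C : set 'cV[R]_N,
  compact C /\ C `<=` @int_simplex R N & forall n, C (x n w)}.

Let k0 := pker_ge0 alpha chain i0 x0_simplex a_gt.
Let k1 := pker_sum1 alpha chain i0 x0_simplex a_gt.

(** The exit probability is made small relative to K, which is possible because K does not depend on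
    m. *)
Lemma charfn_cvg (t : 'cV[R]_N) (phi e : R) (tau := fun i => \sum_j t j 0 * u i j 0) :
  0 < e -> \forall n \near \oo,
  `|Ex pker n (fun p => cos ((\sum_j t j 0 * (xs p j 0 - mu j 0)) / Num.sqrt (g n) + phi)) -
     cos phi * expR (- (clt_var lambda alpha a tau / 2))| <= e.
Proof.
move=> e0; have [r [C [m1 [[C1 r0 r1 rs] hm]]]] := linear_regime.
pose K := 2 + 4 * clt_const lambda alpha a C tau * clt_bound lambda alpha a C tau.
have K0 : 0 <= K.
  have h1 := clt_bound_ge0 a spec alpha_ge0 C tau.
  have h2 := clt_const_ge0 a spec alpha_ge0 C tau.
  by rewrite /K addr_ge0 // mulr_ge0 // mulr_ge0.
have d0 : 0 < e / 2 / (K + 1) by rewrite !divr_gt0 // ltr_wpDl.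
have [m0 hm0] := good_probability chain alpha_ge0 x0_simplex a_gt a_le1 proc x_compact r0 d0.
have [[h1 h2 h3 h4] [h5 h6 h7 h8]] := hm (maxn m0 m1) (leq_maxr _ _).
have e2 : 0 < e / 2 by rewrite divr_gt0.
have := clt_charfn chain spec alpha_ge0 x0_simplex a_gt a_le1 C1 (ltW r0) r1 rs h1 h2 h3 h4 h5 h6 h7 h8
  t phi (fun n => hm0 _ n (leq_maxl m0 m1)) e2.
apply: filterS => n; rewrite -/tau -/K => h; apply: (le_trans h).
have : K * (e / 2 / (K + 1)) <= e / 2.
  rewrite mulrA ler_pdivrMr ?ltr_wpDl //; rewrite mulrC ler_wpM2l ?(ltW e2) //.
  by rewrite lerDl.
lra.
Qed.

(** Chebyshev's inequality with the second moment bound O(g n) on the good event, plus the exit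
    probability. *)
Lemma path_tight (e : R) : 0 < e -> exists2 L : R, 0 < L & \forall n \near \oo,
  Ex pker n (fun p => (L * Num.sqrt (g n) < `|xs p - mu|)%R%:R) <= e.
Proof.
move=> e0; have [r [C [m1 [[C1 r0 r1 rs] hm]]]] := linear_regime.
have e2 : 0 < e / 2 by rewrite divr_gt0.
have [m0 hm0] := good_probability chain alpha_ge0 x0_simplex a_gt a_le1 proc x_compact r0 e2.
pose m := maxn m0 m1.
have [[h1 h2 h3 h4] [h5 h6 h7 h8]] := hm m (leq_maxr _ _).
have [B B0 hB] := dist_bound chain spec alpha_ge0 x0_simplex a_gt a_le1 C1 (ltW r0) r1 rs h1 h2 h3 h4 h6.
have L2 : 0 < (B + 1) / (e / 2) by rewrite divr_gt0 // ltr_wpDl.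
exists (Num.sqrt ((B + 1) / (e / 2))); first by rewrite sqrtr_gt0.
exists m => // n /= mn; have gn := step_size_gt0 a n.
set L := Num.sqrt _; have LE : L ^+ 2 = (B + 1) / (e / 2) by rewrite sqr_sqrtr // ltW.
have Lg0 : 0 < L ^+ 2 * g n by rewrite LE mulr_gt0.
apply: (@le_trans _ _ (Ex pker n (fun p =>
   (L ^+ 2 * g n)^-1 * (`|xs p - mu| ^+ 2 * (good r m p)%:R) + (~~ good r m p)%:R))).
  apply: (Ex_le k0) => p _; case: (good r m p) => /=; rewrite ?mulr1 ?mulr0 ?addr0 ?add0r.
    case: ltP => [h|_]; last by rewrite mulr_ge0 ?sqr_ge0 // invr_ge0 ltW.
    rewrite mulrC ler_pdivlMr // mul1r -[g n]sqr_sqrtr ?ltW // -exprMn.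
    by rewrite ltr_sqr ?nnegrE ?mulr_ge0 ?sqrtr_ge0.
  by case: (_ < _)%R.
rewrite (ExD k0) (ExZ k0).
have := hm0 m n (leq_maxl _ _) mn; have := hB n mn.
set E1 := Ex _ _ _ => hE1 hE2.
have : (L ^+ 2 * g n)^-1 * E1 <= e / 2.
  rewrite mulrC ler_pdivrMr // LE mulrA mulrCA divff ?mulr1 ?gt_eqF //.
  by apply: (le_trans hE1); rewrite ler_wpM2r // lerDl.
by rewrite -/m in hE2 *; lra.
Qed.

End CharFnLimit.

(** * Convergence in law from characteristic functions *)

Section TrigApprox.
Context (R : realType) (N : nat).

(** Only [s] is confined to the cube: [x] may lie slightly outside, as needed for a modulus around
    each point. *)
Lemma unif_continuous_cube (F : 'cV[R]_N -> R) (eta : R) : continuous F -> 0 < eta ->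
  exists2 delta : R, 0 < delta & forall s x : 'cV[R]_N, (forall i, `|s i 0| <= 1) ->
    (forall i, `|x i 0 - s i 0| < delta) -> `|F x - F s| <= eta.
Proof.
move=> cF eta0.
pose A : set 'rV[R]_N := [set v | forall i, (`[-1, 1]%classic : set R) (v ord0 i)].
have cA : compact A by apply: (@rV_compact _ _ (fun=> `[(-1 : R), 1]%classic)) => _; exact: segment_compact.
pose P (dl : R) (v : 'rV[R]_N) := forall x : 'cV[R]_N, (forall i, `|x i 0 - v ord0 i| < dl) ->
  `|F x - F v^T| <= eta.
have e2 : 0 < eta / 2 by rewrite divr_gt0.
have [dl [dl0 hdl]] : exists dl : R, 0 < dl /\ A `<=` P dl.
  have /compact_near_coveringP/(_ R (0^'+) P) := cA.
  move=> cov; suff cov' : \forall dl \near 0^'+, A `<=` P dl.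
    near (0 : R)^'+ => dl; exists dl; split; first by [].
    by near: dl; exact: cov'.
  apply: cov => v Av.
  have /cvgrPdist_lt/(_ _ e2)/nbhs_ballP[r /= r0 hr] := cF v^T.
  have r4 : 0 < r / 4 by rewrite divr_gt0.
  have key (z : 'cV[R]_N) : (forall i, `|v ord0 i - z i 0| <= r / 4 + r / 4) -> `|F v^T - F z| < eta / 2.
    move=> h; apply: hr; rewrite -ball_normE /=.
    apply: (@le_lt_trans _ _ (r / 4 + r / 4)); last by lra.
    by apply: cV_norm_le => [|i]; [rewrite addr_ge0 // ltW|rewrite !mxE].
  exists ([set v' | `|v - v'| < r / 4], [set dl | dl < r / 4]) => /=.
    split; first by apply/nbhs_ballP; exists (r / 4) => //= v'; rewrite -ball_normE.
    exact: nbhs_right_lt.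
  move=> [v' dl] /= [vv' dlr] x hx.
  have vi i : `|v ord0 i - v' ord0 i| <= r / 4.
    apply: le_trans (ltW vv'); rewrite [leRHS]/Num.norm /= mx_normrE.
    by apply/bigmax_geP; right => /=; exists (ord0, i) => //; rewrite !mxE.
  have h1 : `|F v^T - F v'^T| < eta / 2.
    by apply: key => i; rewrite mxE (le_trans (vi i)) // lerDl ltW.
  have h2 : `|F v^T - F x| < eta / 2.
    apply: key => i; rewrite -(subrKA (v' ord0 i)); apply: (le_trans (ler_normD _ _)).
    by apply: lerD => //; rewrite distrC (le_trans (ltW (hx i))) // ltW.
  rewrite -(subrKA (F v^T)); apply: (le_trans (ler_normD _ _)).
  by rewrite [`|F x - _|]distrC [leRHS]splitr; apply: lerD; exact: ltW.
exists dl => // s x hs hx; rewrite -[s]trmxK; apply: hdl.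
  by move=> i /=; rewrite in_itv /= mxE -ler_norml.
by move=> i; rewrite mxE.
Unshelve. all: by end_near. Qed.

Definition dot (t y : 'cV[R]_N) : R := \sum_j t j 0 * y j 0.

Lemma dotDl s t y : dot (s + t) y = dot s y + dot t y.
Proof. by rewrite /dot -big_split; apply: eq_bigr => j _; rewrite !mxE mulrDl. Qed.

Lemma dotBl s t y : dot (s - t) y = dot s y - dot t y.
Proof. by rewrite /dot -sumrB; apply: eq_bigr => j _; rewrite !mxE mulrBl. Qed.

Lemma dot0l y : dot 0 y = 0.
Proof. by rewrite /dot big1 // => j _; rewrite mxE mul0r. Qed.

Definition trig_poly (T : 'cV[R]_N -> R) := exists s : seq (R * 'cV[R]_N * R),
  forall y, T y = \sum_(q <- s) q.1.1 * cos (dot q.1.2 y + q.2).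

Lemma trig_ext T T' : T =1 T' -> trig_poly T -> trig_poly T'.
Proof. by move=> TT' [s hs]; exists s => y; rewrite -TT'. Qed.

Lemma trig_cos c t phi : trig_poly (fun y => c * cos (dot t y + phi)).
Proof. by exists [:: (c, t, phi)] => y; rewrite big_seq1. Qed.

Lemma trig_cst c : trig_poly (fun=> c).
Proof.
by apply: trig_ext (trig_cos c 0 0) => y; rewrite dot0l addr0 cos0 mulr1.
Qed.

Lemma trig_add T T' : trig_poly T -> trig_poly T' -> trig_poly (fun y => T y + T' y).
Proof. by move=> [s hs] [s' hs']; exists (s ++ s') => y; rewrite big_cat hs hs'. Qed.

Lemma trig_sum (I : Type) (r : seq I) (T : I -> 'cV[R]_N -> R) :
  (forall i, trig_poly (T i)) -> trig_poly (fun y => \sum_(i <- r) T i y).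
Proof.
move=> hT; elim: r => [|i r IHr].
  by apply: trig_ext (trig_cst 0) => y; rewrite big_nil.
by apply: trig_ext (trig_add (hT i) IHr) => y; rewrite big_cons.
Qed.

Lemma cos_mul_cos (a b : R) : cos a * cos b = 2^-1 * cos (a + b) + 2^-1 * cos (a - b).
Proof. by rewrite cosD cosB; field. Qed.

Lemma trig_mul T T' : trig_poly T -> trig_poly T' -> trig_poly (fun y => T y * T' y).
Proof.
move=> [s hs] [s' hs'].
have h : trig_poly (fun y => \sum_(q <- s) \sum_(q' <- s')
    (q.1.1 * cos (dot q.1.2 y + q.2)) * (q'.1.1 * cos (dot q'.1.2 y + q'.2))).
  apply: trig_sum => q; apply: trig_sum => q'.
  apply: trig_ext (trig_add (trig_cos (q.1.1 * q'.1.1 * 2^-1) (q.1.2 + q'.1.2) (q.2 + q'.2))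
    (trig_cos (q.1.1 * q'.1.1 * 2^-1) (q.1.2 - q'.1.2) (q.2 - q'.2))) => y.
  have := cos_mul_cos (dot q.1.2 y + q.2) (dot q'.1.2 y + q'.2).
  rewrite dotDl dotBl.
  have -> : dot q.1.2 y + q.2 - (dot q'.1.2 y + q'.2) = dot q.1.2 y - dot q'.1.2 y + (q.2 - q'.2) by ring.
  have -> : dot q.1.2 y + q.2 + (dot q'.1.2 y + q'.2) = dot q.1.2 y + dot q'.1.2 y + (q.2 + q'.2) by ring.
  by move=> E; rewrite mulrACA E; ring.
apply: trig_ext h => y; rewrite hs hs' mulr_suml; apply: eq_bigr => q _.
by rewrite mulr_sumr.
Qed.

Lemma trig_prod (I : Type) (r : seq I) (T : I -> 'cV[R]_N -> R) :
  (forall i, trig_poly (T i)) -> trig_poly (fun y => \prod_(i <- r) T i y).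
Proof.
move=> hT; elim: r => [|i r IHr].
  by apply: trig_ext (trig_cst 1) => y; rewrite big_nil.
by apply: trig_ext (trig_mul (hT i) IHr) => y; rewrite big_cons.
Qed.

Lemma trig_sin i (L : R) : trig_poly (fun y => sin (y i 0 / L)).
Proof.
apply: trig_ext (trig_cos 1 (L^-1 *: delta_mx i 0) (- (pi / 2))) => y.
rewrite mul1r cosBpihalf; congr (sin _).
rewrite /dot (bigD1 i) //= big1 => [|j ji]; last by rewrite !mxE (negbTE ji) mulr0 mul0r.
by rewrite !mxE !eqxx mulr1 addr0 mulrC.
Qed.

(** An expectation over finitely many steps is polynomial in the transition probabilities, and
    trigonometric polynomials form an algebra. *)
Lemma trig_Ex (S : finType) (k : 'cV[R]_N -> seq S -> S -> R) m (f : 'cV[R]_N -> seq S -> R) :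
  (forall p j, trig_poly (fun y => k y p j)) -> (forall p, trig_poly (fun y => f y p)) ->
  trig_poly (fun y => Ex (k y) m (f y)).
Proof.
move=> hk; elim: m f => [|m IHm] f hf //=; apply: IHm => p.
by apply: trig_sum => j; apply: trig_mul.
Qed.

Local Notation coins := {ffun 'I_N -> bool}.

Definition coin_sgn (b : bool) : R := if b then 1 else -1.

Definition coin_kernel (s : 'cV[R]_N) (p : seq coins) (c : coins) : R :=
  \prod_i ((1 + coin_sgn (c i) * s i 0) / 2).

Definition coin_mean m (p : seq coins) : 'cV[R]_N :=
  \col_i (psum (fun _ (c : coins) => coin_sgn (c i)) p / m%:R).

(* The Bernstein polynomial as a mean over [m] independent draws of signs of
   mean [s]. *)
Definition bernstein (F : 'cV[R]_N -> R) m (s : 'cV[R]_N) : R :=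
  Ex (coin_kernel s) m (fun p => F (coin_mean m p)).

Lemma trig_bernstein F m (L : R) :
  trig_poly (fun y => bernstein F m (\col_i sin (y i 0 / L))).
Proof.
apply: trig_Ex => p; last exact: trig_cst.
move=> c; apply: trig_prod => i.
apply: trig_mul; last exact: trig_cst.
apply: trig_add; first exact: trig_cst.
apply: trig_mul; first exact: trig_cst.
by apply: trig_ext (trig_sin i L) => y; rewrite mxE.
Qed.

Section Coins.
Variable s : 'cV[R]_N.
Hypothesis s_le1 : forall i, `|s i 0| <= 1.

Lemma coin_kernel_ge0 p c : 0 <= coin_kernel s p c.
Proof.
apply: prodr_ge0 => i _; rewrite divr_ge0 //.
by have := s_le1 i; rewrite ler_norml /coin_sgn; case: (c i); lra.
Qed.

Lemma coin_marginal i0 (h : bool -> R) p : \sum_c coin_kernel s p c * h (c i0) =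
  (1 + s i0 0) / 2 * h true + (1 - s i0 0) / 2 * h false.
Proof.
pose F i b := (1 + coin_sgn b * s i 0) / 2 * (if i == i0 then h b else 1).
transitivity (\sum_(c : coins) \prod_i F i (c i)).
  apply: eq_bigr => c _; rewrite /F big_split /=; congr (_ * _).
  by rewrite (bigD1 i0) //= eqxx big1 ?mulr1 // => i /negbTE ->.
rewrite -bigA_distr_bigA (bigD1 i0) //= [X in _ * X]big1 ?mulr1.
  by rewrite big_bool /= /F eqxx /coin_sgn; field.
by move=> i /negbTE ii0; rewrite big_bool /= /F ii0 /coin_sgn; field.
Qed.

Lemma coin_kernel_sum1 p : \sum_c coin_kernel s p c = 1.
Proof.
rewrite /coin_kernel -(bigA_distr_bigA (fun i b => (1 + coin_sgn b * s i 0) / 2)) big1 // => i _.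
by rewrite big_bool /= /coin_sgn; field.
Qed.

(** The empirical mean of m independent signs of mean s_i has variance (1 - s_i^2) / m; the
    orthogonality of martingale increments is reused. *)
Lemma coin_mean_sqr i m : (0 < m)%N ->
  Ex (coin_kernel s) m (fun p => (coin_mean m p i 0 - s i 0) ^+ 2) <= m%:R^-1.
Proof.
move=> m0; have mR : m%:R != 0 :> R by rewrite pnatr_eq0 -lt0n.
pose xi (p : seq coins) (c : coins) := coin_sgn (c i) - s i 0.
have -> : Ex (coin_kernel s) m (fun p => (coin_mean m p i 0 - s i 0) ^+ 2) =
    m%:R^-2 * Ex (coin_kernel s) m (fun p => psum xi p ^+ 2).
  rewrite -(ExZ coin_kernel_ge0); apply: (Ex_ext coin_kernel_ge0) => p sp.
  have -> : psum xi p = psum (fun _ (c : coins) => coin_sgn (c i)) p - (size p)%:R * s i 0.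
    elim: (p) => [|c q IH] /=; first by rewrite mul0r subrr.
    by rewrite IH /xi -natr1; ring.
  by rewrite mxE sp; field.
have h : Ex (coin_kernel s) m (fun p => psum xi p ^+ 2) <= \sum_(l < m) 1.
  apply: (Ex_psum_sqr coin_kernel_ge0 coin_kernel_sum1 (c := fun=> 1)) => p _.
    by rewrite (coin_marginal i (fun b => coin_sgn b - s i 0)) /coin_sgn; field.
  rewrite (coin_marginal i (fun b => (coin_sgn b - s i 0) ^+ 2)) /coin_sgn.
  have := sqr_ge0 (s i 0).
  have -> : (1 + s i 0) / 2 * (1 - s i 0) ^+ 2 + (1 - s i 0) / 2 * (-1 - s i 0) ^+ 2 =
     1 - s i 0 ^+ 2 by field.
  by lra.
rewrite sumr_const card_ord in h.
rewrite [leRHS](_ : _ = m%:R^-2 * m%:R); last by field.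
by rewrite ler_wpM2l // invr_ge0 exprn_ge0.
Qed.

Lemma bernstein_le F M m : (forall x, `|F x| <= M) -> `|bernstein F m s| <= M.
Proof.
move=> hF; apply: (le_trans (Ex_norm coin_kernel_ge0 _ _)).
by apply: (Ex_le_cst coin_kernel_ge0 coin_kernel_sum1).
Qed.

(** Bernstein's argument: the modulus of continuity when the mean is close to s, and Chebyshev's
    inequality with the bound 2 M otherwise. *)
Lemma bernstein_dist F M eta delta m : (0 < m)%N -> (forall x, `|F x| <= M) -> 0 <= eta -> 0 < delta ->
  (forall x : 'cV[R]_N, (forall i, `|x i 0 - s i 0| < delta) -> `|F x - F s| <= eta) ->
  `|bernstein F m s - F s| <= eta + 2 * M * N%:R * delta ^- 2 * m%:R^-1.
Proof.
move=> m0 hF eta0 d0 mod.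
have k0 := coin_kernel_ge0; have k1 := coin_kernel_sum1.
have M0 : 0 <= M by exact: le_trans (normr_ge0 _) (hF 0).
have V0 : 0 <= delta ^- 2 by rewrite invr_ge0 exprn_ge0 // ltW.
rewrite -(Ex_cst k0 k1 m (F s)) -(ExB k0).
apply: (le_trans (Ex_norm k0 _ _)).
apply: (@le_trans _ _ (Ex (coin_kernel s) m (fun p => eta + 2 * M * delta ^- 2 *
    \sum_i (coin_mean m p i 0 - s i 0) ^+ 2))).
  apply: (Ex_le k0) => p _; set x := coin_mean m p.
  have S0 : 0 <= \sum_i (x i 0 - s i 0) ^+ 2 by apply: sumr_ge0 => i _; exact: sqr_ge0.
  have MS0 : 0 <= 2 * M * delta ^- 2 * \sum_i (x i 0 - s i 0) ^+ 2 by rewrite !mulr_ge0.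
  have [/forallP h|] := boolP [forall i, `|x i 0 - s i 0| < delta].
    by apply: (le_trans (mod x h)); rewrite lerDl.
  rewrite negb_forall => /existsP[i]; rewrite -leNgt => hi.
  have h1 : `|F x - F s| <= 2 * M.
    by apply: (le_trans (ler_normB _ _)); rewrite mulr_natl mulr2n lerD.
  apply: (le_trans h1); rewrite -[leLHS]add0r; apply: lerD => //.
  rewrite -mulrA ler_peMr ?mulr_ge0 // mulrC ler_pdivlMr ?exprn_gt0 // mul1r.
  apply: (@le_trans _ _ ((x i 0 - s i 0) ^+ 2)).
    by rewrite -(real_normK (num_real (x i 0 - s i 0))) ler_sqr ?nnegrE // ltW.
  by rewrite (bigD1 i) //= lerDl; apply: sumr_ge0 => j _; exact: sqr_ge0.
rewrite (ExD k0) (Ex_cst k0 k1) (ExZ k0) lerD2l (Ex_sum k0 k1).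
rewrite [leRHS](_ : _ = 2 * M * delta ^- 2 * (N%:R * m%:R^-1)); last by ring.
rewrite ler_wpM2l ?mulr_ge0 //.
apply: (@le_trans _ _ (\sum_(i < N) m%:R^-1)).
  by apply: ler_sum => i _; exact: coin_mean_sqr.
by rewrite sumr_const card_ord mulr_natl.
Qed.

End Coins.

(* A truncation with values in the open interval on which sin inverts asin. *)
Definition clip (x : R) : R := (`|x + 2^-1| - `|x - 2^-1|) / 2.

Lemma clip_bound x : -1 < clip x < 1.
Proof.
have := ler_normB (x + 2^-1) (x - 2^-1); have := ler_dist_dist (x + 2^-1) (x - 2^-1).
have -> : x + 2^-1 - (x - 2^-1) = 1 by field.
by rewrite normr1 ler_norml /clip => /andP[h1 h2] _; apply/andP; split; lra.
Qed.

Lemma clip_id x : `|x| <= 2^-1 -> clip x = x.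
Proof.
by rewrite ler_norml => /andP[h1 h2]; rewrite /clip ger0_norm ?ler0_norm; try lra; field.
Qed.

Lemma continuous_clip : continuous clip.
Proof.
move=> x; apply: cvgM; last exact: cvg_cst.
by apply: cvgB; apply: cvg_norm; apply: cvgD; [|exact: cvg_cst| |exact: cvg_cst]; exact: cvg_id.
Qed.

Lemma continuous_col (h : R -> R) : continuous h ->
  continuous (fun x : 'cV[R]_N => \col_i h (x i 0)).
Proof.
move=> ch x; apply/(@cvgrPdist_le R 'cV[R]_N _ (nbhs x)) => e e0.
have : nbhs x (fun y : 'cV[R]_N => forall i : 'I_N, `|h (x i 0) - h (y i 0)| <= e).
  have Fx : Filter (nbhs (x : 'cV[R]_N)) := nbhs_filter _.
  apply: (@filter_forall _ _ (fun i (y : 'cV[R]_N) => `|h (x i 0) - h (y i 0)| <= e) _ Fx) => i.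
  have ci : continuous (fun y : 'cV[R]_N => h (y i 0)).
    by move=> y; apply: (@continuous_comp _ _ _ (fun y : 'cV[R]_N => y i 0) h); [exact: coord_continuous|exact: ch].
  by have /cvgrPdist_le := ci x; apply.
apply: filterS => y hy; apply: cV_norm_le => [|i]; first exact: ltW.
by rewrite !mxE.
Qed.

(** In the variables sin (y_i / (2 K)) the function becomes continuous on the cube, where Bernstein
    polynomials approximate it. Being averages of values of f, they keep the bound M everywhere,
    which controls the tails. *)
Lemma trig_approx (f : 'cV[R]_N -> R) (M K e : R) : continuous f ->
  (forall y, `|f y| <= M) -> 0 < K -> 0 < e -> exists T, [/\ trig_poly T,
    forall y, `|T y| <= M & forall y : 'cV[R]_N, (forall i, `|y i 0| <= K) -> `|f y - T y| <= e].
Proof.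
move=> cf fM K0 e0.
(* The scale 2 K puts the angle y_i / (2 K) into [-1/2, 1/2], where both [clip] and asin after sin
   are harmless. *)
pose h x : R := 2 * K * asin (clip x).
have ch : continuous h.
  move=> x; apply: cvgM; first exact: cvg_cst.
  apply: (@continuous_comp _ _ _ clip asin); first exact: continuous_clip.
  by apply: continuous_asin; exact: clip_bound.
pose F (x : 'cV[R]_N) := f (\col_i h (x i 0)).
have cF : continuous F.
  by move=> x; apply: (@continuous_comp _ _ _ (fun x : 'cV[R]_N => \col_i h (x i 0)) f);
    [exact: continuous_col|exact: cf].
have FM x : `|F x| <= M by exact: fM.
have M0 : 0 <= M by exact: le_trans (normr_ge0 _) (fM 0).
have e2 : 0 < e / 2 by rewrite divr_gt0.
have [dl dl0 hdl] := unif_continuous_cube cF e2.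
pose B := 2 * M * N%:R * dl ^- 2.
have B0 : 0 <= B by rewrite !mulr_ge0 // invr_ge0 exprn_ge0 // ltW.
have [m m0 hm] : exists2 m : nat, (0 < m)%N & B * m%:R^-1 <= e / 2.
  exists (Num.bound (B / (e / 2))).+1 => //.
  rewrite ler_pdivrMr // mulrC -ler_pdivrMr //.
  have := archi_boundP (divr_ge0 B0 (ltW e2)) => /ltW h1; apply: (le_trans h1).
  by rewrite ler_nat.
pose s (y : 'cV[R]_N) : 'cV[R]_N := \col_i sin (y i 0 / (2 * K)).
have s1 y i : `|s y i 0| <= 1 by rewrite mxE sin_max.
exists (fun y => bernstein F m (s y)); split; first exact: trig_bernstein.
  by move=> y; apply: bernstein_le.
move=> y hy.
have yK i : `|y i 0 / (2 * K)| <= 2^-1.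
  rewrite normrM [X in _ * X]ger0_norm ?invr_ge0 ?mulr_ge0 ?(ltW K0) //.
  by rewrite ler_pdivrMr ?mulr_gt0 // mulrA mulVf // mul1r.
have -> : f y = F (s y).
  rewrite /F; congr f; apply/colP => i; rewrite !mxE /h clip_id; last first.
    exact: le_trans (norm_sin_le _) (yK i).
  rewrite sinK; first by field; rewrite gt_eqF.
  have := yK i; rewrite in_itv /= -ler_norml => /le_trans; apply.
  by apply: le_trans (pihalf_ge1 R); lra.
rewrite distrC; apply: (le_trans (bernstein_dist (s1 y) m0 FM (ltW e2) dl0 _)).
  by move=> x hx; apply: hdl.
by rewrite [leRHS]splitr lerD2l.
Qed.

End TrigApprox.

Section ContinuousFunctions.
Context (R : realType) (X : topologicalType).
Implicit Types f g : X -> R.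

Lemma cont_cst (c : R) : continuous (fun _ : X => c).
Proof. exact: cst_continuous. Qed.

Lemma contD f g : continuous f -> continuous g -> continuous (fun z => f z + g z).
Proof. by move=> cf cg z; apply: cvgD; [exact: cf|exact: cg]. Qed.

Lemma contM f g : continuous f -> continuous g -> continuous (fun z => f z * g z).
Proof. by move=> cf cg z; apply: cvgM; [exact: cf|exact: cg]. Qed.

Lemma cont_comp (h : R -> R) f : continuous h -> continuous f -> continuous (fun z => h (f z)).
Proof. by move=> ch cf z; apply: (@continuous_comp _ _ _ f h); [exact: cf|exact: ch]. Qed.

Lemma cont_sum (I : Type) (r : seq I) (f : I -> X -> R) :
  (forall i, continuous (f i)) -> continuous (fun z => \sum_(i <- r) f i z).
Proof.
move=> cf; elim: r => [|i r IH].
  rewrite (_ : (fun z => _) = fun=> 0); first exact: cont_cst.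
  by apply/funext => z; rewrite big_nil.
rewrite (_ : (fun z => _) = fun z => f i z + \sum_(j <- r) f j z); first exact: contD.
by apply/funext => z; rewrite big_cons.
Qed.

End ContinuousFunctions.

Lemma cvg_seq_sum (R : realType) (I : Type) (s : seq I) (u : I -> nat -> R) (l : I -> R) :
  (forall i, u i n @[n --> \oo] --> l i) ->
  \sum_(i <- s) u i n @[n --> \oo] --> \sum_(i <- s) l i.
Proof.
move=> h; elim: s => [|i s IH].
  rewrite big_nil (_ : (fun n => _) = fun=> 0); first exact: cvg_cst.
  by apply/funext => n; rewrite big_nil.
rewrite big_cons (_ : (fun n => _) = fun n => u i n + \sum_(j <- s) u j n); first exact: cvgD.
by apply/funext => n; rewrite big_cons.
Qed.

(** * Lévy continuity for means of bounded continuous functions *)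

Section WeakConvergence.
Context (R : realType) (N : nat).
Implicit Types (f T : 'cV[R]_N -> R) (L : ('cV[R]_N -> R) -> R).

Definition bcont f := continuous f /\ exists M : R, forall z, `|f z| <= M.

Record mean L : Prop := Mean {
  meanD : forall f g, bcont f -> bcont g -> L (fun z => f z + g z) = L f + L g;
  meanZ : forall (c : R) f, bcont f -> L (fun z => c * f z) = c * L f;
  mean_le : forall f g, bcont f -> bcont g -> (forall z, f z <= g z) -> L f <= L g;
  mean1 : L (fun=> 1) = 1 }.

Lemma bcont_cst (c : R) : bcont (fun=> c).
Proof. by split; [exact: cst_continuous|exists `|c|]. Qed.

Lemma bcontD f g : bcont f -> bcont g -> bcont (fun z => f z + g z).
Proof.
move=> [cf [A hA]] [cg [B hB]]; split; first exact: contD.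
by exists (A + B) => z; apply: (le_trans (ler_normD _ _)); exact: lerD.
Qed.

Lemma bcontZ (c : R) f : bcont f -> bcont (fun z => c * f z).
Proof.
move=> [cf [A hA]]; split; first exact: contM (@cont_cst _ _ c) cf.
by exists (`|c| * A) => z; rewrite normrM ler_wpM2l.
Qed.

Lemma continuous_dot (t : 'cV[R]_N) : continuous (dot t).
Proof.
by apply: cont_sum => j; apply: contM; [exact: cont_cst|exact: coord_continuous].
Qed.

Lemma bcont_cos (t : 'cV[R]_N) (phi : R) : bcont (fun z => cos (dot t z + phi)).
Proof.
split; last by exists 1 => z; exact: cos_max.
apply: cont_comp; first exact: continuous_cos.
by apply: contD; [exact: continuous_dot|exact: cont_cst].
Qed.

Lemma mean_trig L (s : seq (R * 'cV[R]_N * R)) : mean L ->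
  bcont (fun y => \sum_(q <- s) q.1.1 * cos (dot q.1.2 y + q.2)) /\
  L (fun y => \sum_(q <- s) q.1.1 * cos (dot q.1.2 y + q.2)) =
  \sum_(q <- s) q.1.1 * L (fun y => cos (dot q.1.2 y + q.2)).
Proof.
move=> mL; elim: s => [|q s [IH1 IH2]].
  have -> : (fun y : 'cV[R]_N => \sum_(q <- [::]) q.1.1 * cos (dot q.1.2 y + q.2)) = (fun=> 0 * 1) :> ('cV[R]_N -> R).
    by apply/funext => y; rewrite big_nil mul0r.
  by split; [exact: bcont_cst|rewrite (meanZ mL) ?mul0r ?big_nil //; exact: bcont_cst].
have -> : (fun y : 'cV[R]_N => \sum_(q <- q :: s) q.1.1 * cos (dot q.1.2 y + q.2)) =
    (fun y => q.1.1 * cos (dot q.1.2 y + q.2) + \sum_(q <- s) q.1.1 * cos (dot q.1.2 y + q.2)).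
  by apply/funext => y; rewrite big_cons.
have bc := bcontZ q.1.1 (bcont_cos q.1.2 q.2).
split; first exact: bcontD.
by rewrite (meanD mL) // (meanZ mL) ?IH2 ?big_cons //; exact: bcont_cos.
Qed.

Lemma clip_half (x : R) : 0 <= clip x + 2^-1 <= 1.
Proof.
have := ler_dist_dist (x + 2^-1) (x - 2^-1).
have -> : x + 2^-1 - (x - 2^-1) = 1 by field.
by rewrite normr1 ler_norml /clip => /andP[h1 h2]; apply/andP; split; lra.
Qed.

Lemma clip_ge (x : R) : 2^-1 <= x -> clip x + 2^-1 = 1.
Proof. by move=> h; rewrite /clip !ger0_norm; [field|lra|lra]. Qed.

Lemma clip_le (x : R) : x <= - 2^-1 -> clip x + 2^-1 = 0.
Proof. by move=> h; rewrite /clip !ler0_norm; [field|lra|lra]. Qed.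

(** A continuous ramp from 0 on the ball of radius K to 1 outside radius 2 K, so that tightness is
    expressed by means of bounded continuous functions. *)
Definition cutoff (K : R) (z : 'cV[R]_N) : R := clip (`|z| / K - 3 / 2) + 2^-1.

Lemma cutoff_bcont K : bcont (cutoff K).
Proof.
split; last by exists 1 => z; rewrite ger0_norm; case/andP: (clip_half (`|z| / K - 3 / 2)).
apply: contD; last exact: cont_cst.
apply: cont_comp; first exact: continuous_clip.
apply: contD; last exact: cont_cst.
apply: contM; last exact: cont_cst.
exact: (@norm_continuous _ 'cV[R]_N).
Qed.

Lemma cutoff_ge0 K z : 0 <= cutoff K z.
Proof. by case/andP: (clip_half (`|z| / K - 3 / 2)). Qed.

Lemma cutoff_eq1 K z : 0 < K -> 2 * K <= `|z| -> cutoff K z = 1.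
Proof.
move=> K0 h; apply: clip_ge; have : 2 <= `|z| / K by rewrite ler_pdivlMr.
lra.
Qed.

Lemma cutoff_eq0 K z : 0 < K -> `|z| <= K -> cutoff K z = 0.
Proof.
move=> K0 h; apply: clip_le; have : `|z| / K <= 1 by rewrite ler_pdivrMr // mul1r.
lra.
Qed.

Lemma mean_dist L f T (e B : R) (K : R) : mean L -> bcont f -> bcont T ->
  (forall z, `|f z - T z| <= e + B * cutoff K z) ->
  `|L f - L T| <= e + B * L (cutoff K).
Proof.
move=> mL bf bT h.
have bc := cutoff_bcont K; have b1 := bcont_cst 1.
have hE : L (fun z => e * 1 + B * cutoff K z) = e + B * L (cutoff K).
  by rewrite (meanD mL (bcontZ e b1) (bcontZ B bc)) (meanZ mL _ b1) (meanZ mL _ bc) (mean1 mL) mulr1.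
have bE : bcont (fun z => e * 1 + B * cutoff K z) by apply: bcontD; exact: bcontZ.
have h1 f1 f2 : bcont f1 -> bcont f2 -> (forall z, f1 z <= f2 z + (e * 1 + B * cutoff K z)) ->
    L f1 <= L f2 + (e + B * L (cutoff K)).
  move=> b1' b2 h12; rewrite -hE -(meanD mL) //; apply: (mean_le mL) => //.
  exact: bcontD.
have l1 : L f <= L T + (e + B * L (cutoff K)).
  by apply: h1 => // z; have := h z; rewrite ler_norml mulr1 => /andP[]; lra.
have l2 : L T <= L f + (e + B * L (cutoff K)).
  by apply: h1 => // z; have := h z; rewrite ler_norml mulr1 => /andP[]; lra.
by rewrite ler_norml; apply/andP; split; lra.
Qed.

Lemma coord_le_norm (z : 'cV[R]_N) i : `|z i 0| <= `|z|.
Proof.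
rewrite [leRHS]/Num.norm /= mx_normrE; apply/bigmax_geP; right => /=.
by exists (i, 0).
Qed.

(** Replace f by a trigonometric polynomial T, uniformly close on a large cube and bounded by M
    outside. The five parts of e are two for each passage between f and T and one for the
    convergence of the means of T. *)
Lemma levy_continuity (Ln : nat -> ('cV[R]_N -> R) -> R) L :
  (forall n, mean (Ln n)) -> mean L ->
  (forall e : R, 0 < e -> exists2 K : R, 0 < K & \forall n \near \oo, Ln n (cutoff K) <= e) ->
  (forall e : R, 0 < e -> exists2 K : R, 0 < K & L (cutoff K) <= e) ->
  (forall t phi, Ln n (fun z => cos (dot t z + phi)) @[n --> \oo] --> L (fun z => cos (dot t z + phi))) ->
  forall f, bcont f -> Ln n f @[n --> \oo] --> L f.
Proof.
move=> mLn mL tn tL ch f bf.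
have [cf [M0 hM0]] := bf; pose M := M0 + 1.
have M0_ge0 : 0 <= M0 by exact: le_trans (normr_ge0 _) (hM0 0).
have M_gt0 : 0 < M by rewrite ltr_wpDl.
have fM z : `|f z| <= M by rewrite (le_trans (hM0 z)) // lerDl.
apply/cvgrPdist_le => e e0.
have e5 : 0 < e / 5 by rewrite divr_gt0.
have eM : 0 < e / 5 / (2 * M) by rewrite divr_gt0 // mulr_gt0.
have [K1 K10 hK1] := tn _ eM; have [K2 K20 hK2] := tL _ eM.
pose K := Num.max K1 K2; have K0 : 0 < K by rewrite lt_max K10.
have K22 : 0 < 2 * K by rewrite mulr_gt0.
have [T [[s hs] TM fT]] := trig_approx cf fM K22 e5.
have bT : bcont T.
  have [b _] := mean_trig s mL.
  by have -> : T = (fun y => \sum_(q <- s) q.1.1 * cos (dot q.1.2 y + q.2)) by apply/funext.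
have TL L' : mean L' -> L' T = \sum_(q <- s) q.1.1 * L' (fun y => cos (dot q.1.2 y + q.2)).
  by move=> mL'; have [_ <-] := mean_trig s mL'; congr (L' _); apply/funext.
have bound K' : 0 < K' -> K' <= K -> forall z, `|f z - T z| <= e / 5 + 2 * M * cutoff K' z.
  move=> K'0 K'K z; have [h|h] := lerP (2 * K') `|z|; last first.
    apply: (@le_trans _ _ (e / 5)).
      apply: fT => i; apply: (le_trans (coord_le_norm z i)); apply: (le_trans (ltW h)).
      by rewrite ler_pM2l.
    by rewrite lerDl mulr_ge0 ?cutoff_ge0 // mulr_ge0 // ltW.
  rewrite cutoff_eq1 // mulr1; apply: (le_trans (ler_normB _ _)).
  have := fM z; have := TM z; lra.
have hT : Ln n T @[n --> \oo] --> L T.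
  rewrite (TL _ mL) (_ : (fun n => Ln n T) = (fun n => \sum_(q <- s) q.1.1 * Ln n (fun y => cos (dot q.1.2 y + q.2)))).
    by apply: cvg_seq_sum => q; apply: cvgM; [exact: cvg_cst|exact: ch].
  by apply/funext => n; rewrite TL.
have /cvgrPdist_le/(_ _ e5) := hT.
move: hK1; apply: filterS2 => n hn hTn.
have dL K' L' : mean L' -> 0 < K' -> K' <= K -> L' (cutoff K') <= e / 5 / (2 * M) -> `|L' f - L' T| <= e / 5 + e / 5.
  move=> mL' K'0 K'K hK'; apply: (le_trans (mean_dist mL' bf bT (bound K' K'0 K'K))).
  rewrite lerD2l; apply: (@le_trans _ _ (2 * M * (e / 5 / (2 * M)))).
    by rewrite ler_wpM2l // mulr_ge0 // ltW.
  by rewrite mulrC divfK // gt_eqF // mulr_gt0.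
have d1 : `|Ln n f - Ln n T| <= e / 5 + e / 5 by apply: dL K10 _ hn; rewrite // le_max lexx.
have d2 : `|L f - L T| <= e / 5 + e / 5 by apply: dL K20 _ hK2; rewrite // le_max lexx orbT.
move: d1 d2 hTn; rewrite !ler_norml => /andP[a1 a2] /andP[a3 a4] /andP[a5 a6].
by apply/andP; split; lra.
Qed.

End WeakConvergence.

(** * Measurability and means of random vectors *)

Section RandomVectors.
Context (R : realType) (N : nat) (d : measure_display) (Omega : measurableType d).
Context (Pr : probability Omega R) (Y : Omega -> 'cV[R]_N).
Hypothesis mY : forall j, measurable_fun [set: Omega] (fun w => Y w j 0).

(** An open set is the countable union of the rational cubes it contains, and preimages of cubes are
    finite intersections of coordinate events. *)
Lemma preimage_open_measurable (U : set 'cV[R]_N) : open U -> measurable (Y @^-1` U).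
Proof.
move=> oU.
pose B (q : 'cV[rat]_N * nat) := [set z : 'cV[R]_N | forall i, `|z i 0 - ratr (q.1 i 0)| < q.2.+1%:R^-1].
pose V n := if unpickle n is Some q then if `[< B q `<=` U >] then B q else set0 else set0.
have mB q : measurable (Y @^-1` B q).
  have -> : Y @^-1` B q = \bigcap_(i in [set: 'I_N])
      ([set: Omega] `&` (fun w => Y w i 0) @^-1` `](ratr (q.1 i 0) - q.2.+1%:R^-1), (ratr (q.1 i 0) + q.2.+1%:R^-1)[).
    apply/seteqP; split => w /= h i => [_|]; first split => //=.
      by rewrite in_itv /= -ltr_distl; exact: h.
    by have [_ /=] := h i I; rewrite in_itv /= -ltr_distl.
  by apply: fin_bigcap_measurable => // i _; apply: mY.
suff -> : Y @^-1` U = \bigcup_n (Y @^-1` V n).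
  apply: bigcupT_measurable => n; rewrite /V; case: unpickle => [q|]; last by rewrite preimage_set0.
  by case: asboolP => _; [exact: mB|rewrite preimage_set0].
rewrite -preimage_bigcup; congr (Y @^-1` _); apply/seteqP; split => [z Uz|z [n _]]; last first.
  rewrite /V; case: unpickle => [q|] //; case: asboolP => // BU Bz.
  exact: BU.
have /nbhs_ballP[e /= e0 he] : nbhs z U by apply: open_nbhs_nbhs.
have [k hk] : exists k : nat, k.+1%:R^-1 + k.+1%:R^-1 < e.
  exists (Num.bound (2 / e)); have := archi_boundP (divr_ge0 (ler0n R 2) (ltW e0)) => h.
  have {}h : 2 / e < (Num.bound (2 / e)).+1%:R by apply: (lt_trans h); rewrite ltr_nat.
  set k := (Num.bound _).+1%:R in h *; have k0 : 0 < k by rewrite ltr0n.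
  rewrite ltr_pdivrMr // in h.
  by rewrite (_ : k^-1 + k^-1 = 2 / k) ?ltr_pdivrMr 1?mulrC //; field; rewrite gt_eqF.
have /choice[q hq] : forall i, exists q : rat, `|z i 0 - ratr q| < k.+1%:R^-1.
  move=> i; have k0 : 0 < k.+1%:R^-1 :> R by rewrite invr_gt0.
  move: (k.+1%:R^-1) k0 => c c0.
  have /rat_in_itvoo[q hq] : z i 0 - c < z i 0 + c by lra.
  exists q; rewrite in_itv /= in hq; rewrite ltr_norml; case/andP: hq => h1 h2.
  by apply/andP; split; lra.
exists (pickle (\col_i q i, k)) => //; rewrite /V pickleK.
have Bz : B (\col_i q i, k) z by move=> i /=; rewrite mxE.
rewrite asboolT // => y By; apply: he; rewrite -ball_normE /=.
apply: le_lt_trans hk; apply: cV_norm_le => [|i]; first by rewrite addr_ge0.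
rewrite !mxE -(subrKA (ratr (q i))); apply: (le_trans (ler_normD _ _)).
apply: lerD; first exact: ltW.
by rewrite distrC; have := By i; rewrite /= mxE => /ltW.
Qed.

End RandomVectors.

Section RandomVectorMean.
Context (R : realType) (N : nat) (d : measure_display) (Omega : measurableType d).
Context (Pr : probability Omega R) (Y : Omega -> 'cV[R]_N).
Hypothesis mY : forall j, measurable_fun [set: Omega] (fun w => Y w j 0).

Lemma rv_comp_measurable (f : 'cV[R]_N -> R) : continuous f -> measurable_fun [set: Omega] (fun w => f (Y w)).
Proof.
move=> cf; apply: (measurability _ (RGenOInfty.measurableE R)) => _ [_ [x ->] <-].
rewrite setTI; apply: (preimage_open_measurable mY (U := f @^-1` `]x, +oo[%classic)).
by apply: open_comp => // z _; exact: cf.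
Qed.

Lemma rv_borel_measurable : measurable_fun [set: Omega] (Y : Omega -> borel_cV R N).
Proof.
apply: (@measurability _ _ _ (borel_cV R N) _ _ (@open 'cV[R]_N)) => // _ [U oU <-].
by rewrite setTI; exact: (preimage_open_measurable mY).
Qed.

Lemma rv_integrable (f : 'cV[R]_N -> R) : bcont f -> Pr.-integrable [set: Omega] (EFin \o (fun w => f (Y w))).
Proof.
move=> [cf [M hM]]; apply: measurable_bounded_integrable => //.
- by rewrite (le_lt_trans (probability_le1 _ _)) ?ltry.
- exact: rv_comp_measurable.
- by exists M; split; [exact: num_real|move=> x Mx w _; rewrite /= (le_trans (hM _)) // ltW].
Qed.

Lemma rv_mean : mean (fun f => \int[Pr]_w f (Y w)).
Proof.
split=> [f g bf bg|c f bf|f g bf bg fg|].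
- by rewrite RintegralD //; exact: rv_integrable.
- by rewrite RintegralZl //; exact: rv_integrable.
- by apply: le_Rintegral => //; exact: rv_integrable.
- by rewrite Rintegral_cst // mul1r; exact: (congr1 fine (probability_setT Pr)).
Qed.

Lemma rv_dominated (F : nat -> Omega -> R) (f : Omega -> R) :
  (forall n, measurable_fun [set: Omega] (F n)) -> measurable_fun [set: Omega] f ->
  (forall n w, `|F n w| <= 1) -> (forall w, \forall n \near \oo, F n w = f w) ->
  \int[Pr]_w F n w @[n --> \oo] --> \int[Pr]_w f w.
Proof.
move=> mF mf F1 Ff.
have [intf _ cv] : [/\ Pr.-integrable setT (EFin \o f), True &
    (\int[Pr]_w (F n w)%:E)%E @[n --> \oo] --> (\int[Pr]_w (f w)%:E)%E].
  have [] := @dominated_convergence _ Omega R Pr setT measurableT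
    (fun n w => (F n w)%:E) (EFin \o f) (cst 1%E).
  - by move=> n; apply/measurable_EFinP.
  - exact/measurable_EFinP.
  - apply: aeW => w _; apply: cvg_near_cst.
    by apply: filterS (Ff w) => n /= ->.
  - by apply: finite_measure_integrable_cst.
  - by apply: aeW => w n _; rewrite /= lee_fin.
  - by move=> h1 h2 h3; split.
have fin : (\int[Pr]_w (f w)%:E)%E \is a fin_num by exact: integrable_fin_num.
rewrite /Rintegral; apply: fine_cvg.
by rewrite fineK.
Qed.

Lemma rv_tight (e : R) : 0 < e -> exists2 K : R, 0 < K & \int[Pr]_w cutoff K (Y w) <= e.
Proof.
move=> e0.
have : \int[Pr]_w cutoff n.+1%:R (Y w) @[n --> \oo] --> \int[Pr]_w (0 : R).
  apply: rv_dominated => [n||n w|w].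
  - exact: (rv_comp_measurable (cutoff_bcont _ _).1).
  - exact: measurable_cst.
  - by rewrite ger0_norm ?cutoff_ge0 //; case/andP: (clip_half (`|Y w| / n.+1%:R - 3 / 2)).
  - exists (Num.bound `|Y w|) => // n /= hn; rewrite cutoff_eq0 //.
    apply: (le_trans (ltW (archi_boundP (normr_ge0 _)))).
    by rewrite ler_nat ltnW.
rewrite Rintegral_cst // mul0r => /cvgrPdist_le/(_ e e0)[n _ hn].
exists n.+1%:R => //; have := hn n (leqnn n); rewrite /= sub0r normrN.
exact: le_trans (ler_norm _).
Qed.

End RandomVectorMean.

Lemma coord_borel_measurable (R : realType) (N : nat) (j : 'I_N) :
  measurable_fun [set: borel_cV R N] (fun z : borel_cV R N => (z : 'cV[R]_N) j 0).
Proof.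
apply: (measurability _ (RGenOInfty.measurableE R)) => _ [_ [x ->] <-].
rewrite setTI; apply: sub_sigma_algebra; apply: open_comp => //.
by move=> z _; exact: coord_continuous.
Qed.

(** * A law on the line is determined by its characteristic function *)

Section Uniqueness.
Context (R : realType).
Implicit Types P : probability (measurableTypeR R) R.

Let col1 (x : R) : 'cV[R]_1 := const_mx x.

Let col1_measurable j : measurable_fun [set: measurableTypeR R] (fun x => col1 x j 0).
Proof. by rewrite (_ : (fun x => _) = id) //; apply/funext => x; rewrite mxE. Qed.

(** The continuity theorem for a constant sequence equates all means of bounded continuous
    functions; ramps then give open rays, which generate the Borel sets and are stable under
    intersection. *)
Lemma charfn_unique P1 P2 :
  (forall tau phi : R, \int[P1]_x cos (tau * x + phi) = \int[P2]_x cos (tau * x + phi)) ->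
  forall B, measurable B -> P1 B = P2 B.
Proof.
move=> h.
have eqL (f : 'cV[R]_1 -> R) : bcont f -> \int[P1]_x f (col1 x) = \int[P2]_x f (col1 x).
  move=> bf.
  have := @levy_continuity R 1 (fun=> fun f => \int[P1]_x f (col1 x)) (fun f => \int[P2]_x f (col1 x)).
  move=> /(_ _ _ _ _ _ f bf) H.
  have {}H : \int[P1]_x f (col1 x) @[n --> \oo] --> \int[P2]_x f (col1 x).
    apply: H.
    - by move=> _; exact: rv_mean.
    - exact: rv_mean.
    - move=> e e0; have [K K0 hK] := rv_tight P1 col1_measurable e0.
      by exists K => //; exact: nearW.
    - by move=> e e0; exact: (rv_tight P2 col1_measurable e0).
    - move=> t phi.
      have dE (x : R) : dot t (col1 x) = t 0 0 * x by rewrite /dot big_ord1 mxE.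
      have eI P : \int[P]_x cos (dot t (col1 x) + phi) = \int[P]_x cos (t 0 0 * x + phi).
        by apply: eq_Rintegral => x _; rewrite dE.
      by rewrite !eI h; exact: cvg_cst.
  by have := cvg_lim _ H; rewrite lim_cst // => ->.
have ray (x : R) : P1 `]x, +oo[%classic = P2 `]x, +oo[%classic.
  (* A ramp from 0 at x to 1 at x + 1 / n, converging to the indicator of the open ray. *)
  pose F n (y : R) := clip (n%:R * (y - x) - 2^-1) + 2^-1.
  have cF n : continuous (F n).
    apply: contD; last exact: cont_cst.
    apply: cont_comp; first exact: continuous_clip.
    apply: contD; last exact: cont_cst.
    apply: contM; first exact: cont_cst.
    by apply: contD; [move=> z; exact: cvg_id|exact: cont_cst].
  have F1 n y : `|F n y| <= 1.
    by case/andP: (clip_half (n%:R * (y - x) - 2^-1)) => a b; rewrite ger0_norm.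
  have lim P : \int[P]_y F n y @[n --> \oo] --> fine (P `]x, +oo[%classic).
    have -> : fine (P `]x, +oo[%classic) = \int[P]_y \1_(`]x, +oo[%classic) y.
      by rewrite /Rintegral integral_indic // setIT.
    apply: rv_dominated => //.
    - by move=> n; apply: continuous_measurable_fun; exact: cF.
    - move=> y; rewrite indicE /=; case: (boolP (y \in _)) => hy.
        rewrite inE /= in_itv /= andbT in hy.
        exists (Num.bound (y - x)^-1) => // n /= hn; rewrite /F clip_ge //.
        have yx : 0 < y - x by rewrite subr_gt0.
        suff : 1 <= n%:R * (y - x) by lra.
        rewrite -ler_pdivrMr // mul1r; apply: (le_trans (ltW (archi_boundP _))); last by rewrite ler_nat.
        by rewrite invr_ge0 ltW.
      rewrite notin_setE /= in_itv /= andbT in hy; move/negP: hy; rewrite -leNgt => yx.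
      exists 0%N => // n _ /=; rewrite /F clip_le //.
      have : n%:R * (y - x) <= 0 by rewrite mulr_ge0_le0 // subr_le0.
      lra.
  have eqF n : \int[P1]_y F n y = \int[P2]_y F n y.
    have bc : bcont (fun z : 'cV[R]_1 => F n (z 0 0)).
      split; last by exists 1.
      by apply: cont_comp; [exact: cF|exact: coord_continuous].
    have eI P : \int[P]_x F n (col1 x 0 0) = \int[P]_x F n x.
      by apply: eq_Rintegral => x' _; rewrite mxE.
    by have := eqL _ bc; rewrite !eI.
  have l1 := lim P1; rewrite (funext eqF) in l1.
  have := cvg_unique _ l1 (lim P2) => E.
  by rewrite -[LHS]fineK ?E ?fineK // fin_num_measure.
pose g n : set (measurableTypeR R) := `](- (n%:R : R))%R, +oo[%classic.
have mG : @measurable _ (measurableTypeR R) = <<s @RGenOInfty.G R >> by exact: RGenOInfty.measurableE.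
have GI : setI_closed (@RGenOInfty.G R).
  move=> _ _ [x ->] [y ->]; exists (Num.max x y).
  apply/seteqP; split => z /=; rewrite !in_itv /= !andbT gt_max.
    by move=> [-> ->].
  by move=> /andP[].
have Gg n : @RGenOInfty.G R (g n) by exists (- n%:R).
have cov : \bigcup_k g k = setT.
  apply/seteqP; split => // x _; exists (Num.bound `|x|) => //=.
  rewrite /g /= in_itv /= andbT ltrNl; apply: le_lt_trans (archi_boundP (normr_ge0 x)).
  by rewrite -normrN ler_norm.
have P12 A : @RGenOInfty.G R A -> P1 A = P2 A by move=> [x ->]; exact: ray.
have P1oo k : (P1 (g k) < +oo)%E by rewrite ltey_eq fin_num_measure //; exact: measurable_itv.
move=> B mB.
have := @measure_unique _ R (measurableTypeR R) (@RGenOInfty.G R) g mG GI Gg cov P1 P2 P12 P1oo B mB.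
exact.
Qed.

End Uniqueness.

(** * Gaussian laws *)

Section NormalCharFn.
Context (R : realType) (s : R).
Hypothesis s_gt0 : 0 < s.
Local Notation leb := (@lebesgue_measure R).

Let p : R -> R := normal_pdf 0 s.
Let K : R := normal_peak s.
Let c : R := (2 * s ^+ 2)^-1.

Let s0 : s != 0. Proof. by rewrite gt_eqF. Qed.
Let c_gt0 : 0 < c. Proof. by rewrite invr_gt0 mulr_gt0 // exprn_gt0. Qed.
Let K_gt0 : 0 < K. Proof. exact: normal_peak_gt0. Qed.

Let normal_pdf0E (r x : R) : r != 0 ->
  normal_pdf 0 r x = normal_peak r * expR (- (x ^+ 2 * (2 * r ^+ 2)^-1)).
Proof.
move=> r0; rewrite normal_pdfE // /normal_fun subr0 mulNr.
by rewrite (_ : r ^+ 2 *+ 2 = 2 * r ^+ 2) // mulr_natl.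
Qed.

Let pE x : p x = K * expR (- (x ^+ 2 * c)). Proof. exact: normal_pdf0E. Qed.

Let p_gt0 x : 0 < p x. Proof. by rewrite pE mulr_gt0 // expR_gt0. Qed.

Let p_derive x : is_derive x (1 : R) p (- (2 * c * x * p x)).
Proof.
rewrite (_ : p = fun x => K * expR (- (x ^+ 2 * c))); last by apply/funext => y; rewrite pE.
by apply: is_derive_eq; rewrite /GRing.scale /=; ring.
Qed.

(** The Radon-Nikodym derivative of the normal law agrees almost everywhere with its density. *)
Lemma integral_normal_prob (f : R -> R) (M : R) : measurable_fun setT f -> (forall x, `|f x| <= M) ->
  \int[normal_prob 0 s]_x f x = \int[leb]_x (f x * p x).
Proof.
move=> mf fM; congr fine.
have intf : (normal_prob 0 s).-integrable setT (EFin \o f).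
  apply: measurable_bounded_integrable => //.
    by rewrite (le_lt_trans (probability_le1 _ _)) ?ltry.
  by exists M; split; [exact: num_real|move=> x Mx w _; rewrite /= (le_trans (fM _)) // ltW].
have dom := normal_prob_dominates 0 s.
rewrite -[LHS](Radon_Nikodym_change_of_variables dom measurableT intf).
apply: ae_eq_integral => //.
- apply: emeasurable_funM; first exact/measurable_EFinP.
  by apply: (measurable_int leb); exact: Radon_Nikodym_integrable.
- by apply/measurable_EFinP; apply: measurable_funM => //; exact: measurable_normal_pdf.
- rewrite (_ : (fun x => (f x * p x)%:E) = (fun x => (f x)%:E * (p x)%:E)%E) //.
  apply: ae_eqe_mul2l => /=.
  rewrite Radon_NikodymE //=; case: cid => /= h [h1 h2 h3].
  apply: integral_ae_eq => //=.
  + by apply/measurable_EFinP; exact: measurable_normal_pdf.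
  + by move=> E _ mE; rewrite -h3.
Qed.

Let p_int : leb.-integrable setT (EFin \o p).
Proof. exact: integrable_normal_pdf. Qed.

Let s2 : R := Num.sqrt 2 * s.

(** An integrable majorant for differentiation under the integral: half of the Gaussian exponent
    absorbs |x|, through |x| <= s (1 + y) <= s e^y with y = x^2 / (4 s^2). *)
Let xp_le x : `|x| * p x <= s * K / normal_peak s2 * normal_pdf 0 s2 x.
Proof.
have s20 : s2 != 0 by rewrite mulf_neq0 // sqrtr_eq0 -ltNge.
have k2 := normal_peak_gt0 s20.
rewrite normal_pdf0E // mulrA divfK ?gt_eqF // pE.
have -> : (2 * s2 ^+ 2)^-1 = c / 2.
  by rewrite /s2 exprMn sqr_sqrtr // /c; field.
set y := x ^+ 2 * (c / 2).
have -> : x ^+ 2 * c = y + y by rewrite /y; field.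
rewrite opprD expRD.
have h : `|x| <= s * expR y.
  have := expR_ge1Dx y.
  have : `|x| <= s * (1 + y).
    have -> : s * (1 + y) = `|x| + s * (1 - `|x| / (2 * s)) ^+ 2.
      have : x ^+ 2 = `|x| ^+ 2 by rewrite real_normK ?num_real.
      by rewrite /y /c => ->; field.
    by rewrite lerDl mulr_ge0 ?sqr_ge0 // ltW.
  by move=> h1 h2; apply: (le_trans h1); rewrite ler_pM2l.
have h2 : `|x| * expR (- y) <= s by rewrite expRN ler_pdivrMr ?expR_gt0.
rewrite (_ : `|x| * (K * (expR (- y) * expR (- y))) = `|x| * expR (- y) * (K * expR (- y))); last by ring.
by rewrite -[leRHS]mulrA ler_wpM2r // mulr_ge0 ?expR_ge0 // ltW.
Qed.

Let G (x : R) : R := s * K / normal_peak s2 * normal_pdf 0 s2 x.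

Let G_int : leb.-integrable setT (EFin \o G).
Proof.
rewrite (_ : EFin \o G = (fun x => (s * K / normal_peak s2)%:E * (normal_pdf 0 s2 x)%:E)%E) //.
by apply: integrableZl => //; exact: integrable_normal_pdf.
Qed.

Let G_ge0 x : 0 <= G x.
Proof. by apply: le_trans (xp_le x); rewrite mulr_ge0 // ltW. Qed.

Variable A : R.

Let C (t : R) : R := \int[leb]_x (cos (t * x + A) * p x).

Let cos_meas t : measurable_fun setT (fun x : R => cos (t * x + A)).
Proof.
apply: continuous_measurable_fun; apply: cont_comp; first exact: continuous_cos.
by apply: contD; [apply: contM; [exact: cont_cst|move=> z; exact: cvg_id]|exact: cont_cst].
Qed.

Let sin_meas t : measurable_fun setT (fun x : R => sin (t * x + A)).
Proof.
apply: continuous_measurable_fun; apply: cont_comp; first exact: continuous_sin.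
by apply: contD; [apply: contM; [exact: cont_cst|move=> z; exact: cvg_id]|exact: cont_cst].
Qed.

Let p_meas : measurable_fun setT p. Proof. exact: measurable_normal_pdf. Qed.

Let cosp_int t : leb.-integrable setT (EFin \o (fun x => cos (t * x + A) * p x)).
Proof.
apply: (le_integrable measurableT _ _ p_int).
  by apply/measurable_EFinP; exact: (measurable_funM (cos_meas t) p_meas).
move=> x _ /=; rewrite lee_fin normrM ler_piMl //; exact: cos_max.
Qed.

Let xsinp_int t : leb.-integrable setT (EFin \o (fun x => x * sin (t * x + A) * p x)).
Proof.
apply: (le_integrable measurableT _ _ G_int).
  by apply/measurable_EFinP; exact: (measurable_funM (measurable_funM (@measurable_id _ _ setT) (sin_meas t)) p_meas).
move=> x _ /=; rewrite lee_fin [leRHS]ger0_norm //; apply: le_trans (xp_le x).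
rewrite !normrM (gtr0_norm (p_gt0 x)) ler_wpM2r ?(ltW (p_gt0 x)) //.
by rewrite ler_piMr //; exact: sin_max.
Qed.

Let h t (x : R) : R := sin (t * x + A) * p x.
Let h' t (x : R) : R := t * (cos (t * x + A) * p x) - 2 * c * (x * sin (t * x + A) * p x).

Let h_derive t x : is_derive x (1 : R) (h t) (h' t x).
Proof.
have := p_derive x => dp; rewrite /h.
by apply: is_derive_eq; rewrite /h' /GRing.scale /=; ring.
Qed.

Let h'_int t : leb.-integrable setT (EFin \o h' t).
Proof.
rewrite (_ : EFin \o h' t = ((fun x => t%:E * (cos (t * x + A) * p x)%:E) \-
  (fun x => (2 * c)%:E * (x * sin (t * x + A) * p x)%:E))%E) //.
by apply: integrableB => //; apply: integrableZl => //; [exact: cosp_int|exact: xsinp_int].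
Qed.

Let h_bound t (n : nat) : `|h t n.+1%:R - h t (- n.+1%:R)| <= 2 * (K / c) / n.+1%:R.
Proof.
have pn (x : R) : `|x| = n.+1%:R -> `|h t x| <= K / c / n.+1%:R.
  move=> xn; rewrite /h normrM (gtr0_norm (p_gt0 x)).
  apply: (@le_trans _ _ (p x)); first by rewrite ler_piMl ?(ltW (p_gt0 _)) //; exact: sin_max.
  rewrite (_ : K / c / n.+1%:R = K * (c^-1 / n.+1%:R)) ; last by rewrite mulrA.
  rewrite pE ler_pM2l // expRN -invfM lef_pV2 ?posrE ?expR_gt0 ?mulr_gt0 //.
  apply: le_trans (expR_ge1Dx _); rewrite -(real_normK (num_real x)) xn.
  rewrite mulrC -[leLHS]add0r; apply: lerD => //; rewrite ler_wpM2r ?(ltW c_gt0) //.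
  by rewrite expr2 ler_peMl // ler1n.
apply: (le_trans (ler_normB _ _)).
rewrite [leRHS](_ : _ = K / c / n.+1%:R + K / c / n.+1%:R); last by ring.
by apply: lerD; apply: pn; rewrite ?normrN ger0_norm.
Qed.

(** Integration by parts: the fundamental theorem on [-(n + 1), n + 1], with boundary terms
    vanishing by [h_bound], and dominated convergence. *)
Let h'_integral0 t : \int[leb]_x h' t x = 0.
Proof.
pose I (n : nat) : set R := `[(- n.+1%:R)%R, n.+1%:R]%classic.
have cv : (\int[leb]_(x in I n) (h' t x)%:E)%E @[n --> \oo] --> (\int[leb]_x (h' t x)%:E)%E.
  rewrite (_ : (fun n => _) = (fun n => \int[leb]_x ((EFin \o h' t) \_ (I n)) x)%E); last first.
    by apply/funext => n; rewrite integral_mkcond.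
  have [] := @dominated_convergence _ (measurableTypeR R) R leb setT measurableT
    (fun n => (EFin \o h' t) \_ (I n)) (EFin \o h' t) (fun x => `|(h' t x)%:E|)%E.
  - move=> n; apply/(measurable_restrictT _ (measurable_itv _)).
    by apply: measurable_funTS; exact: measurable_int (h'_int t).
  - exact: measurable_int (h'_int t).
  - apply: aeW => x _; apply: cvg_near_cst; exists (Num.bound `|x|) => // n /= hn.
    rewrite patchE ifT // inE /I /= in_itv /= -ler_norml.
    by apply: (le_trans (ltW (archi_boundP (normr_ge0 _)))); rewrite ler_nat leqW.
  - by apply: integrable_abse; exact: h'_int.
  - apply: aeW => x n _; rewrite patchE; case: ifP => // _.
    by rewrite abse0 abse_ge0.
  - by [].
have FTC n : (\int[leb]_(x in I n) (h' t x)%:E)%E = (h t n.+1%:R - h t (- n.+1%:R))%:E.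
  have dh x : derivable (h t) x 1 by case: (h_derive t x).
  have ch : continuous (h t) by move=> x; apply: differentiable_continuous; apply/derivable1_diffP.
  rewrite (@continuous_FTC2 R (h' t) (h t)) ?EFinB //.
  - by apply: (@lt_trans _ _ 0); rewrite ?oppr_lt0 // ltr0n.
  - apply: continuous_subspaceT; have cp : continuous p by exact: continuous_normal_pdf.
    have ct : continuous (fun x : R => t * x + A).
      by apply: contD; [apply: contM; [exact: cont_cst|move=> z; exact: cvg_id]|exact: cont_cst].
    apply: contD; first by apply: contM; [exact: cont_cst|apply: contM => //; exact: cont_comp (@continuous_cos R) ct].
    rewrite (_ : (fun z => _) = fun z => - (2 * c) * (z * sin (t * z + A) * p z)); last first.
      by apply/funext => z; rewrite mulNr.
    apply: contM; first exact: cont_cst.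
    apply: contM => //; apply: contM; first by move=> z; exact: cvg_id.
    exact: cont_comp (@continuous_sin R) ct.
  - split => [x _||]; first exact: dh.
      by apply: cvg_at_right_filter; exact: ch.
    by apply: cvg_at_left_filter; exact: ch.
  - by move=> x _; rewrite derive1E; case: (h_derive t x).
have cv0 : (\int[leb]_(x in I n) (h' t x)%:E)%E @[n --> \oo] --> (0 : R)%:E.
  rewrite (_ : (fun n => _) = (fun n => (h t n.+1%:R - h t (- n.+1%:R))%:E)); last first.
    by apply/funext => n; rewrite FTC.
  apply: cvg_EFin; first exact: nearW.
  apply/cvgrPdist_le => e e0.
  exists (Num.bound (2 * (K / c) / e)) => // n /= hn; rewrite sub0r normrN.
  apply: (le_trans (h_bound t n)); rewrite ler_pdivrMr // [leRHS]mulrC -ler_pdivrMr //.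
  apply: (le_trans (ltW (archi_boundP _))); last by rewrite ler_nat leqW.
  exact: (divr_ge0 (mulr_ge0 (ler0n _ 2) (ltW (divr_gt0 K_gt0 c_gt0))) (ltW e0)).
by rewrite /Rintegral (cvg_unique _ cv cv0).
Qed.

Let xsin_integral t : \int[leb]_x (x * sin (t * x + A) * p x) = s ^+ 2 * t * C t.
Proof.
have := h'_integral0 t; rewrite /h' RintegralB //; last 2 first.
- rewrite (_ : EFin \o _ = (fun x => t%:E * (cos (t * x + A) * p x)%:E)%E) //.
  by apply: integrableZl => //; exact: cosp_int.
- rewrite (_ : EFin \o _ = (fun x => (2 * c)%:E * (x * sin (t * x + A) * p x)%:E)%E) //.
  by apply: integrableZl => //; exact: xsinp_int.
rewrite !RintegralZl // -/(C t) => /eqP; rewrite subr_eq0 => /eqP E.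
apply: (@mulfI _ (2 * c)); first by rewrite gt_eqF // mulr_gt0.
by rewrite -E /c; field.
Qed.

Let C_derive t : is_derive t (1 : R) C (- (s ^+ 2 * t * C t)).
Proof.
pose f (t x : R) := cos (t * x + A) * p x.
have df t' x : is_derive t' (1 : R) (f^~ x) (- (x * sin (t' * x + A) * p x)).
  by rewrite /f; apply: is_derive_eq; rewrite /GRing.scale /=; ring.
have d1E t' x : partial1of2 f t' x = - (x * sin (t' * x + A) * p x).
  by rewrite /partial1of2 derive1E; case: (df t' x).
have tI : `](t - 1), (t + 1)[%classic t by rewrite /= in_itv /=; apply/andP; split; lra.
have i1 x : `](t - 1), (t + 1)[%classic x -> leb.-integrable setT (EFin \o f x) by move=> _; exact: cosp_int.
have i2 x y : `](t - 1), (t + 1)[%classic x -> setT y -> derivable (f ^~ y) x 1.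
  by move=> _ _; case: (df x y).
have i3 x y : `](t - 1), (t + 1)[%classic x -> setT y -> `|partial1of2 f x y| <= G y.
  move=> _ _; rewrite d1E normrN; apply: le_trans (xp_le y).
  rewrite !normrM (gtr0_norm (p_gt0 y)) ler_wpM2r ?(ltW (p_gt0 y)) //.
  by rewrite ler_piMr //; exact: sin_max.
have dC := derivable_under_integral measurableT tI i1 i2 G_ge0 G_int i3.
have eC := differentiation_under_integral measurableT tI i1 i2 G_ge0 G_int i3.
apply: DeriveDef; first exact: dC.
rewrite -derive1E eC -xsin_integral.
under eq_Rintegral do rewrite d1E.
rewrite -mulN1r -RintegralZl //; first by apply: eq_Rintegral => x _; rewrite mulN1r.
Qed.

(** The equation C' = - s^2 t C makes C(t) e^{s^2 t^2 / 2} constant, and its value at 0 is cos A. *)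
Lemma normal_charfn_aux t : C t = cos A * expR (- (s ^+ 2 * t ^+ 2 / 2)).
Proof.
pose E t := C t * expR (s ^+ 2 * t ^+ 2 / 2).
have dE x : is_derive x (1 : R) E 0.
  have := C_derive x => dC; rewrite /E.
  by apply: is_derive_eq; rewrite /GRing.scale /=; field.
have := is_derive_0_is_cst t 0 dE; rewrite /E expr0n /= mulr0 mul0r expR0 mulr1 => E0.
have C0 : C 0 = cos A.
  rewrite /C; under eq_Rintegral do rewrite mul0r add0r.
  rewrite RintegralZl // /Rintegral integral_normal_pdf /= mulr1 //.
by rewrite -C0 -E0 -mulrA -expRD subrr expR0 mulr1.
Qed.

End NormalCharFn.

Lemma normal_charfn (R : realType) (s t A : R) : 0 < s ->
  \int[normal_prob 0 s]_x cos (t * x + A) = cos A * expR (- (s ^+ 2 * t ^+ 2 / 2)).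
Proof.
move=> s_gt0; rewrite (@integral_normal_prob _ s (fun x => cos (t * x + A)) 1).
- exact: (normal_charfn_aux s_gt0 A t).
- apply: continuous_measurable_fun; apply: cont_comp; first exact: continuous_cos.
  by apply: contD; [apply: contM; [exact: cont_cst|move=> z; exact: cvg_id]|exact: cont_cst].
- by move=> x; exact: cos_max.
Qed.

Lemma Rintegral_fineK (R : realType) d (T : measurableType d) (P : probability T R) (f : T -> R) :
  P.-integrable setT (EFin \o f) -> (\int[P]_w (f w)%:E = (\int[P]_w f w)%R%:E)%E.
Proof. by move=> h; rewrite /Rintegral fineK //; exact: integrable_fin_num. Qed.

Lemma bounded_integrable (R : realType) d (T : measurableType d) (P : probability T R)
    (f : T -> R) (M : R) :
  measurable_fun setT f -> (forall w, `|f w| <= M) -> P.-integrable setT (EFin \o f).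
Proof.
move=> mf fM; apply: measurable_bounded_integrable => //.
  by rewrite (le_lt_trans (probability_le1 _ _)) ?ltry.
by exists M; split; [exact: num_real|move=> x Mx w _; rewrite /= (le_trans (fM _)) // ltW].
Qed.

Lemma image_law (R : realType) d d' (T : measurableType d) (T' : measurableType d')
    (P : probability T R) (Y : T -> T') : measurable_fun setT Y ->
  exists nu : probability T' R, (forall A, nu A = P (Y @^-1` A)) /\
    forall (f : T' -> R) (M : R), measurable_fun setT f -> (forall z, `|f z| <= M) ->
      \int[nu]_z f z = \int[P]_w f (Y w).
Proof.
move=> mY; pose Y' : {mfun T >-> T'} := HB.pack Y (isMeasurableFun.Build _ _ _ _ Y mY).
exists (distribution P Y'); split => // f M mf fM.
congr fine; rewrite /distribution (@integral_pushforward _ _ _ _ R Y' mY P setT (EFin \o f)) //.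
- exact/measurable_EFinP.
- apply: (bounded_integrable P (f := f \o Y) (M := M)) => //.
  + exact: measurableT_comp.
  + by move=> w; exact: fM.
Qed.

(** * Product laws *)

Section ProductProbability.
Context (R : realType) d1 d2 (T1 : measurableType d1) (T2 : measurableType d2).
Variables (P1 : probability T1 R) (P2 : probability T2 R).

Definition prod_law : set (T1 * T2) -> \bar R := (P1 \x P2)%E.

HB.instance Definition _ := Measure.on prod_law.

Let prod_law_setT : prod_law setT = 1%E.
Proof.
rewrite /prod_law -setXTT product_measure1E //.
by rewrite [X in (X * _)%E](probability_setT P1) [X in (_ * X)%E](probability_setT P2) mule1.
Qed.

HB.instance Definition _ := Measure_isProbability.Build _ _ _ prod_law prod_law_setT.

Lemma Rintegral_prod (f : T1 * T2 -> R) (h : T1 -> R) (M : R) :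
  measurable_fun setT f -> (forall z, `|f z| <= M) ->
  (forall x, \int[P2]_y f (x, y) = h x) ->
  \int[prod_law]_z f z = \int[P1]_x h x.
Proof.
move=> mf fM hE; congr fine.
have intf : (P1 \x P2)%E.-integrable setT (EFin \o f) by exact: (bounded_integrable prod_law mf fM).
rewrite -[LHS](integral12_prod_meas1 intf); apply: eq_integral => x _.
rewrite /fubini_F -hE Rintegral_fineK //.
apply: (bounded_integrable P2 (M := M)) => //.
by apply: (measurableT_comp mf); exact: pair1_measurable.
Qed.

End ProductProbability.

(** * Construction and identification of Gaussian laws *)

Section GaussianLaw.
Context (R : realType) (N : nat).
Implicit Type nu : probability (borel_cV R N) R.

Lemma cos_dot_measurable (t : 'cV[R]_N) (phi : R) :
  measurable_fun [set: borel_cV R N] (fun z : borel_cV R N => cos (dot t z + phi)).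
Proof.
have h := @rv_comp_measurable R N _ _ (fun z : borel_cV R N => z : 'cV[R]_N) (@coord_borel_measurable R N).
exact: (h _ (bcont_cos t phi).1).
Qed.

Lemma dot_affine (t z w : 'cV[R]_N) (x : R) : dot t (z + x *: w) = dot t z + x * dot t w.
Proof.
by rewrite /dot mulr_sumr -big_split; apply: eq_bigr => j _; rewrite !mxE /=; ring.
Qed.

(** Adding an independent standard normal multiple of w adds <t, w>^2 to the variance of the
    projection on t. *)
Lemma gaussian_step nu (q : 'cV[R]_N -> R) (w : 'cV[R]_N) :
  (forall t phi, \int[nu]_z cos (dot t z + phi) = cos phi * expR (- (q t / 2))) ->
  exists nu' : probability (borel_cV R N) R, forall t phi,
    \int[nu']_z cos (dot t z + phi) = cos phi * expR (- ((q t + dot t w ^+ 2) / 2)).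
Proof.
move=> hnu.
pose g01 : probability (measurableTypeR R) R := normal_prob (0 : R) (1 : R).
pose Y (zg : borel_cV R N * measurableTypeR R) : 'cV[R]_N := (zg.1 : 'cV[R]_N) + (zg.2 : R) *: w.
have mY j : measurable_fun setT (fun zg => Y zg j 0).
  rewrite (_ : (fun zg => _) = (fun zg => (zg.1 : 'cV[R]_N) j 0 + (zg.2 : R) * w j 0)); last first.
    by apply/funext => zg; rewrite !mxE.
  apply: measurable_funD.
    by apply: (measurableT_comp (@coord_borel_measurable R N j)); exact: measurable_fst.
  by apply: measurable_funM => //; exact: measurable_snd.
have [nu' [_ hnu']] := image_law (prod_law nu g01) (rv_borel_measurable mY).
exists nu' => t phi.
rewrite (hnu' (fun z : borel_cV R N => cos (dot t z + phi)) 1); first last.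
- by move=> z; exact: cos_max.
- exact: cos_dot_measurable.
rewrite (Rintegral_prod nu (h := fun z : borel_cV R N => expR (- (dot t w ^+ 2 / 2)) * cos (dot t z + phi)) (M := 1)).
- rewrite RintegralZl // ?hnu.
    by rewrite mulrCA -expRD; congr (_ * expR _); field.
  by apply: (bounded_integrable nu (M := 1)); [exact: cos_dot_measurable|move=> z; exact: cos_max].
- apply: (measurableT_comp (cos_dot_measurable t phi)).
  exact: (rv_borel_measurable mY).
- by move=> z; exact: cos_max.
- move=> z; rewrite -[expR _]mulr1 mulrC.
  have := normal_charfn (dot t w) (dot t z + phi) (@ltr01 R).
  rewrite expr1n mul1r mulr1 => <-; apply: eq_Rintegral => x _; congr cos.
  by rewrite (dot_affine t z w x) [in RHS]mulrC [RHS]addrCA addrA.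
Qed.

Lemma gaussian_law (ws : seq 'cV[R]_N) : exists nu, forall t phi,
  \int[nu]_z cos (dot t z + phi) = cos phi * expR (- ((\sum_(w <- ws) dot t w ^+ 2) / 2)).
Proof.
elim: ws => [|w ws [nu IH]].
  exists (\d_(0 : borel_cV R N)) => t phi.
  rewrite big_nil mul0r oppr0 expR0 mulr1 /Rintegral integral_dirac //.
    rewrite diracT mul1e /=; congr cos.
    by rewrite /dot big1 ?add0r // => j _; rewrite mxE mulr0.
  by apply/measurable_EFinP; exact: cos_dot_measurable.
have [nu' h] := gaussian_step w IH.
by exists nu' => t phi; rewrite h big_cons [in RHS]addrC.
Qed.

(** Scaling t by tau gives the whole characteristic function of one projection, so one-dimensional
    uniqueness identifies its law. *)
Lemma gaussian_centered nu (V : 'M[R]_N) :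
  (forall (t : 'cV[R]_N) phi, \int[nu]_z cos (dot t z + phi) =
     cos phi * expR (- ((t^T *m V *m t) 0 0 / 2))) ->
  (forall t : 'cV[R]_N, 0 <= (t^T *m V *m t) 0 0) -> centered_normal_law V nu.
Proof.
move=> hnu V0 t B mB var.
have mdot : measurable_fun [set: borel_cV R N] (fun z : borel_cV R N => dot t z : measurableTypeR R).
  have h := @rv_comp_measurable R N _ _ (fun z : borel_cV R N => z : 'cV[R]_N) (@coord_borel_measurable R N).
  exact: (h _ (@continuous_dot R N t)).
have [P1 [P1E hP1]] := image_law nu mdot.
have -> : [set z : 'cV[R]_N | B ((t^T *m z) 0 0)] = (fun z : borel_cV R N => dot t z) @^-1` B.
  have dE (z : 'cV[R]_N) : (t^T *m z) 0 0 = dot t z.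
    by rewrite mxE /dot; apply: eq_bigr => j _; rewrite mxE.
  by apply/seteqP; split => z /=; rewrite dE.
rewrite -P1E.
have mc tau phi : measurable_fun [set: measurableTypeR R] (fun x : measurableTypeR R => cos (tau * (x : R) + phi)).
  apply: continuous_measurable_fun; apply: cont_comp; first exact: continuous_cos.
  by apply: contD; [apply: contM; [exact: cont_cst|move=> z; exact: cvg_id]|exact: cont_cst].
have ch tau phi : \int[P1]_x cos (tau * x + phi) = cos phi * expR (- (tau ^+ 2 * var / 2)).
  rewrite (hP1 _ 1 (mc tau phi)); last by move=> z; exact: cos_max.
  transitivity (\int[nu]_z cos (dot (tau *: t) z + phi)).
    apply: eq_Rintegral => z _; congr (cos (_ + _)).
    by rewrite /dot mulr_sumr; apply: eq_bigr => j _; rewrite mxE mulrA.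
  rewrite hnu; congr (_ * expR (- (_ / 2))).
  have -> : (tau *: t)^T = tau *: t^T by rewrite linearZ.
  have sE (x : R) (M : 'M[R]_1) : (x *: M) 0 0 = x * M 0 0 by rewrite mxE.
  by rewrite -scalemxAl -scalemxAl -scalemxAr !sE mulrA -expr2.
have [v0|v0] := eqVneq var 0.
  apply: (@charfn_unique R P1 (\d_(0 : measurableTypeR R)) _ B mB) => tau phi.
  rewrite ch v0 mulr0 mul0r oppr0 expR0 mulr1 /Rintegral integral_dirac //.
    by rewrite diracT mul1e /= mulr0 add0r.
  exact/measurable_EFinP.
have v_gt0 : 0 < var by rewrite lt_neqAle eq_sym v0 V0.
apply: (@charfn_unique R P1 (normal_prob 0 (Num.sqrt var)) _ B mB) => tau phi.
rewrite ch normal_charfn ?sqrtr_gt0 // sqr_sqrtr ?(ltW v_gt0) //.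
by rewrite [var * _]mulrC.
Qed.

End GaussianLaw.

(** * Limit covariance and conclusion *)

Section LimitCovariance.
Context (R : realType) (N : nat) (P : 'M[R]_N) (mu : 'cV[R]_N).
Context (lambda : 'I_N -> R) (u v : 'I_N -> 'cV[R]_N) (a : R).

Definition limit_coef (alpha : R) (i : 'I_N) : R :=
  (2 * alpha * (1 + lambda i) + 2 - (a == 1)%:R)^-1 * ((1 + lambda i) / (1 - lambda i)).

Lemma quad_Vx (alpha : R) (t : 'cV[R]_N) : (t^T *m Vx lambda u a alpha *m t) 0 0 =
  \sum_(i < N | (i < N.-1)%N) limit_coef alpha i * dot t (u i) ^+ 2.
Proof.
have mul11E (A B : 'M[R]_1) : (A *m B) 0 0 = A 0 0 * B 0 0 by rewrite mxE big_ord1.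
have dotE (x y : 'cV[R]_N) : (x^T *m y) 0 0 = dot x y.
  by rewrite mxE; apply: eq_bigr => j _; rewrite mxE.
rewrite /Vx mulmx_sumr mulmx_suml summxE; apply: eq_bigr => i _.
rewrite -scalemxAr -scalemxAl (mxE _ (fun i j => _ * _)) -/(limit_coef alpha i).
have -> : t^T *m (u i *m (u i)^T) *m t = (t^T *m u i) *m ((u i)^T *m t) by rewrite !mulmxA.
rewrite mul11E !dotE expr2; congr (_ * (_ * _)).
by apply: eq_bigr => j _; rewrite mulrC.
Qed.

Hypothesis spec : spectral_decomposition P mu lambda u v.

Lemma limit_coef_den (alpha : R) (i : 'I_N) : 0 <= alpha ->
  0 < 2 * alpha * (1 + lambda i) + 2 - (a == 1)%:R.
Proof.
move=> al0; have : 0 <= 2 * alpha * (1 + lambda i).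
  by rewrite !mulr_ge0 // -lerBlDl sub0r ltW // (lambda_gtN1 spec).
by case: (a == 1) => /=; lra.
Qed.

Lemma gap_ratio_gt0 (i : 'I_N) : (i < N.-1)%N -> 0 < (1 + lambda i) / (1 - lambda i).
Proof.
by move=> iN; have := lambda_gtN1 spec i; have := lambda_lt1 spec iN => h1 h2;
  rewrite divr_gt0 //; lra.
Qed.

Lemma limit_coef_gt0 (alpha : R) (i : 'I_N) : 0 <= alpha -> (i < N.-1)%N -> 0 < limit_coef alpha i.
Proof.
by move=> al0 iN; rewrite /limit_coef mulr_gt0 ?invr_gt0 ?limit_coef_den ?gap_ratio_gt0.
Qed.

Lemma limit_coef_decr (alpha1 alpha2 : R) (i : 'I_N) : 0 <= alpha1 -> alpha1 < alpha2 -> (i < N.-1)%N ->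
  limit_coef alpha2 i < limit_coef alpha1 i.
Proof.
move=> al0 al12 iN; rewrite /limit_coef ltr_pM2r ?gap_ratio_gt0 //.
rewrite ltf_pV2 ?posrE ?limit_coef_den //; last by rewrite ltW // (le_lt_trans al0).
have l1 : 0 < 1 + lambda i by have := lambda_gtN1 spec i; lra.
by rewrite ltrD2r ltrD2r ltr_pM2r // ltr_pM2l.
Qed.

(** Both matrices are diagonal in the same family u_i, and each coefficient decreases strictly in
    alpha because 1 + lambda_i > 0. *)
Lemma Vx_decreasing (hN : (2 <= N)%N) (alpha1 alpha2 : R) : 0 <= alpha1 -> alpha1 < alpha2 ->
  loewner_lt (Vx lambda u a alpha2) (Vx lambda u a alpha1).
Proof.
move=> al0 al12.
have VT al : (Vx lambda u a al)^T = Vx lambda u a al.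
  rewrite /Vx linear_sum; apply: eq_bigr => i _.
  by rewrite linearZ /= trmx_mul trmxK.
split; first split.
- by rewrite linearB /= !VT.
- move=> w; rewrite mulmxBr mulmxBl.
  have subE (A B : 'M[R]_1) : (A - B) 0 0 = A 0 0 - B 0 0 by rewrite !mxE.
  rewrite subE.
  rewrite !quad_Vx -sumrB; apply: sumr_ge0 => i iN.
  by rewrite -mulrBl mulr_ge0 ?sqr_ge0 // subr_ge0 ltW // limit_coef_decr.
move=> E; have N1 : (0 < N.-1)%N by rewrite -ltnS prednK // ltnW.
(* By biorthogonality v_{i0} isolates one coefficient; index 0 is below N - 1 since N >= 2. *)
pose i0 : 'I_N := Ordinal (ltnW hN).
have quad al : ((v i0)^T *m Vx lambda u a al *m v i0) 0 0 = limit_coef al i0.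
  have dotE i : dot (v i0) (u i) = (i == i0)%:R.
    by rewrite -(biorthonormal spec) mxE; apply: eq_bigr => j _; rewrite mxE mulrC.
  rewrite quad_Vx (bigD1 i0) //= big1 => [|i /andP[_ /negbTE ii0]].
    by rewrite dotE eqxx expr1n mulr1 addr0.
  by rewrite dotE ii0 expr0n mulr0.
have := limit_coef_decr al0 al12 (i := i0) N1.
by rewrite -!quad E ltxx.
Qed.

End LimitCovariance.

(** * Convergence in distribution of the normalized process *)

Section ConvergenceInDistribution.
Context (R : realType) (N D : nat) (P : 'M[R]_N) (mu : 'cV[R]_N).
Context (lambda : 'I_N -> R) (u v : 'I_N -> 'cV[R]_N) (alpha a : R).
Hypothesis chain : ergodic_reversible P mu.
Hypothesis spec : spectral_decomposition P mu lambda u v.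
Hypothesis alpha_ge0 : 0 <= alpha.
Context (x0 : 'cV[R]_N) (i0 : 'I_N).
Hypothesis x0_simplex : int_simplex x0.
Hypothesis a_gt : 2^-1 < a.
Hypothesis a_le1 : a <= 1.
Context (beta : nat -> R) (H : 'cV[R]_D -> 'I_N -> 'cV[R]_D) (theta0 : 'cV[R]_D).
Context (d : measure_display) (Omega : measurableType d) (Pr : probability Omega R).
Context (theta : nat -> Omega -> 'cV[R]_D) (x : nat -> Omega -> 'cV[R]_N).
Context (X : nat -> Omega -> 'I_N).
Hypothesis proc : sa_srrw P mu alpha beta (step_size a) H theta0 x0 i0 Pr theta x X.
Hypothesis x_compact : {ae Pr, forall w, exists2 C : set 'cV[R]_N,
  compact C /\ C `<=` @int_simplex R N & forall n, C (x n w)}.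

Local Notation g := (step_size a).
Local Notation xs := (xs a x0).
Local Notation pker := (pker P mu alpha a x0 i0).

Let k0 := pker_ge0 alpha chain i0 x0_simplex a_gt.
Let k1 := pker_sum1 alpha chain i0 x0_simplex a_gt.

Definition fluctuation (n : nat) (w : Omega) : 'cV[R]_N := (g n) `^ (- 2^-1) *: (x n w - mu).
Definition path_fluctuation (n : nat) (p : seq 'I_N) : 'cV[R]_N := (Num.sqrt (g n))^-1 *: (xs p - mu).

Lemma fluctuation_measurable n j : measurable_fun [set: Omega] (fun w => fluctuation n w j 0).
Proof.
rewrite (_ : (fun w => _) = (fun w => (g n) `^ (- 2^-1) * (x n w j 0 - mu j 0))); last first.
  by apply/funext => w; rewrite !mxE.
apply: measurable_funM; first exact: measurable_cst.
by apply: measurable_funB; [exact: (x_measurable proc n j)|exact: measurable_cst].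
Qed.

Lemma fluctuation_integral n (f : 'cV[R]_N -> R) : continuous f ->
  \int[Pr]_w f (fluctuation n w) = Ex pker n (fun p => f (path_fluctuation n p)).
Proof.
move=> cf; rewrite -[RHS]/(fine (Ex pker n (fun p => f (path_fluctuation n p)))%:E).
rewrite -(integral_path proc); congr fine.
apply: ae_eq_integral => //.
- by apply/measurable_EFinP; exact: (rv_comp_measurable (fluctuation_measurable n) cf).
- by apply/measurable_EFinP; exact: (measurable_path_fun proc n (fun p => f (path_fluctuation n p))).
- apply: filterS (ae_path proc) => w [_ xw] _; congr (f _)%:E.
  rewrite /fluctuation /path_fluctuation powRN powR12_sqrt ?step_size_ge0 //.
  by rewrite xw.
Qed.

Lemma clt_varE (t : 'cV[R]_N) : clt_var lambda alpha a (fun i => \sum_j t j 0 * u i j 0) =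
  (t^T *m Vx lambda u a alpha *m t) 0 0.
Proof.
rewrite quad_Vx; apply: eq_bigr => i _; rewrite /limit_coef -/(dot t (u i)) [LHS]mulrC; congr (_ * _).
rewrite mulrC /slope /rate; congr (_^-1 * _); ring.
Qed.

Lemma fluctuation_cvg : exists nu : probability (borel_cV R N) R,
  centered_normal_law (Vx lambda u a alpha) nu /\ cvg_in_distribution Pr fluctuation nu.
Proof.
(* These scaled eigenvectors make the sum of the squares <t, w>^2 equal to the quadratic form of
   [Vx]. *)
pose ws := [seq Num.sqrt (limit_coef lambda a alpha i) *: u i | i <- [seq i <- enum 'I_N | ((i : 'I_N) < N.-1)%N]].
have [nu hnu] := gaussian_law ws.
have {}hnu (t : 'cV[R]_N) (phi : R) : \int[nu]_z cos (dot t z + phi) =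
    cos phi * expR (- ((t^T *m Vx lambda u a alpha *m t) 0 0 / 2)).
  rewrite hnu quad_Vx; congr (_ * expR (- (_ / 2))).
  rewrite big_map big_filter big_enum_cond /=; apply: eq_bigr => i iN.
  have -> : dot t (Num.sqrt (limit_coef lambda a alpha i) *: u i) =
      Num.sqrt (limit_coef lambda a alpha i) * dot t (u i).
    by rewrite /dot mulr_sumr; apply: eq_bigr => j _; rewrite mxE mulrCA.
  by rewrite exprMn sqr_sqrtr // ltW // (limit_coef_gt0 a spec).
have V0 (t : 'cV[R]_N) : 0 <= (t^T *m Vx lambda u a alpha *m t) 0 0.
  by rewrite quad_Vx; apply: sumr_ge0 => i iN; rewrite mulr_ge0 ?sqr_ge0 // ltW // (limit_coef_gt0 a spec).
exists nu; split; first exact: gaussian_centered.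
have mid := @coord_borel_measurable R N.
have cg n : 0 < Num.sqrt (g n) by rewrite sqrtr_gt0 step_size_gt0.
move=> f cf [M hM].
have bf : bcont f by split => //; exists M.
apply: (@levy_continuity R N (fun n f => \int[Pr]_w f (fluctuation n w)) (fun f => \int[nu]_z f z)) => //.
- by move=> n; exact: (rv_mean Pr (fluctuation_measurable n)).
- exact: (rv_mean nu mid).
- move=> e e0; have [L L0 hL] := path_tight chain spec alpha_ge0 x0_simplex a_gt a_le1 proc x_compact e0.
  exists L => //; apply: filterS hL => n; apply: le_trans.
  rewrite (fluctuation_integral n (cutoff_bcont N L).1); apply: (Ex_le k0) => p _.
  have nE : `|path_fluctuation n p| = `|xs p - mu| / Num.sqrt (g n).
    by rewrite /path_fluctuation normrZ ger0_norm ?invr_ge0 ?(ltW (cg n)) // mulrC.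
  case: ltP => h; first by case/andP: (clip_half (`|path_fluctuation n p| / L - 3 / 2)).
  by rewrite cutoff_eq0 // nE ler_pdivrMr.
- by move=> e e0; exact: (rv_tight nu mid e0).
- move=> t phi; rewrite hnu; apply/cvgrPdist_le => e e0.
  have := charfn_cvg chain spec alpha_ge0 x0_simplex a_gt a_le1 proc x_compact t phi e0.
  apply: filterS => n; rewrite clt_varE distrC; apply: le_trans.
  rewrite (fluctuation_integral n (bcont_cos t phi).1) le_eqVlt; apply/orP; left; apply/eqP.
  congr `|_ - _|; apply: (Ex_ext k0) => p _; congr (cos (_ + _)).
  by rewrite /dot /path_fluctuation mulr_suml; apply: eq_bigr => j _; rewrite !mxE; ring.
Qed.

End ConvergenceInDistribution.
Theorem lemma3p1 (R : realType) (N D : nat) (hN : (2 <= N)%N)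
    (P : 'M[R]_N) (mu : 'cV[R]_N)
    (lambda : 'I_N -> R) (u v : 'I_N -> 'cV[R]_N)
    (chain : ergodic_reversible P mu)
    (spec : spectral_decomposition P mu lambda u v)
    (alpha : R) (alpha_ge0 : 0 <= alpha)
    (H : 'cV[R]_D -> 'I_N -> 'cV[R]_D)
    (A1_cont : forall i, continuous (fun th : 'cV[R]_D => H th i))
    (A1_growth : exists2 L : R, 0 < L &
       forall (th : 'cV[R]_D) (i : 'I_N), `|H th i| <= L * (1 + `|th|))
    (a b : R) (A2_a : 2^-1 < a <= 1) (A2_b : 2^-1 < b <= 1)
    (d : measure_display) (Omega : measurableType d)
    (Pr : 'cV[R]_D -> 'cV[R]_N -> 'I_N -> probability Omega R)
    (theta : nat -> Omega -> 'cV[R]_D) (x : nat -> Omega -> 'cV[R]_N)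
    (X : nat -> Omega -> 'I_N)
    (process : forall theta0 x0 i0, int_simplex x0 ->
       sa_srrw P mu alpha (step_size b) (step_size a) H theta0 x0 i0
         (Pr theta0 x0 i0) theta x X)
    (A4 : forall theta0 x0 i0, int_simplex x0 ->
       {ae Pr theta0 x0 i0, forall w,
          exists2 C : set 'cV[R]_D, compact C & forall n, C (theta n w)} /\
       {ae Pr theta0 x0 i0, forall w,
          exists2 C : set 'cV[R]_N, compact C /\ C `<=` @int_simplex R N &
            forall n, C (x n w)}) :
  (forall theta0 x0 i0, int_simplex x0 ->
     {ae Pr theta0 x0 i0, forall w, x n w @[n --> \oo] --> mu} /\
     exists nu : probability (borel_cV R N) R,
       centered_normal_law (Vx lambda u a alpha) nu /\
       cvg_in_distribution (Pr theta0 x0 i0)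
         (fun n w => (step_size a n) `^ (- 2^-1) *: (x n w - mu)) nu) /\
  (forall alpha1 alpha2 : R, 0 < alpha1 -> alpha1 < alpha2 ->
     loewner_lt (Vx lambda u a alpha2) (Vx lambda u a alpha1) /\
     loewner_lt (Vx lambda u a alpha1) (Vx lambda u a 0)).

Proof.
have /andP[a_gt a_le1] := A2_a.
split=> [theta0 x0 i0 x0_simplex|alpha1 alpha2 al1 al12].
  have proc := process theta0 x0 i0 x0_simplex.
  have [_ x_compact] := A4 theta0 x0 i0 x0_simplex.
  split; first exact: (ae_cvg_mu chain alpha_ge0 x0_simplex a_gt a_le1 proc x_compact).
  exact: (fluctuation_cvg chain spec alpha_ge0 x0_simplex a_gt a_le1 proc x_compact).
by split; apply: (Vx_decreasing a spec hN) => //; exact: ltW.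
Qed.
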